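(* Let $\mu,\nu\in\mathcal{P}_2(\mathbb{R}^d)$ have the same barycentre, $[\mu]=[\nu]$, and put $f=\nu-\mu$. Let $$\mathcal{I}(f)=\sup\Big\{\int u\,d\nu-\int u\,d\mu \;:\; u\in C^{1,1}(\mathbb{R}^d),\ \mathrm{lip}(\nabla u)\le 1\Big\},$$ $$\mathcal{J}(\mu,\nu)=\inf\Big\{\iiint c(x,y,z)\,\pi(dxdydz)\;:\;\pi\in\Sigma(\mu,\nu)\Big\},\qquad c(x,y,z)=\tfrac12\big(|z-x|^2+|z-y|^2\big).$$ Then: (i) $\mathcal{I}(f)=\mathcal{J}(\mu,\nu)$, and there exist $u$ attaining the supremum in $\mathcal{I}(f)$ and $\pi$ attaining the infimum in $\mathcal{J}(\mu,\nu)$; (ii) an admissible pair $(u,\pi)$ (i.e. $u\in C^{1,1}(\mathbb{R}^d)$ with $\mathrm{lip}(\nabla u)\le1$ and $\pi\in\Sigma(\mu,\nu)$) is optimal for both problems if and only if $$[u(y)+\langle\nabla u(y),z-y\rangle]-[u(x)+\langle\nabla u(x),z-x\rangle]=c(x,y,z)\quad\text{for }\pi\text{-a.e. }(x,y,z).$$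
   Context: $\mathcal{P}_2(\mathbb{R}^k)$ denotes Borel probability measures on $\mathbb{R}^k$ with finite second moment; $[\mu]=\int x\,\mu(dx)$ is the barycentre. $\mathrm{lip}(v)$ is the Lipschitz constant of $v$. $\Sigma(\mu,\nu)$ is the set of $\pi\in\mathcal{P}_2((\mathbb{R}^d)^3)$ whose first marginal is $\mu$, whose second marginal is $\nu$, and such that $\iiint\langle z-x,\Phi(x)\rangle\,\pi(dxdydz)=\iiint\langle z-y,\Psi(y)\rangle\,\pi(dxdydz)=0$ for all smooth compactly supported test maps $\Phi,\Psi:\mathbb{R}^d\to\mathbb{R}^d$. *)

(* Defs.v *)
From HB Require Import structures.
From mathcomp Require Import all_boot all_order all_algebra.
From mathcomp Require Import all_classical all_reals all_analysis.
Set Implicit Arguments. Unset Strict Implicit. Unset Printing Implicit Defensive.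
Import Order.TTheory GRing.Theory Num.Theory.
Import numFieldNormedType.Exports.
Local Open Scope classical_set_scope.
Local Open Scope ring_scope.

Section Defs.
Variable R : realType.

(** R^d is modelled by row vectors 'rV[R]_d with the Euclidean inner product
    and norm (the library's default norm on matrices is the max-norm, so the
    Euclidean structure is defined explicitly here). *)
Definition dotv d (x y : 'rV[R]_d) : R := \sum_(i < d) x ord0 i * y ord0 i.
Definition enorm d (x : 'rV[R]_d) : R := Num.sqrt (dotv x x).

Definition Rd (d : nat) := g_sigma_algebraType (@open 'rV[R]_d).

Definition grad d (u : 'rV[R]_d -> R) (x : 'rV[R]_d) : 'rV[R]_d :=
  \row_(i < d) ('d u x (delta_mx ord0 i : 'rV[R]_d)).

Definition C11_lip1 d (u : 'rV[R]_d -> R) : Prop :=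
  (forall x, differentiable u x) /\
  (forall x y, enorm (grad u x - grad u y) <= enorm (x - y)).

Fixpoint Ck (U V : normedModType R) (k : nat) (f : U -> V) : Prop :=
  match k with
  | 0%N => continuous f
  | k'.+1 => (forall x, differentiable f x) /\
             (forall v : U, Ck k' (fun x => 'd f x v))
  end.
Definition smooth (U V : normedModType R) (f : U -> V) : Prop :=
  forall k, Ck k f.

Definition compact_support d (Phi : 'rV[R]_d -> 'rV[R]_d) : Prop :=
  compact (closure [set x | Phi x != 0]).

Definition test_map d (Phi : 'rV[R]_d -> 'rV[R]_d) : Prop :=
  smooth Phi /\ compact_support Phi.

Definition finite_second_moment d (mu : probability (Rd d) R) : Prop :=
  mu.-integrable setT (fun x : Rd d => ((enorm (x : 'rV[R]_d)) ^+ 2)%:E).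

Definition same_barycentre d (mu nu : probability (Rd d) R) : Prop :=
  forall i : 'I_d,
    (\int[mu]_x ((x : 'rV[R]_d) ord0 i)%:E = \int[nu]_x ((x : 'rV[R]_d) ord0 i)%:E)%E.

Definition T3 d := (Rd d * Rd d * Rd d)%type.
Definition px d (p : T3 d) : 'rV[R]_d := p.1.1.
Definition py d (p : T3 d) : 'rV[R]_d := p.1.2.
Definition pz d (p : T3 d) : 'rV[R]_d := p.2.

Definition finite_second_moment3 d (pi : probability (T3 d) R) : Prop :=
  pi.-integrable setT (fun p : T3 d =>
    ((enorm (px p)) ^+ 2 + (enorm (py p)) ^+ 2 + (enorm (pz p)) ^+ 2)%:E).

Definition Sigma d (mu nu : probability (Rd d) R) (pi : probability (T3 d) R)
  : Prop :=
  finite_second_moment3 pi /\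
  (forall A : set (Rd d), measurable A -> pi ((fun p : T3 d => p.1.1) @^-1` A) = mu A) /\
  (forall A : set (Rd d), measurable A -> pi ((fun p : T3 d => p.1.2) @^-1` A) = nu A) /\
  (forall Phi Psi : 'rV[R]_d -> 'rV[R]_d, test_map Phi -> test_map Psi ->
     (\int[pi]_p (dotv (pz p - px p) (Phi (px p)))%:E = 0)%E /\
     (\int[pi]_p (dotv (pz p - py p) (Psi (py p)))%:E = 0)%E).

Definition cost d (x y z : 'rV[R]_d) : R :=
  2^-1 * ((enorm (z - x)) ^+ 2 + (enorm (z - y)) ^+ 2).

Definition Iobj d (mu nu : probability (Rd d) R) (u : 'rV[R]_d -> R) : \bar R :=
  (\int[nu]_x (u x)%:E - \int[mu]_x (u x)%:E)%E.

Definition Ival d (mu nu : probability (Rd d) R) : \bar R :=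
  ereal_sup [set Iobj mu nu u | u in @C11_lip1 d].

Definition Jobj d (pi : probability (T3 d) R) : \bar R :=
  (\int[pi]_p (cost (px p) (py p) (pz p))%:E)%E.

Definition Jval d (mu nu : probability (Rd d) R) : \bar R :=
  ereal_inf [set Jobj pi | pi in @Sigma d mu nu].

End Defs.

(* Main.v *)
(* Write gap u for the integral of u against nu - mu. A function u lies in C^{1,1} with
   lip (grad u) <= 1 iff |u z - u x - <g x, z - x>| <= |z - x|^2/2 for some g (then
   g = grad u). Hence
     [u y + <grad u y, z - y>] - [u x + <grad u x, z - x>] <= c(x,y,z),
   and integrating against pi in Sigma(mu, nu), where the gradient terms vanish by the
   martingale constraints, gives gap u <= J; equality means equality pi-a.e.

   A maximiser of gap is a pointwise limit of normalised jets (u 0 = 0, grad u 0 = 0)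
   along an ultrafilter. Let I be the maximum of gap. On functions f of (x,y,z) of
   quadratic growth consider
     p(f) = inf { int phi dmu + int psi dnu + t I },
   over t >= 0 and phi, psi, Phi, Psi such that
     f <= phi(x) + psi(y) + <Phi(x), z - x> + <Psi(y), z - y> + t c(x,y,z).
   If f >= 0 then p(f) >= 0: dividing by t, the right-hand side is nonnegative exactly when
   the lower paraboloids built from (-psi, -Psi) lie below the upper paraboloids built
   from (phi, Phi), so some admissible u satisfies -psi <= u <= phi, and gap u <= I.
   Thus p is a finite sublinear functional, and a linear L <= p is positive, has
   marginals mu and nu, kills the martingale terms and satisfies L c <= I. Since L
   integrates |x|^2 + |y|^2 + |z|^2, it is tight, hence represented on bounded continuous
   functions by a probability measure pi, which belongs to Sigma(mu, nu) and has cost <= I. *)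

Require Import Defs.
From HB Require Import structures.
From mathcomp Require Import all_boot all_order all_algebra.
From mathcomp Require Import all_classical all_reals all_analysis.
From mathcomp Require Import measurable_realfun ring lra.
Set Implicit Arguments. Unset Strict Implicit. Unset Printing Implicit Defensive.
Import Order.TTheory GRing.Theory Num.Theory.
Import numFieldNormedType.Exports.
Local Open Scope classical_set_scope.
Local Open Scope ring_scope.

(** * C^{1,1} functions as quadratic jets *)

(** The obstacle is growth. Cost and second moments are quadratic, whereas a positive functional is
    represented by a measure only on bounded continuous functions, and part of its mass on larger
    functions may sit at infinity. Three regimes result: equality on bounded functions; equality
    still when [f^2] is at most a multiple of 1 + |x|^2 + |y|^2 + |z|^2, which covers the drifts
    tested against bounded maps; only an inequality for nonnegative quadratic functions. That
    inequality points the right way: moments must be finite and the cost at most I, while weak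
    duality supplies the converse. Weak duality has its own growth problem: it integrates the drift
    against grad u, which is neither smooth nor compactly supported, so the constraints are extended
    from bump functions to measurable integrands. Building the value I into p turns the absence of a
    duality gap into nonnegativity of p on nonnegative functions; dividing by t + e instead of t,
    with e > 0 arbitrary, covers the degenerate case t = 0. *)

Section Euclid.
Context {R : realType} {d : nat}.
Implicit Types (x y z : 'rV[R]_d) (a : R).

Lemma dotvC x y : dotv x y = dotv y x.
Proof. by apply: eq_bigr => i _; rewrite mulrC. Qed.

Lemma dotvDr x y z : dotv x (y + z) = dotv x y + dotv x z.
Proof. by rewrite -big_split; apply: eq_bigr => i _; rewrite mxE mulrDr. Qed.

Lemma dotvZr a x y : dotv x (a *: y) = a * dotv x y.
Proof. by rewrite big_distrr; apply: eq_bigr => i _ /=; rewrite mxE mulrCA. Qed.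

Lemma dotvDl x y z : dotv (x + y) z = dotv x z + dotv y z.
Proof. by rewrite dotvC dotvDr !(dotvC z). Qed.

Lemma dotvZl a x y : dotv (a *: x) y = a * dotv x y.
Proof. by rewrite dotvC dotvZr dotvC. Qed.

Lemma dotvNr x y : dotv x (- y) = - dotv x y.
Proof. by rewrite -scaleN1r dotvZr mulN1r. Qed.

Lemma dotvNl x y : dotv (- x) y = - dotv x y.
Proof. by rewrite dotvC dotvNr dotvC. Qed.

Lemma dotv0r x : dotv x 0 = 0.
Proof. by rewrite -(scale0r 0) dotvZr mul0r. Qed.

Lemma dotv0l x : dotv 0 x = 0.
Proof. by rewrite dotvC dotv0r. Qed.

Definition dotvE := (dotvDr, dotvDl, dotvNr, dotvNl, dotvZr, dotvZl).

Lemma dotv_ge0 x : 0 <= dotv x x.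
Proof. by apply: sumr_ge0 => i _; rewrite -expr2 sqr_ge0. Qed.

Lemma enorm_sq x : enorm x ^+ 2 = dotv x x.
Proof. by rewrite sqr_sqrtr// dotv_ge0. Qed.

Lemma ler_enorm x y : (enorm x <= enorm y) = (dotv x x <= dotv y y).
Proof. by rewrite ler_sqrt// dotv_ge0. Qed.

Lemma dotv_delta x (i : 'I_d) : dotv x (delta_mx ord0 i) = x ord0 i.
Proof.
rewrite /dotv (bigD1 i)//= big1 ?addr0 ?mxE ?eqxx ?mulr1// => j ji.
by rewrite mxE (negbTE ji) andbF mulr0.
Qed.

Lemma coord_sq_le x (i : 'I_d) : x ord0 i ^+ 2 <= dotv x x.
Proof.
rewrite /dotv (bigD1 i)//= -expr2 lerDl; apply: sumr_ge0 => j _.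
by rewrite -expr2 sqr_ge0.
Qed.

Lemma coord_norm_le x (i : 'I_d) : `|x ord0 i| <= `|x|.
Proof.
rewrite [leRHS]/Num.norm /= mx_normrE; apply/bigmax_geP; right => /=.
by exists (ord0, i).
Qed.

(** Here [|x|] is the max-norm, in which differentiability and compactness are expressed; together
    with [norm_sq_le_dotv] this transfers Euclidean estimates to that norm and back. *)
Lemma dotv_le_norm x : dotv x x <= d%:R * `|x| ^+ 2.
Proof.
have -> : d%:R * `|x| ^+ 2 = \sum_(i < d) `|x| ^+ 2.
  by rewrite sumr_const card_ord mulr_natl.
apply: ler_sum => i _.
by rewrite -expr2 -real_normK ?num_real// lerXn2r ?nnegrE// coord_norm_le.
Qed.

Lemma norm_sq_le_dotv x : `|x| ^+ 2 <= dotv x x.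
Proof.
have [->|x0] := eqVneq x 0; first by rewrite normr0 expr0n dotv_ge0.
have /mx_norm_neq0[[i j] /= xij] : mx_norm x != 0 by rewrite -[mx_norm x]/`|x| normr_eq0.
rewrite [`|x|]xij ord1 real_normK ?num_real//; exact: coord_sq_le.
Qed.

(* Young's inequality, which replaces Cauchy-Schwarz throughout. *)
Lemma dotv_young a x y : 0 < a ->
  dotv x y <= 2^-1 * (a * dotv x x + a^-1 * dotv y y).
Proof.
move=> a0; have := dotv_ge0 (a *: x - y); rewrite !dotvE (dotvC y x).
move=> H; rewrite -(ler_pM2l a0) (_ : a * (_ * _) =
  2^-1 * (a * (a * dotv x x) + (a / a) * dotv y y)); last by ring.
by rewrite divff ?gt_eqF// mul1r; lra.
Qed.

Lemma dotv_abs x y : `|dotv x y| <= 2^-1 * (dotv x x + dotv y y).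
Proof.
have := dotv_young x y ltr01; have := dotv_young x (- y) ltr01.
by rewrite !dotvE invr1 !mul1r opprK => H1 H2; rewrite ler_norml; apply/andP; split; lra.
Qed.

Lemma dotvDD_le x y : dotv (x + y) (x + y) <= 2 * dotv x x + 2 * dotv y y.
Proof. by have := dotv_ge0 (x - y); rewrite !dotvE (dotvC y x); lra. Qed.

Lemma dotvBB_le x y : dotv (x - y) (x - y) <= 2 * dotv x x + 2 * dotv y y.
Proof. by have := dotvDD_le x (- y); rewrite (dotvNl y) dotvNr opprK. Qed.

Lemma dotv_linear_subproof x : linear (dotv x).
Proof. by move=> a y z; rewrite dotvDr dotvZr. Qed.
HB.instance Definition _ x := GRing.isLinear.Build R 'rV[R]_d R _ (dotv x)
  (dotv_linear_subproof x).

Lemma dotv_continuous x : continuous (dotv x).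
Proof.
rewrite /dotv; apply: continuous_big => [|i _ y].
  exact: add_continuous.
apply: continuousM; [exact: cst_continuous | exact: coord_continuous].
Qed.

End Euclid.

(** A quadratic remainder is little-o of [h]. The sign of [C] is left free, so precision [e] is
    reached on the radius [e / (|C| + 1)]. *)
Lemma quad_diff {R : realType} (V : normedModType R) (f : V -> R)
    (l : {linear V -> R}) (x : V) (C : R) : continuous l ->
  (forall h, `|f (x + h) - f x - l h| <= C * `|h| ^+ 2) ->
  differentiable f x /\ 'd f x = l :> (V -> R).
Proof.
move=> lc H.
have E : f \o shift x = cst (f x) + l +o_ 0 id.
  apply/eqaddoP => _/posnumP[e].
  have C0 : 0 < `|C| + 1 by rewrite ltr_wpDl.
  apply: filterS (nbhs0_le (divr_gt0 [gt0 of e%:num] C0)) => h he.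
  rewrite /= !fctE /= opprD addrA (addrC h).
  apply: le_trans (H h) _; rewrite expr2 mulrA.
  rewrite ler_wpM2r//.
  apply: (@le_trans _ _ ((`|C| + 1) * `|h|)).
    by rewrite ler_wpM2r// (le_trans (ler_norm _))// lerDl.
  by rewrite mulrC -ler_pdivlMr.
have D := diff_unique lc E; split => //.
by apply/diff_locallyP; rewrite D; split.
Qed.

Section QuadJet.
Context {R : realType} {d : nat}.
Implicit Types (u : 'rV[R]_d -> R) (g : 'rV[R]_d -> 'rV[R]_d) (x y z : 'rV[R]_d).

(** Derivative-free form of [C11_lip1]: it passes directly to pointwise limits of the pair
    [(u, g)]. *)
Definition quad_jet u g := forall x z,
  `|u z - u x - dotv (g x) (z - x)| <= 2^-1 * dotv (z - x) (z - x).

Lemma quad_jet_diff u g : quad_jet u g ->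
  forall x, differentiable u x /\ 'd u x = dotv (g x) :> ('rV[R]_d -> R).
Proof.
move=> Q x; apply: (@quad_diff _ _ u (dotv (g x)) x (2^-1 * d%:R)).
  exact: dotv_continuous.
move=> h; have := Q x (x + h); rewrite [x + h - x]addrAC subrr add0r => /le_trans; apply.
by rewrite -mulrA ler_wpM2l ?invr_ge0//; exact: dotv_le_norm.
Qed.

Lemma quad_jet_grad u g : quad_jet u g -> grad u = g.
Proof.
move=> Q; apply/funext => x; apply/rowP => i; rewrite mxE.
by rewrite (quad_jet_diff Q x).2 dotv_delta.
Qed.

(* Testing the two paraboloids at the points (x+y)/2 +- (g y - g x)/2 yields
   the sharp constant 1. *)
Lemma quad_jet_lip u g : quad_jet u g ->
  forall x y, dotv (g x - g y) (g x - g y) <= dotv (x - y) (x - y).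
Proof.
move=> Q x y.
set D := g y - g x.
pose z := 2^-1 *: (x + y) + 2^-1 *: D; pose w := 2^-1 *: (x + y) - 2^-1 *: D.
have := Q x z; have := Q y z; have := Q x w; have := Q y w.
have : dotv (z - x) (z - x) + dotv (z - y) (z - y) + dotv (w - x) (w - x)
     + dotv (w - y) (w - y) = dotv (x - y) (x - y) + dotv D D.
  rewrite /z /w; clear z w; clearbody D.
  rewrite !(dotvDl, dotvNl, dotvZl).
  rewrite !(dotvDr, dotvNr, dotvZr) (dotvC y x) (dotvC x D) (dotvC y D).
  by field.
have : dotv (g y) (z - y) - dotv (g y) (w - y) - dotv (g x) (z - x)
     + dotv (g x) (w - x) = dotv D D.
  have -> : dotv (g y) (z - y) - dotv (g y) (w - y) - dotv (g x) (z - x)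
     + dotv (g x) (w - x) = dotv D (z - w).
    by rewrite !dotvE; ring.
  have -> : z - w = D.
    by apply/rowP => i; rewrite /z /w !mxE; field.
  by [].
rewrite -[g x - g y]opprB -/D dotvNl dotvNr opprK !ler_norml.
by move=> E1 E2 /andP[A1 A2] /andP[A3 A4] /andP[A5 A6] /andP[A7 A8]; lra.
Qed.

Lemma quad_jet_C11 u g : quad_jet u g -> C11_lip1 u.
Proof.
move=> Q; split=> [x|x y]; first exact: (quad_jet_diff Q x).1.
by rewrite (quad_jet_grad Q) ler_enorm; exact: quad_jet_lip.
Qed.

Lemma diff_grad u x : 'd u x = dotv (grad u x) :> ('rV[R]_d -> R).
Proof.
apply/funext => v; rewrite {1}(row_sum_delta v) linear_sum /dotv.
by apply: eq_bigr => i _; rewrite linearZ /= mxE mulrC.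
Qed.

(** Along the segment, [h] is [u] minus its tangent at [x] and minus a paraboloid of unit curvature.
    Its derivative is nonpositive, and [h 1 <= h 0] is the claim. *)
Lemma C11_upper u : C11_lip1 u -> forall x z,
  u z - u x - dotv (grad u x) (z - x) <= 2^-1 * dotv (z - x) (z - x).
Proof.
move=> [du lip] x z; set v := z - x.
pose c := dotv v v; pose b := dotv (grad u x) v.
pose h (t : R) : R := u (x + t *: v) - t * b - 2^-1 * t ^+ 2 * c.
have dl (t : R) : is_diff t (fun s : R => x + s *: v) ( *:%R^~ v).
  have := @is_diffD _ _ _ _ _ _ _ t (is_diff_cst x t) (is_diff_scalel t v).
  by rewrite add0r.
have dh (t : R) : is_derive t 1 h (dotv (grad u (x + t *: v) - grad u x) v - t * c).
  have d1 : is_derive t 1 (fun s : R => u (x + s *: v)) (dotv (grad u (x + t *: v)) v).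
    have D : is_diff t (u \o (fun s : R => x + s *: v)) ('d u (x + t *: v) \o ( *:%R^~ v)).
      apply: is_diff_comp; exact: differentiableP.
    split; first by apply/derivable1_diffP; case: D.
    rewrite deriveE; last by case: D.
    by rewrite diff_val /= scale1r diff_grad.
  have d2 : is_derive t 1 (fun s : R => s * b) b.
    have M := @is_deriveM R R id (cst b) t 1 1 0 (is_derive_id _ _) (is_derive_cst _ _ _).
    have E : t *: 0 + cst b t *: 1 = b :> R.
      by rewrite scaler0 add0r /cst [_ *: _]mulr1.
    by rewrite E in M.
  have d3 : is_derive t 1 (fun s : R => 2^-1 * s ^+ 2 * c) (t * c).
    have M := @is_deriveZ R R _ (id ^+ 2) (2^-1 * c) t 1 _
      (@is_deriveX R R id 2 t 1 1 (is_derive_id _ _)).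
    have E : (2^-1 * c) *: ((2%:R * t ^+ 1) *: 1) = t * c :> R.
      by rewrite /GRing.scale /= expr1; field.
    rewrite E in M.
    have EF : (2^-1 * c) \*: (id ^+ 2) = (fun s : R => 2^-1 * s ^+ 2 * c).
      by apply/funext => s; rewrite /= /GRing.scale /= fctE; ring.
    by rewrite EF in M.
  have M := is_deriveB (is_deriveB d1 d2) d3.
  by rewrite dotvDl dotvNl.
have : h 1 <= h 0.
  apply: (@ler0_derive1_le_cc R h 0 1); rewrite ?in_itv/= ?lexx ?ler01//.
  - move=> t; rewrite in_itv/= => /andP[t0 t1]; rewrite derive1E derive_val subr_le0.
    set D := grad u _ - _.
    (* Young's inequality with weight [1/t] loses nothing here: [D] has length at most [t |v|], so
       each of the two halves is at most [t c / 2]. *)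
    have ti : 0 < t^-1 by rewrite invr_gt0.
    apply: le_trans (dotv_young _ _ ti) _; rewrite invrK.
    have : dotv D D <= t ^+ 2 * c.
      have := lip (x + t *: v) x; rewrite ler_enorm => /le_trans; apply.
      by rewrite [x + _]addrC addrK dotvZl dotvZr mulrA expr2.
    move=> H; have : t^-1 * dotv D D <= t * c.
      by rewrite mulrC ler_pdivrMr// mulrAC -expr2.
    by rewrite -/c; lra.
  - by apply: continuous_subspaceT => t; apply: differentiable_continuous; apply/derivable1_diffP; case: (dh t).
rewrite /h scale1r scale0r addr0 mul0r !mul1r expr0n expr1n mulr0 mul0r !subr0 mulr1.
have -> : x + v = z by rewrite addrC subrK.
by rewrite -/b -/c; lra.
Qed.

Lemma gradN u x : differentiable u x -> grad (fun x => - u x) x = - grad u x.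
Proof.
move=> du; apply/rowP => i; rewrite !mxE.
by have := diffN du => /(congr1 (@^~ (delta_mx ord0 i))).
Qed.

Lemma C11N u : C11_lip1 u -> C11_lip1 (fun x => - u x).
Proof.
move=> [du lip]; split=> [x|x y]; first exact: differentiableN.
rewrite !gradN//; apply: le_trans (lip x y); rewrite ler_enorm.
by rewrite -opprD dotvNl dotvNr opprK.
Qed.

(** The lower paraboloid for [u] is the upper one for [- u]. *)
Lemma C11_quad_jet u : C11_lip1 u -> quad_jet u (grad u).
Proof.
move=> cu x z; rewrite ler_norml; apply/andP; split; last exact: C11_upper.
have := C11_upper (C11N cu) x z; rewrite gradN; last exact: cu.1.
by rewrite dotvNl; lra.
Qed.

End QuadJet.

(** * Insertion between paraboloids *)

Lemma le_small_eq0 {R : realType} (a C : R) :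
  (forall t, 0 < t -> `|a| <= C * t) -> a = 0.
Proof.
move=> H; apply/eqP; rewrite -normr_le0; apply/ler_addgt0Pl => e e0.
rewrite addr0; have C0 : 0 < `|C| + 1 by rewrite ltr_wpDl.
apply: le_trans (H _ (divr_gt0 e0 C0)) _.
rewrite mulrA ler_pdivrMr// mulrC ler_wpM2l ?(ltW e0)//.
by rewrite (le_trans (ler_norm _))// lerDl.
Qed.

Section Insertion.
Context {R : realType} {d : nat}.
Implicit Types (u v : 'rV[R]_d -> R) (x y z e w : 'rV[R]_d).

(** Convexity of [u + |.|^2 / 2] along segments, expanded; [semiconcave] is likewise concavity of
    [u - |.|^2 / 2]. *)
Definition semiconvex u := forall x e (t : R), 0 <= t -> t <= 1 ->
  u (x + t *: e) <= (1 - t) * u x + t * u (x + e) + 2^-1 * (t * (1 - t)) * dotv e e.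

Definition semiconcave u := forall x e (t : R), 0 <= t -> t <= 1 ->
  (1 - t) * u x + t * u (x + e) - 2^-1 * (t * (1 - t)) * dotv e e <= u (x + t *: e).

(** Two difference quotients [P s / s] and [P t / t] differ by at most [|t - s| |e|^2 / 2]. Hence
    every quotient minus its error lies below every quotient plus its error, and the supremum of the
    former serves as [l]. *)
Lemma directional_derivative u x e : semiconvex u -> semiconcave u ->
  exists l, forall t, 0 < t -> `|t * l - (u (x + t *: e) - u x)| <= 2^-1 * t ^+ 2 * dotv e e.
Proof.
move=> cx cv.
pose P t := u (x + t *: e) - u x.
have H r t : 0 <= r -> r <= 1 -> `|P (r * t) - r * P t| <= 2^-1 * (r * (1 - r)) * (t ^+ 2 * dotv e e).
  move=> r0 r1; have := cx x (t *: e) r r0 r1; have := cv x (t *: e) r r0 r1.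
  rewrite /P scalerA dotvZl dotvZr mulrA -expr2.
  set a := u _; set b := u (x + t *: e); set c := _ * (_ ^+ 2 * _).
  by move=> H1 H2; rewrite ler_norml; apply/andP; split; lra.
have HD s t : 0 < s -> s <= t -> `|s^-1 * P s - t^-1 * P t| <= 2^-1 * (t - s) * dotv e e.
  move=> s0 st; have t0 := lt_le_trans s0 st.
  have := H (s / t) t (ltW (divr_gt0 s0 t0)); rewrite ler_pdivrMr// mul1r => /(_ st).
  rewrite divfK ?gt_eqF// => Hs.
  rewrite -(ler_pM2l s0) -{1}(gtr0_norm s0) -normrM.
  have -> : s * (s^-1 * P s - t^-1 * P t) = P s - s / t * P t.
    by rewrite mulrBr mulrA divff ?gt_eqF// mul1r mulrA.
  apply: le_trans Hs _; rewrite le_eqVlt; apply/orP; left; apply/eqP.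
  by field; rewrite gt_eqF.
pose S := [set t^-1 * P t - 2^-1 * t * dotv e e | t in [set t : R | 0 < t]].
have US s t : 0 < s -> 0 < t ->
    s^-1 * P s - 2^-1 * s * dotv e e <= t^-1 * P t + 2^-1 * t * dotv e e.
  move=> s0 t0; have e0 := dotv_ge0 e.
  have se := mulr_ge0 (ltW s0) e0; have te := mulr_ge0 (ltW t0) e0.
  have [st|/ltW ts] := leP s t.
  - have := HD s t s0 st; rewrite ler_norml => /andP[_]; lra.
  - have := HD t s t0 ts; rewrite ler_norml => /andP[]; lra.
have S0 : S !=set0 by exists (1^-1 * P 1 - 2^-1 * 1 * dotv e e); exists 1 => //=.
exists (sup S) => t t0.
have L : t^-1 * P t - 2^-1 * t * dotv e e <= sup S.
  apply: ub_le_sup; last by exists t.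
  by exists (1^-1 * P 1 + 2^-1 * 1 * dotv e e) => _ [s s0 <-]; exact: US.
have U : sup S <= t^-1 * P t + 2^-1 * t * dotv e e.
  by apply: ge_sup => // _ [s s0 <-]; exact: US.
have -> : t * sup S - (u (x + t *: e) - u x) = t * (sup S - t^-1 * P t).
  by rewrite /P; field; rewrite gt_eqF.
rewrite normrM gtr0_norm//.
have -> : 2^-1 * t ^+ 2 * dotv e e = t * (2^-1 * t * dotv e e) by ring.
by rewrite ler_pM2l// ler_norml; apply/andP; split; lra.
Qed.

(** The directional derivative is linear in the direction: positive homogeneity and midpoint
    additivity hold up to errors of order [t^2] against terms of order [t], hence exactly. *)
Lemma semi_quad_jet u : semiconvex u -> semiconcave u -> exists g, quad_jet u g.
Proof.
move=> cx cv.
suff H x : exists g, forall e, `|u (x + e) - u x - dotv g e| <= 2^-1 * dotv e e.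
  have [g Hg] := choice H; exists g => x z.
  by have := Hg x (z - x); rewrite [x + _]addrC subrK.
have [l Hl] := choice (fun e => directional_derivative x e cx cv).
have lZ c e : 0 < c -> l (c *: e) = c * l e.
  move=> c0; apply/eqP; rewrite -subr_eq0; apply/eqP.
  apply: (@le_small_eq0 _ _ (c ^+ 2 * dotv e e)) => t t0.
  rewrite -(ler_pM2l t0) -{1}(gtr0_norm t0) -normrM.
  have := Hl e (t * c) (mulr_gt0 t0 c0); have := Hl (c *: e) t t0.
  rewrite scalerA dotvZl dotvZr; set p := u _ - _.
  have -> : t * (l (c *: e) - c * l e) =
    (t * l (c *: e) - p) - (t * c * l e - p) by ring.
  move=> H1 H2; apply: le_trans (ler_normB _ _) _.
  apply: le_trans (lerD H1 H2) _; rewrite le_eqVlt; apply/orP; left; apply/eqP.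
  by field.
have lM e w : l (2^-1 *: (e + w)) = 2^-1 * (l e + l w).
  apply/eqP; rewrite -subr_eq0; apply/eqP.
  apply: (@le_small_eq0 _ _ (dotv e e + dotv w w)) => t t0.
  rewrite -(ler_pM2l t0) -{1}(gtr0_norm t0) -normrM.
  have h0 : (0 : R) <= 2^-1 by [].
  have h1 : (2^-1 : R) <= 1 by rewrite invf_le1// ler1n.
  have := Hl e t t0; have := Hl w t t0; have := Hl (2^-1 *: (e + w)) t t0.
  (* The point reached along [(e + w) / 2] is the midpoint of those reached along [e] and [w]; the
     two curvature bounds at 1/2 control the defect by [t^2 |w - e|^2 / 8]. *)
  have := cx (x + t *: e) (t *: (w - e)) 2^-1 h0 h1.
  have := cv (x + t *: e) (t *: (w - e)) 2^-1 h0 h1.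
  have -> : x + t *: e + 2^-1 *: (t *: (w - e)) = x + t *: (2^-1 *: (e + w)).
    by apply/rowP => i; rewrite !mxE; field.
  have -> : x + t *: e + t *: (w - e) = x + t *: w.
    by apply/rowP => i; rewrite !mxE; ring.
  have := dotvBB_le w e; have := dotvDD_le e w.
  rewrite !(dotvZl, dotvZr).
  move: (dotv (w - e) _) (dotv (e + w) _) => A B HB HA.
  have t2 : 0 <= t ^+ 2 by exact: sqr_ge0.
  have {}HA := ler_wpM2l t2 HA; have {}HB := ler_wpM2l t2 HB.
  have := mulr_ge0 t2 (dotv_ge0 e); have := mulr_ge0 t2 (dotv_ge0 w).
  move: HA HB; rewrite !mulrDr !expr2.
  move: (u (x + t *: (2^-1 *: (e + w)))) (u (x + t *: e)) (u (x + t *: w)) => a b c.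
  move: (l (2^-1 *: (e + w))) (l e) (l w) => l0 l1 l2.
  move: (dotv e e) (dotv w w) => E W HA HB E0 W0 H1 H2.
  rewrite !ler_norml => /andP[A1 A2] /andP[A3 A4] /andP[A5 A6].
  by apply/andP; split; lra.
have l0 : l 0 = 0.
  have p2 : (0 : R) < 2 by [].
  by have := lZ 2 0 p2; rewrite scaler0; lra.
have lN e : l (- e) = - l e.
  by have := lM e (- e); rewrite subrr scaler0 l0; lra.
have lZ' c e : l (c *: e) = c * l e.
  have [c0|c0|->] := ltgtP c 0; first last.
  - by rewrite scale0r mul0r.
  - exact: lZ.
  - rewrite -[c]opprK scaleNr lN lZ ?oppr_gt0//; ring.
have lD e w : l (e + w) = l e + l w.
  by have := lM e w; rewrite lZ'; lra.
exists (\row_i l (delta_mx ord0 i)) => e.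
have -> : dotv (\row_i l (delta_mx ord0 i)) e = l e.
  rewrite [in RHS](row_sum_delta e) /dotv.
  rewrite (big_morph l lD l0); apply: eq_bigr => i _.
  by rewrite mxE lZ' mulrC.
have := Hl e 1 ltr01; rewrite scale1r mul1r expr1n mulr1.
by rewrite distrC.
Qed.

(* The largest (-1)-convex minorant u of the upper paraboloids is (-1)-concave:
   averaging two translates of u gives a competitor in the supremum. *)
Lemma insertion (phi psi : 'rV[R]_d -> R) (p q : 'rV[R]_d -> 'rV[R]_d) :
  (forall x y z, phi y + dotv (p y) (z - y) - 2^-1 * dotv (z - y) (z - y) <=
     psi x + dotv (q x) (z - x) + 2^-1 * dotv (z - x) (z - x)) ->
  exists u, [/\ C11_lip1 u, forall y, phi y <= u y & forall x, u x <= psi x].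
Proof.
move=> H.
pose up x z := psi x + dotv (q x) (z - x) + 2^-1 * dotv (z - x) (z - x).
pose lo y z := phi y + dotv (p y) (z - y) - 2^-1 * dotv (z - y) (z - y).
pose V := [set v | semiconvex v /\ forall x z, v z <= up x z].
pose S z := [set v z | v in V].
pose u z := sup (S z).
(* A lower paraboloid satisfies the semiconvexity inequality with equality, and [H] places it below
   every [up x]; this makes [V] nonempty and yields [phi <= u]. *)
have Vlo y : V (lo y).
  split=> [x e t t0 t1|x z]; last exact: H.
  rewrite /lo.
  have -> : x + t *: e - y = (x - y) + t *: e by rewrite addrAC.
  have -> : x + e - y = (x - y) + e by rewrite addrAC.
  move: (x - y) (p y) => a b.
  rewrite !(dotvDl, dotvZl) !(dotvDr, dotvZr) (dotvC e a).
  by rewrite le_eqVlt; apply/orP; left; apply/eqP; field.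
have Sub v z : V v -> v z <= u z.
  move=> Vv; apply: ub_le_sup; last by exists v.
  by exists (up 0 z) => _ [w [_ Vw] <-]; exact: Vw.
have S0 z : S z !=set0 by exists (lo 0 z); exists (lo 0).
have uup x z : u z <= up x z.
  by apply: ge_sup => // _ [w [_ Vw] <-]; exact: Vw.
have ucx : semiconvex u.
  move=> x e t t0 t1; apply: ge_sup => // _ [v Vv <-].
  apply: le_trans (Vv.1 x e t t0 t1) _; rewrite !lerD2r.
  by rewrite lerD// ler_wpM2l ?subr_ge0//; exact: Sub.
have ucv : semiconcave u.
  move=> x e t t0 t1.
  (* The translates are chosen so that [v (x + t e)] is the left side of semiconcavity. For the
     paraboloid [up y] the same average exceeds the value at [w] by exactly the subtracted constant,
     so [v] stays below it. *)
  pose v w := (1 - t) * u (w - t *: e) + t * u (w + (1 - t) *: e)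
     - 2^-1 * (t * (1 - t)) * dotv e e.
  have Vv : V v.
    split=> [y f s s0 s1|y w].
      have t1' : 0 <= 1 - t by rewrite subr_ge0.
      have := ler_wpM2l t1' (ucx (y - t *: e) f s s0 s1).
      have := ler_wpM2l t0 (ucx (y + (1 - t) *: e) f s s0 s1).
      rewrite /v.
      rewrite (addrAC y (s *: f)) (addrAC y f) (addrAC y (s *: f)) (addrAC y f).
      move: (u _) (u _) (u _) (u _) (u _) (u _) (dotv f f) (dotv e e) => *; lra.
    have t1' : 0 <= 1 - t by rewrite subr_ge0.
    have := ler_wpM2l t1' (uup y (w - t *: e)).
    have := ler_wpM2l t0 (uup y (w + (1 - t) *: e)).
    rewrite /v /up.
    have -> : w - t *: e - y = (w - y) - t *: e by rewrite addrAC.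
    have -> : w + (1 - t) *: e - y = (w - y) + (1 - t) *: e by rewrite addrAC.
    move: (u _) (u _) (w - y) (q y) => a b c f.
    rewrite !(dotvDl, dotvNl, dotvZl) !(dotvDr, dotvNr, dotvZr) (dotvC e c).
    by move=> H1 H2; apply: le_trans (lerB (lerD H2 H1) (lexx _)) _;
      rewrite le_eqVlt; apply/orP; left; apply/eqP; field.
  have := Sub v (x + t *: e) Vv.
  rewrite /v addrK; congr (_ * _ + _ * u _ - _ <= _).
  by rewrite -addrA -scalerDl [t + _]addrC subrK scale1r.
have [g Q] := semi_quad_jet ucx ucv.
exists u; split; first exact: quad_jet_C11 Q.
- move=> y; have := Sub _ y (Vlo y); rewrite /lo subrr !dotv0r.
  by rewrite mulr0 subr0 addr0.
- by move=> x; have := uup x x; rewrite /up subrr !dotv0r mulr0 !addr0.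
Qed.

End Insertion.

(** * Integrals of real-valued functions *)

Section RealIntegrals.
Context d (T : measurableType d) (R : realType).
Variable P : probability T R.
Implicit Types (f g : T -> R).

Definition intg f := P.-integrable setT (EFin \o f).

Lemma intg_measurable f : intg f -> measurable_fun setT f.
Proof. by move=> /measurable_int /measurable_EFinP. Qed.

Lemma intg_le f g : measurable_fun setT f -> (forall x, `|f x| <= g x) ->
  intg g -> intg f.
Proof.
move=> mf fg; apply: le_integrable => //; first exact/measurable_EFinP.
by move=> x _ /=; rewrite lee_fin (le_trans (fg x))// ler_norm.
Qed.

Lemma intgD f g : intg f -> intg g -> intg (fun x => f x + g x).
Proof. by move=> If Ig; have := integrableD measurableT If Ig. Qed.

Lemma intgB f g : intg f -> intg g -> intg (fun x => f x - g x).
Proof. by move=> If Ig; have := integrableB measurableT If Ig. Qed.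

Lemma intgZ (k : R) f : intg f -> intg (fun x => k * f x).
Proof. by move=> If; have := integrableZl measurableT k If. Qed.

Lemma intg_cst (k : R) : intg (fun=> k).
Proof. exact: finite_measure_integrable_cst. Qed.

Lemma intg_sum I (s : seq I) (F : I -> T -> R) : (forall i, intg (F i)) ->
  intg (fun x => \sum_(i <- s) F i x).
Proof.
move=> IF; rewrite /intg.
rewrite (_ : EFin \o _ = (fun x => \sum_(i <- s) (F i x)%:E)%E).
  by apply: integrable_sum => // i _; exact: IF.
by apply/funext => x /=; rewrite sumEFin.
Qed.

Lemma EFin_Rintegral f : intg f ->
  (\int[P]_x (f x)%:E)%E = (\int[P]_x f x)%:E.
Proof. by move=> If; rewrite fineK// integrable_fin_num. Qed.

Lemma RintD f g : intg f -> intg g ->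
  \int[P]_x (f x + g x) = \int[P]_x f x + \int[P]_x g x.
Proof. exact: RintegralD. Qed.

Lemma RintB f g : intg f -> intg g ->
  \int[P]_x (f x - g x) = \int[P]_x f x - \int[P]_x g x.
Proof. exact: RintegralB. Qed.

Lemma RintZ (k : R) f : intg f -> \int[P]_x (k * f x) = k * \int[P]_x f x.
Proof. exact: RintegralZl. Qed.

Lemma Rint_cst (k : R) : \int[P]_x k = k.
Proof. rewrite Rintegral_cst; last exact: measurableT.
by transitivity (k * fine (1%E : \bar R));
  [congr (k * fine _); exact: probability_setT | rewrite mulr1]. Qed.

Lemma Rint_sum I (s : seq I) (F : I -> T -> R) : (forall i, intg (F i)) ->
  \int[P]_x (\sum_(i <- s) F i x) = \sum_(i <- s) \int[P]_x F i x.
Proof.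
move=> IF; elim: s => [|i s IH].
  by rewrite big_nil -[RHS](Rint_cst 0); apply: eq_Rintegral => x _; rewrite big_nil.
rewrite big_cons -IH -RintD//; last exact: intg_sum.
by apply: eq_Rintegral => x _; rewrite big_cons.
Qed.

Lemma Rint_le f g : intg f -> intg g -> (forall x, f x <= g x) ->
  \int[P]_x f x <= \int[P]_x g x.
Proof. by move=> If Ig fg; apply: le_Rintegral. Qed.

Lemma Rint_dominated (f_ : nat -> T -> R) f g :
  (forall n, measurable_fun setT (f_ n)) -> measurable_fun setT f ->
  (forall x, f_ ^~ x @ \oo --> f x) -> intg g ->
  (forall n x, `|f_ n x| <= g x) ->
  \int[P]_x f_ n x @[n --> \oo] --> \int[P]_x f x.
Proof.
move=> mf_ mf f_f Ig f_g.
have ff x : (EFin \o f_ ^~ x) @ \oo --> (f x)%:E.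
  by apply: cvg_EFin; [exact: nearW | exact: f_f].
have [If _ C] := @dominated_convergence _ T R P setT measurableT
  (fun n => EFin \o f_ n) (EFin \o f) (EFin \o g)
  (fun n => (measurable_EFinP _ _).2 (mf_ n)) ((measurable_EFinP _ _).2 mf)
  (aeW _ (fun x _ => ff x))
  Ig (aeW _ (fun x n _ => f_g n x)).
rewrite [X in _ --> X](EFin_Rintegral If) in C.
exact: fine_cvg C.
Qed.

End RealIntegrals.

(** * Existence of a maximiser *)

Lemma compact_norm_ball {R : realType} (d : nat) (r : R) :
  compact [set x : 'rV[R]_d | `|x| <= r].
Proof.
apply: bounded_closed_compact.
  exists r; split; first exact: num_real.
  by move=> M rM x /= /le_trans; apply; exact: ltW.
apply: (preimage_closed _ (@closed_le R r)) => x _.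
exact: norm_continuous.
Qed.

(** * Growth and integrability of C^{1,1} functions *)

Section Moments.
Context {R : realType} {d : nat}.
Implicit Types (u : 'rV[R]_d -> R) (g : 'rV[R]_d -> 'rV[R]_d) (x y z : 'rV[R]_d).

Lemma continuous_measurable_Rd (u : 'rV[R]_d -> R) : continuous u ->
  measurable_fun setT (u : Rd R d -> R).
Proof.
move=> /continuousP cu; apply: (measurability _ (RGenOpens.measurableE R)).
move=> _ [_ [a [b ->] <-]]; rewrite setTI; apply: sub_sigma_algebra.
exact/cu/interval_open.
Qed.

Lemma C11_continuous u : C11_lip1 u -> continuous u.
Proof. by move=> [du _] x; apply: differentiable_continuous. Qed.

Lemma dotv_sq_continuous : continuous (fun x : 'rV[R]_d => dotv x x).
Proof.
rewrite /dotv; apply: continuous_big => [|i _ y]; first exact: add_continuous.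
by apply: continuousM; exact: coord_continuous.
Qed.

Lemma jet_growth u g : quad_jet u g ->
  exists C, forall x, `|u x| <= C * (1 + dotv x x).
Proof.
move=> Q; exists (`|u 0| + dotv (g 0) (g 0) + 1) => x.
have := Q 0 x; rewrite subr0 => H.
have {}H := le_trans (ler_norm _) H; have H' := Q 0 x; rewrite subr0 ler_norml in H'.
case/andP: H' => H' _.
have := dotv_abs (g 0) x; rewrite ler_norml => /andP[H1 H2].
have := ler_norm (u 0); have := ler_norm (- u 0); rewrite normrN => N1 N2.
have g0 := dotv_ge0 (g 0); have x0 := dotv_ge0 x; have a0 := normr_ge0 (u 0).
have P1 := mulr_ge0 a0 x0; have P2 := mulr_ge0 g0 x0.
by rewrite ler_norml; apply/andP; split; rewrite !(mulrDl, mulrDr) ?mulr1 ?mul1r; lra.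
Qed.

Variable mu : probability (Rd R d) R.
Hypothesis mu2 : finite_second_moment mu.

Lemma intg_sq : intg mu (fun x => dotv x x).
Proof.
move: mu2; rewrite /finite_second_moment /intg.
by congr (mu.-integrable _ _); apply/funext => x /=; rewrite enorm_sq.
Qed.

Lemma intg_growth u C : continuous u ->
  (forall x, `|u x| <= C * (1 + dotv x x)) -> intg mu u.
Proof.
move=> cu uC; apply: (@intg_le _ _ _ mu u (fun x => C * (1 + dotv x x))) => //; first exact: continuous_measurable_Rd.
by apply: intgZ; apply: intgD; [exact: intg_cst | exact: intg_sq].
Qed.

Lemma intg_C11 u : C11_lip1 u -> intg mu u.
Proof.
move=> cu; have [C uC] := jet_growth (C11_quad_jet cu).
exact: intg_growth (C11_continuous cu) uC.
Qed.

Lemma intg_coord i : intg mu (fun x => x ord0 i).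
Proof.
apply: (@intg_growth _ 1); first exact: coord_continuous.
move=> x; have := coord_sq_le x i; have := dotv_ge0 x.
have := sqr_ge0 (x ord0 i - 1); have := sqr_ge0 (x ord0 i + 1); rewrite sqrrD sqrrB !expr1n !mulr1.
by move=> *; rewrite ler_norml; apply/andP; split; lra.
Qed.

Lemma intg_dotv a : intg mu (dotv a).
Proof. by apply: intg_sum => i; apply: intgZ; exact: intg_coord. Qed.

End Moments.

(** * Compactness of normalised jets and attainment of the supremum *)

Section Maximiser.
Context {R : realType} {d : nat}.
Implicit Types (u : 'rV[R]_d -> R) (g : 'rV[R]_d -> 'rV[R]_d) (x y z : 'rV[R]_d).

Definition normal_jet u g := [/\ quad_jet u g, u 0 = 0 & g 0 = 0].

Lemma normal_jet_le u g : normal_jet u g -> forall x, `|u x| <= 2^-1 * dotv x x.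
Proof. by move=> [Q u0 g0] x; have := Q 0 x; rewrite u0 g0 dotv0l !subr0. Qed.

Lemma normal_jet_grad_le u g : normal_jet u g -> forall x, dotv (g x) (g x) <= dotv x x.
Proof. by move=> [Q u0 g0] x; have := quad_jet_lip Q x 0; rewrite g0 !subr0. Qed.

(** The neighbourhood serves the whole class at once, which upgrades pointwise convergence to
    uniform convergence on balls. *)
Lemma normal_jet_equicont x (e : R) : 0 < e ->
  \forall x' \near x, forall u g, normal_jet u g -> `|u x' - u x| <= e.
Proof.
move=> e0.
have c0 : 0 < dotv x x + 1 by rewrite ltr_wpDl ?dotv_ge0.
(* The increment is at most [(a |g x|^2 + s / a + s) / 2] with [|g x|^2 <= |x|^2]. This [a] makes
   the first term at most [e], and the radius [e / (1/a + 1)] for [s] makes the other two together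
   at most [e]. *)
pose a := e / (dotv x x + 1); have a0 : 0 < a by exact: divr_gt0.
have ai0 : 0 < a^-1 + 1 by rewrite ltr_wpDl ?invr_ge0 ?ltW.
have N : \forall x' \near x, dotv (x' - x) (x' - x) <= e / (a^-1 + 1).
  have cc : {for x, continuous (fun x' => dotv (x' - x) (x' - x))}.
    apply: (@continuous_comp _ _ _ (fun x' => x' - x) (fun v => dotv v v)).
      by apply: continuousB; [exact: cvg_id | exact: cst_continuous].
    exact: dotv_sq_continuous.
  have := cvgr_le _ cc; rewrite subrr dotv0l; apply; exact: divr_gt0.
apply: filterS N => x' Hx' u g NJ.
have [Q _ _] := NJ; have := Q x x'; have := normal_jet_grad_le NJ x.
move: Hx'; set s := dotv (x' - x) _ => Hs Hg.
have Y1 := dotv_young (g x) (x' - x) a0.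
have Y2 := dotv_young (g x) (- (x' - x)) a0.
rewrite dotvNr dotvNl dotvNr opprK in Y2.
have {}Hg : a * dotv (g x) (g x) <= e.
  apply: (@le_trans _ _ (a * (dotv x x + 1))).
    by rewrite ler_wpM2l ?(ltW a0)// (le_trans Hg)// lerDl.
  by rewrite /a divfK ?gt_eqF.
have {}Hs : a^-1 * s + s <= e.
  by have := Hs; rewrite ler_pdivlMr// mulrDr mulr1 mulrC.
rewrite -/s in Y1 Y2.
by rewrite !ler_norml => /andP[H1 H2]; apply/andP; split; lra.
Qed.

(** Compactness of [[-M, M]] provides a cluster point, and an ultrafilter converges to any of its
    cluster points. *)
Lemma ultra_bounded_cvg (U : set_system nat) (a : nat -> R) (M : R) :
  UltraFilter U -> (forall n, `|a n| <= M) -> exists l : R, a n @[n --> U] --> l.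
Proof.
move=> UU aM.
have aU : (a n @[n --> U]) `[- M, M]%classic.
  have aM' n : `[- M, M]%classic (a n) by rewrite /= in_itv/= -ler_norml aM.
  exact: (filterE _ aM').
have [l [_ cl]] := @segment_compact R (- M) M _ (fmap_proper_filter a _) aU.
exists l => V Vl; have [//|UC] := in_ultra_setVsetC (a @^-1` V) UU.
by have [t [/= nVt Vt]] := cl (~` V) V UC Vl.
Qed.

(** One ultrafilter settles all points and all gradient coordinates at once. Dominated convergence
    asks for a sequence, hence the extraction of [s] by uniform closeness on the ball of radius [k];
    only [k <= s k] is kept, not monotonicity. *)
Lemma normal_jet_limit (u_ : nat -> 'rV[R]_d -> R) (g_ : nat -> 'rV[R]_d -> 'rV[R]_d) :
  (forall n, normal_jet (u_ n) (g_ n)) ->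
  exists u g (s : nat -> nat), [/\ normal_jet u g, forall k, (k <= s k)%N &
    forall x, u_ (s k) x @[k --> \oo] --> u x].
Proof.
move=> NJ.
have [U [UU subU]] := @ultraFilterLemma nat \oo _.
have [u Hu] := choice (fun x => ultra_bounded_cvg UU
  (fun n => normal_jet_le (NJ n) x)).
have gb x i n : `|g_ n x ord0 i| <= 1 + dotv x x.
  have := coord_sq_le (g_ n x) i; have := normal_jet_grad_le (NJ n) x.
  move: (g_ n x ord0 i) => c H1 H2.
  have := dotv_ge0 x; have := sqr_ge0 (c - 1); have := sqr_ge0 (c + 1).
  rewrite sqrrD sqrrB !expr1n !mulr1 => *.
  by rewrite ler_norml; apply/andP; split; lra.
have HG x : exists f : 'I_d -> R, forall i, g_ n x ord0 i @[n --> U] --> f i.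
  by have [f Hf] := choice (fun i => ultra_bounded_cvg UU (gb x i)); exists f.
have [g Hg] := choice HG.
pose G x : 'rV[R]_d := \row_i g x i.
have NJu : normal_jet u G.
  split.
  - move=> x z.
    have C : `|u_ n z - u_ n x - dotv (g_ n x) (z - x)| @[n --> U] -->
             `|u z - u x - dotv (G x) (z - x)|.
      apply: cvg_norm; apply: cvgB; first exact: cvgB.
      apply: (@cvg_big _ _ +%R) => [|i _]; first exact: add_continuous.
      have -> : G x ord0 i = g x i by rewrite mxE.
      by apply: cvgM; [exact: Hg | exact: cvg_cst].
    apply: (cvgr_to_le C); apply: nearW => n; case: (NJ n) => Qn _ _; exact: Qn.
  - have C := Hu 0; apply: (cvg_unique (@Rhausdorff R) C).
    rewrite (_ : (fun n => u_ n 0) = cst 0); first exact: cvg_cst.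
    by apply/funext => n; case: (NJ n).
  - apply/rowP => i; rewrite !mxE; have C := Hg 0 i.
    apply: (cvg_unique (@Rhausdorff R) C).
    rewrite (_ : (fun n => g_ n 0 ord0 i) = cst 0); first exact: cvg_cst.
    by apply/funext => n; case: (NJ n) => _ _ ->; rewrite mxE.
have loc (k : nat) : exists n, (k <= n)%N /\
    forall x, `|x| <= k%:R -> `|u_ n x - u x| <= k.+1%:R^-1.
  (* Three errors: from [x'] to [x] in [u_ n], from [u_ n] to [u] at [x], and back from [x] to [x']
     in [u]. *)
  have e0 : 0 < (k.+1%:R^-1 / 3 : R) by rewrite divr_gt0// invr_gt0.
  have cB := @compact_norm_ball R d k%:R.
  have := (compact_near_coveringP _).1 cB nat U
    (fun n x => `|u_ n x - u x| <= k.+1%:R^-1) _.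
  have cov x : [set x : 'rV[R]_d | `|x| <= k%:R] x ->
    \forall x' \near x & n \near U, `|u_ n x' - u x'| <= k.+1%:R^-1.
    move=> _.
    exists ([set x' | forall u g, normal_jet u g -> `|u x' - u x| <= k.+1%:R^-1 / 3],
       [set n | `|u x - u_ n x| <= k.+1%:R^-1 / 3]).
      split => /=; first exact: normal_jet_equicont.
      exact: cvgr_dist_le (Hu x) _ e0.
    move=> [x' n] /= [H1 H2].
    have A1 := H1 _ _ (NJ n); have A2 := H1 _ _ NJu.
    move: A1 A2 H2; rewrite !ler_norml; move: (k.+1%:R^-1) => e.
    by move=> /andP[? ?] /andP[? ?] /andP[? ?]; apply/andP; split; lra.
  move=> /(_ _ cov) H.
  have [n [H1 H2]] := filter_ex (filterI (subU _ (nbhs_infty_ge k)) H).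
  by exists n; split.
have [s Hs] := choice loc.
exists u, G, s; split => //; first by move=> k; case: (Hs k).
move=> x; apply/cvgrPdist_le => e e0.
near=> k.
have [_ /(_ x)] := Hs k; rewrite distrC => H; apply: le_trans (H _) _.
  near: k; exists (Num.truncn `|x|).+1 => // k /= hk.
  by apply: (le_trans (ltW (truncnS_gt _))); rewrite ler_nat.
by apply: ltW; near: k; exact: (near_infty_natSinv_lt (PosNum e0)).
Unshelve. all: by end_near. Qed.

Variables mu nu : probability (Rd R d) R.
Hypothesis (mu2 : finite_second_moment mu) (nu2 : finite_second_moment nu).
Hypothesis bary : same_barycentre mu nu.

Definition gap u := \int[nu]_x u x - \int[mu]_x u x.

Lemma Iobj_gap u : C11_lip1 u -> Iobj mu nu u = (gap u)%:E.
Proof.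
by move=> cu; rewrite /Iobj !EFin_Rintegral//; exact: intg_C11.
Qed.

Lemma bary_dotv a : \int[nu]_x dotv a x = \int[mu]_x dotv a x.
Proof.
rewrite /dotv !Rint_sum; first last.
- by move=> i; apply: intgZ; exact: intg_coord.
- by move=> i; apply: intgZ; exact: intg_coord.
apply: eq_bigr => i _; rewrite !RintZ; try exact: intg_coord.
by rewrite /Rintegral bary.
Qed.

(** [gap] does not see affine functions, because the two measures share mass and barycentre; this is
    where the barycentre hypothesis enters. *)
Lemma normalise u : C11_lip1 u -> exists v g, normal_jet v g /\ gap v = gap u.
Proof.
move=> cu; have Q := C11_quad_jet cu.
exists (fun x => u x - (u 0 + dotv (grad u 0) x)), (fun x => grad u x - grad u 0).
split.
  split => [x z||]; last by rewrite subrr.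
  - have := Q x z; congr (`| _ | <= _).
    move: (grad u x) (grad u 0) => a b; rewrite !dotvE; ring.
  - by rewrite dotv0r addr0 subrr.
have I1 P : finite_second_moment P -> intg P u by move=> ?; exact: intg_C11.
have I2 P : finite_second_moment P -> intg P (fun x => u 0 + dotv (grad u 0) x).
  by move=> ?; apply: intgD; [exact: intg_cst | exact: intg_dotv].
rewrite /gap !RintB; try (by apply: I1); try (by apply: I2).
rewrite !RintD; try exact: intg_cst; try exact: intg_dotv.
by rewrite bary_dotv !Rint_cst; ring.
Qed.

Lemma gap_normal_le u g : normal_jet u g ->
  `|gap u| <= 2^-1 * (\int[nu]_x dotv x x + \int[mu]_x dotv x x).
Proof.
move=> NJ; have cu := quad_jet_C11 (let: And3 Q _ _ := NJ in Q).
have B P : finite_second_moment P -> `|\int[P]_x u x| <= 2^-1 * \int[P]_x dotv x x.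
  move=> P2; have Iu := intg_C11 P2 cu; have Is := intg_sq P2.
  rewrite -RintZ// ler_norml; apply/andP; split.
    rewrite -mulN1r -RintZ; last exact: intgZ.
    apply: Rint_le => //; first by do 2 apply: intgZ.
    by move=> x; have := normal_jet_le NJ x; rewrite ler_norml => /andP[]; lra.
  apply: Rint_le => //; first exact: intgZ.
  by move=> x; have := normal_jet_le NJ x; rewrite ler_norml => /andP[].
apply: le_trans (ler_normB _ _) _; rewrite mulrDr; apply: lerD; exact: B.
Qed.

Lemma gap_maximiser : exists2 u, C11_lip1 u & forall v, C11_lip1 v -> gap v <= gap u.
Proof.
pose S := [set gap (ug.1) | ug in [set ug | normal_jet ug.1 ug.2]].
have S0 : S !=set0.
  exists (gap (fun=> 0)); exists ((fun=> 0), (fun=> 0)) => //=; split=> // x z.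
  by rewrite dotv0l !subr0 normr0 mulr_ge0 ?invr_ge0// dotv_ge0.
have hS : has_sup S.
  split => //; exists (2^-1 * (\int[nu]_x dotv x x + \int[mu]_x dotv x x)).
  by move=> _ [ug NJ <-]; exact: le_trans (ler_norm _) (gap_normal_le NJ).
have ex (n : nat) : exists ug, normal_jet ug.1 ug.2 /\ sup S - n.+1%:R^-1 < gap ug.1.
  have e0 : 0 < (n.+1%:R^-1 : R) by rewrite invr_gt0.
  by have [_ [ug NJ <-] H] := sup_adherent e0 hS; exists ug.
have [ug H] := choice ex.
have [u [g [s [NJ sk cv]]]] := @normal_jet_limit (fun n => (ug n).1) (fun n => (ug n).2) (fun n => (H n).1).
have cu := quad_jet_C11 (let: And3 Q _ _ := NJ in Q).
exists u => // v cv'.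
have [w [h [NJw <-]]] := normalise cv'.
have : gap w <= sup S by apply: ub_le_sup; [exact: hS.2 | exists (w, h)].
move=> /le_trans; apply.
have C P : finite_second_moment P ->
    \int[P]_x (ug (s k)).1 x @[k --> \oo] --> \int[P]_x u x.
  move=> P2; apply: (@Rint_dominated _ (Rd R d) R P (fun k => (ug (s k)).1) u (fun x => 2^-1 * dotv x x)) => //.
  - move=> n; apply: continuous_measurable_Rd; apply: C11_continuous.
    by case: (H (s n)) => -[Q _ _] _; exact: quad_jet_C11 Q.
  - by apply: continuous_measurable_Rd; exact: C11_continuous.
  - by apply: intgZ; exact: intg_sq.
  - by move=> n x; exact: normal_jet_le (H (s n)).1 x.
have Cg : gap (ug (s k)).1 @[k --> \oo] --> gap u by apply: cvgB; exact: C.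
have Cs : sup S - k.+1%:R^-1 @[k --> \oo] --> sup S - 0.
  by apply: cvgB; [exact: cvg_cst | exact: cvg_harmonic].
rewrite subr0 in Cs.
apply: (ler_cvg_to Cs Cg); apply: nearW => k.
(* Since [k <= s k], the gap at index [s k] is also within [1/(k+1)] of the supremum. *)
apply: le_trans (ltW (H (s k)).2); rewrite lerB// lef_pV2 ?posrE//.
by rewrite ler_nat ltnS.
Qed.

End Maximiser.

(** * Smooth bump functions *)

Section Smoothness.
Context {R : realType}.
Implicit Types (U V : normedModType R).

Lemma CkS U V k (f : U -> V) : Ck k.+1 f <->
  (forall x, differentiable f x) /\ (forall v, Ck k (fun x => 'd f x v)).
Proof. by []. Qed.

Lemma Ck_cst U V k (c : V) : Ck k (cst c : U -> V).
Proof.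
elim: k c => [c x|k IH c]; first exact: cvg_cst.
apply/CkS; split=> [x|v]; first exact: differentiable_cst.
rewrite (_ : (fun x => _) = cst 0); first exact: IH.
by apply/funext => x; rewrite diff_cst.
Qed.

Lemma Ck_weaken U V k (f : U -> V) : Ck k.+1 f -> Ck k f.
Proof.
elim: k f => [f [df _] x|k IH f [df Df]]; first exact: differentiable_continuous.
by split => // v; apply: IH; exact: Df.
Qed.

Lemma CkD U V k (f g : U -> V) : Ck k f -> Ck k g -> Ck k (fun x => f x + g x).
Proof.
elim: k f g => [f g cf cg x|k IH f g /CkS[df Df] /CkS[dg Dg]].
  by apply: cvgD; [exact: cf | exact: cg].
apply/CkS; split=> [x|v]; first exact: differentiableD.
rewrite (_ : (fun x => _) = (fun x => 'd f x v + 'd g x v)); first exact: IH.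
by apply/funext => x; rewrite -[X in diff _ X]/(f + g) diffD.
Qed.

Lemma CkM U k (f g : U -> R) : Ck k f -> Ck k g -> Ck k (fun x => f x * g x).
Proof.
elim: k f g => [f g cf cg x|k IH f g Cf Cg].
  by apply: cvgM; [exact: cf | exact: cg].
have /CkS[df Df] := Cf; have /CkS[dg Dg] := Cg.
apply/CkS; split=> [x|v]; first exact: differentiableM.
rewrite (_ : (fun x => _) = (fun x => f x * 'd g x v + g x * 'd f x v)).
  by apply: CkD; apply: IH => //; exact: Ck_weaken.
by apply/funext => x; rewrite -[X in diff _ X]/(f * g) diffM.
Qed.

Lemma Ck_prod U k I (s : seq I) (F : I -> U -> R) : (forall i, Ck k (F i)) ->
  Ck k (fun x => \prod_(i <- s) F i x).
Proof.
move=> CF; elim: s => [|i s IH].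
  rewrite (_ : (fun x => _) = cst 1); first exact: Ck_cst.
  by apply/funext => x; rewrite big_nil.
rewrite (_ : (fun x => _) = (fun x => F i x * \prod_(i <- s) F i x)).
  exact: CkM.
by apply/funext => x; rewrite big_cons.
Qed.

Lemma CkZl U V k (f : U -> R) (w : V) : Ck k f -> Ck k (fun x => f x *: w).
Proof.
elim: k f => [f cf x|k IH f /CkS[df Df]].
  by apply: cvgZ; [exact: cf | exact: cvg_cst].
apply/CkS; split=> [x|v]; first exact: differentiableZl.
rewrite (_ : (fun x => _) = (fun x => 'd f x v *: w)); first exact: IH.
by apply/funext => x; rewrite diffZl.
Qed.

(* p(1/t) exp(-1/t) for t > 0, extended by 0: a family stable by differentiation. *)
Definition flat (p : {poly R}) (t : R) : R :=
  if 0 < t then p.[t^-1] * expR (- t^-1) else 0.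

(** Each [s^i exp(-s)] is at most [i!], as [s^i / i!] is one term of the exponential series. *)
Lemma poly_exp_bounded (p : {poly R}) :
  exists C, forall s, 0 < s -> `|p.[s] * expR (- s)| <= C.
Proof.
exists (\sum_(i < size p) `|p`_i| * i`!%:R) => s s0.
rewrite normrM (gtr0_norm (expR_gt0 _)) horner_coef.
apply: le_trans (ler_wpM2r (expR_ge0 _) (ler_norm_sum _ _ _)) _.
rewrite mulr_suml; apply: ler_sum => i _.
rewrite normrM -mulrA ler_wpM2l// normrX (gtr0_norm s0) expRN.
rewrite ler_pdivrMr ?expR_gt0//.
case: (i : nat) => [|j]; first by rewrite expr0 fact0 mul1r (le_trans _ (expR_ge1Dx _))// lerDl ltW.
have := expR_ge1Dxn j (ltW s0); rewrite -ler_pdivrMl ?ltr0n ?fact_gt0//.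
by rewrite mulrC; apply: le_trans; rewrite lerDr.
Qed.

(** Chain rule in [s = 1/t]: the factor [X^2] is [-ds/dt], and [p - p'] comes from differentiating
    [p(s) exp(-s)] with the opposite sign. *)
Definition flat_deriv (p : {poly R}) : {poly R} := 'X^2 * (p - p^`()).

Lemma flat_diff p t : differentiable (flat p) t /\
  'd (flat p) t = (fun v => v * flat (flat_deriv p) t) :> (R -> R).
Proof.
suff H : is_derive t (1 : R) (flat p) (flat (flat_deriv p) t).
  have D : differentiable (flat p) t by apply/derivable1_diffP; case: H.
  split => //; apply/funext => v.
  have -> : v = v *: (1 : R) by rewrite [_ *: _]mulr1.
  by rewrite linearZ /= -deriveE// (@derive_val _ _ _ _ _ _ _ H) [_ *: 1]mulr1.
have [t0|t0|->] := ltgtP t 0.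
- apply: (@near_eq_is_derive _ _ _ (cst 0)).
    have N : \forall s \near t, s < 0.
      by apply: open_nbhs_nbhs; split; [exact: open_lt | exact: t0].
    by apply: filterS N => s s0; rewrite /flat ltNge (ltW s0).
  by rewrite /flat ltNge (ltW t0) /=; exact: is_derive_cst.
- apply: (@near_eq_is_derive R R R (fun s => p.[s^-1] * expR (- s^-1))).
    have N : \forall s \near t, 0 < s.
      by apply: open_nbhs_nbhs; split; [exact: open_gt | exact: t0].
    by apply: filterS N => s s0; rewrite /flat s0.
  rewrite /flat t0.
  have tn0 : t != 0 by rewrite gt_eqF.
  have dV : is_derive t (1 : R) (fun s : R => s^-1) (- t ^- 2).
    split; first by apply: derivableV.
    by rewrite deriveV// derive_id [_ *: 1]mulr1.
  have dp : is_derive t (1 : R) (fun s : R => p.[s^-1]) (p^`().[t^-1] * (- t ^- 2)).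
    by apply: (@is_derive1_comp _ (horner p) (fun s : R => s^-1)).
  have dN : is_derive t (1 : R) (fun s : R => - s^-1) (t ^- 2).
    by have := is_deriveN dV; rewrite opprK.
  have de : is_derive t (1 : R) (fun s : R => expR (- s^-1)) (expR (- t^-1) * t ^- 2).
    by apply: (@is_derive1_comp _ expR (fun s : R => - s^-1)).
  have M := is_deriveM dp de.
  apply: is_derive_eq M _.
  rewrite /GRing.scale /= /flat_deriv !hornerE /= exprVn; ring.
(* At 0, boundedness of [s^2 p(s) exp(-s)] with [s = 1/h] reads [|flat p h| <= C h^2], so the
   derivative exists and vanishes. *)
- have [C HC] := poly_exp_bounded ('X^2 * p).
  have l0c : continuous (\0 : {linear R -> R}) by move=> x; exact: cvg_cst.
  have [|D E] := quad_diff (C := C) l0c (f := flat p) (x := 0); last first.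
    split; first exact/derivable1_diffP.
    by rewrite deriveE// E /flat ltxx.
  move=> h; rewrite add0r {2}/flat ltxx subr0 subr0 /flat.
  have C0 : 0 <= C by apply: le_trans (HC 1 ltr01).
  case: ifPn => h0; last by rewrite normr0 mulr_ge0// sqr_ge0.
  have := HC h^-1; rewrite invr_gt0 => /(_ h0); rewrite !hornerE /= !normrM -mulrA.
  rewrite normfV (gtr0_norm h0) -[X in X <= _]mulrA !ler_pdivrMl//.
  by rewrite mulrA => /le_trans; apply; rewrite [h * h * C]mulrC mulrA.
Qed.

Lemma Ck_flat U k p (l : {linear U -> R}) (c : R) : continuous l ->
  Ck k (fun x => flat p (l x + c)).
Proof.
move=> lc; have da x : differentiable (fun x => l x + c) x /\
    'd (fun x => l x + c) x = l :> (U -> R).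
  apply: (@quad_diff R U _ l x 0) => // h.
  have -> : l (x + h) + c - (l x + c) - l h = 0 by rewrite linearD; ring.
  by rewrite normr0 mul0r.
elim: k p => [p x|k IH p].
  apply: (@continuous_comp _ _ _ (fun x => l x + c) (flat p)).
    exact: differentiable_continuous (da x).1.
  exact: differentiable_continuous (flat_diff p _).1.
apply/CkS; split=> [x|v].
  by apply: (@differentiable_comp _ _ _ _ (fun x => l x + c) (flat p)); [exact: (da x).1 | exact: (flat_diff p _).1].
rewrite (_ : (fun x => _) = (fun x => cst (l v) x * flat (flat_deriv p) (l x + c))).
  by apply: CkM; [exact: Ck_cst | exact: IH].
apply/funext => x.
rewrite -[X in diff _ X]/(flat p \o (fun x => l x + c)).
rewrite (@diff_comp _ _ _ _ (fun x => l x + c) (flat p) x (da x).1 (flat_diff p _).1).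
by rewrite /= (flat_diff p _).2 (da x).2.
Qed.

Lemma flat1E t : flat 1 t = if 0 < t then expR (- t^-1) else 0.
Proof. by rewrite /flat hornerE mul1r. Qed.

Lemma flat1_itv t : 0 <= flat 1 t <= 1.
Proof.
rewrite flat1E; case: ifP => t0; last by rewrite lexx ler01.
by rewrite expR_ge0 -expR0 ler_expR oppr_le0 invr_ge0 ltW.
Qed.

Lemma flat1_cvg t : 0 < t -> flat 1 (n.+1%:R * t) @[n --> \oo] --> (1 : R).
Proof.
move=> t0.
have C : expR (- (n.+1%:R^-1 * t^-1)) @[n --> \oo] --> expR (- (0 * t^-1)).
  apply: continuous_cvg; first exact: continuous_expR.
  by apply: cvgN; apply: cvgMr_tmp; exact: cvg_harmonic.
rewrite mul0r oppr0 expR0 in C; apply: cvg_trans C.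
by apply: near_eq_cvg; apply: nearW => n; rewrite flat1E mulr_gt0// invfM.
Qed.

End Smoothness.

(** * Box bumps as test maps, and boxes as generators of the Borel sets *)

Section Bumps.
Context {R : realType} {d : nat}.
Implicit Types (a b x : 'rV[R]_d).

Definition box a b : set 'rV[R]_d :=
  [set x | forall i, a ord0 i < x ord0 i < b ord0 i].

(** A product of factors [exp(-1/((n+1) s))], with [s] the distances to the faces: for each [n] it
    is positive exactly on the open box, and it tends to the indicator of the box. *)
Definition box_bump n a b x : R := \prod_(i < d)
  (flat 1 (n.+1%:R * (x ord0 i - a ord0 i)) * flat 1 (n.+1%:R * (b ord0 i - x ord0 i))).

Lemma Ck_box_bump k n a b : Ck k (box_bump n a b).
Proof.
apply: Ck_prod => i; apply: CkM.
- rewrite (_ : (fun x => _) = (fun x => flat 1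
    (dotv (n.+1%:R *: delta_mx ord0 i) x + - (n.+1%:R * a ord0 i)))).
    by apply: Ck_flat; exact: dotv_continuous.
  by apply/funext => x; rewrite dotvZl dotvC dotv_delta mulrBr.
- rewrite (_ : (fun x => _) = (fun x => flat 1
    (dotv (- n.+1%:R *: delta_mx ord0 i) x + n.+1%:R * b ord0 i))).
    by apply: Ck_flat; exact: dotv_continuous.
  by apply/funext => x; rewrite dotvZl dotvC dotv_delta mulrBr mulNr addrC.
Qed.

Lemma box_bump_itv n a b x : 0 <= box_bump n a b x <= 1.
Proof.
apply/andP; split.
  by apply: prodr_ge0 => i _; rewrite mulr_ge0//; [case/andP: (flat1_itv (n.+1%:R * (x ord0 i - a ord0 i)))|case/andP: (flat1_itv (n.+1%:R * (b ord0 i - x ord0 i)))].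
apply: prodr_ile1 => i _; have /andP[A0 A1] := flat1_itv (n.+1%:R * (x ord0 i - a ord0 i)).
have /andP[B0 B1] := flat1_itv (n.+1%:R * (b ord0 i - x ord0 i)).
by rewrite mulr_ge0//= mulr_ile1.
Qed.

Lemma box_bump_neq0 n a b x : box_bump n a b x != 0 -> box a b x.
Proof.
move=> /prodf_neq0 H i; have := H i isT; rewrite mulf_eq0 negb_or !flat1E.
case: ifPn => [A|_ /andP[]]; last by rewrite eqxx.
case: ifPn => [B _|_ /andP[_]]; last by rewrite eqxx.
by move: A B; rewrite !pmulr_rgt0// !subr_gt0 => -> ->.
Qed.

Lemma box_bump_cvg a b x : box_bump n a b x @[n --> \oo] --> (\1_(box a b) x : R).
Proof.
rewrite indicE; case: (boolP (x \in box a b)) => [/set_mem xab|/negP xab].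
  have -> : true%:R = \prod_(i < d) (1 * 1) :> R by rewrite mulr1 big1.
  rewrite /box_bump.
  apply: (@cvg_big R 'I_d *%R 1 xpredT mul_continuous nat \oo _
    (fun i n => flat 1 (n.+1%:R * (x ord0 i - a ord0 i)) *
      flat 1 (n.+1%:R * (b ord0 i - x ord0 i))) (fun=> 1 * 1)) => i _.
  have /andP[A B] := xab i.
  by apply: cvgM; apply: flat1_cvg; rewrite subr_gt0.
rewrite (_ : (fun n => _) = cst 0); first exact: cvg_cst.
apply/funext => n /=; apply/eqP/negPn/negP => /box_bump_neq0 H.
by apply: xab; exact: mem_set.
Qed.

Lemma test_map_box_bump n a b (w : 'rV[R]_d) : test_map (fun x => box_bump n a b x *: w).
Proof.
split; first by move=> k; apply: CkZl; exact: Ck_box_bump.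
rewrite /compact_support; set S := mkset _; pose K := [set x : 'rV[R]_d | forall i, `[a ord0 i, b ord0 i]%classic (x ord0 i)].
have cK : compact K.
  by apply: (@rV_compact R d (fun i => `[a ord0 i, b ord0 i]%classic)) => i; exact: segment_compact.
apply: (subclosed_compact _ cK); first exact: closed_closure.
have clK : closed K by apply: compact_closed => //; exact: norm_hausdorff.
rewrite closureE; apply: smallest_sub => // x; rewrite /S /= scaler_eq0 negb_or => /andP[/box_bump_neq0 H _] i /=.
by have /andP[A B] := H i; rewrite in_itv/= (ltW A) (ltW B).
Qed.

Lemma box_setI : setI_closed [set box ab.1 ab.2 | ab in [set: 'rV[R]_d * 'rV[R]_d]].
Proof.
move=> _ _ [[a b] _ <-] [[a' b'] _ <-] /=.
exists (\row_i Num.max (a ord0 i) (a' ord0 i), \row_i Num.min (b ord0 i) (b' ord0 i)) => //.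
apply/seteqP; split=> [x H|x [H H']] => [|i] /=.
  by split=> i; have := H i; rewrite !mxE gt_max lt_min => /andP[/andP[A B] /andP[C D]]; apply/andP.
have /andP[A B] := H i; have /andP[C D] := H' i.
by rewrite !mxE gt_max lt_min A B C D.
Qed.

Lemma open_box a b : open (box a b).
Proof.
rewrite openE => x xab; rewrite /interior; exists (fun _ i => `]a ord0 i, b ord0 i[%classic).
  move=> i j; rewrite ord1; apply: open_nbhs_nbhs; split; first exact: interval_open.
  by rewrite /= in_itv/=; exact: xab.
by move=> y H i; have := H ord0 i; rewrite /= in_itv.
Qed.

(** An open set is the countable union of the rational boxes that it contains; max-norm balls being
    cubes, every point of it lies in one of them. *)
Lemma Rd_measurable_box : @measurable _ (Rd R d) =
  <<s [set box ab.1 ab.2 | ab in [set: 'rV[R]_d * 'rV[R]_d]] >>.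
Proof.
apply/seteqP; split; last first.
  apply: smallest_sub; first exact: smallest_sigma_algebra.
  by move=> _ [[a b] _ <-]; apply: sub_sigma_algebra; exact: open_box.
apply: smallest_sub; first exact: smallest_sigma_algebra.
move=> O oO.
pose BT := g_sigma_algebraType [set box ab.1 ab.2 | ab in [set: 'rV[R]_d * 'rV[R]_d]].
pose F (q : 'rV[rat]_d * 'rV[rat]_d) : set BT :=
  if `[< box (map_mx ratr q.1) (map_mx ratr q.2) `<=` O >]
  then box (map_mx ratr q.1) (map_mx ratr q.2) else set0.
have -> : O = \bigcup_q F q.
  apply/seteqP; split=> [x Ox|x [q _]]; last first.
    by rewrite /F; case: asboolP => // H /H.
  have /nbhs_ballP[e /= e0 He] : nbhs x O by exact: open_nbhs_nbhs.
  have ex1 i : exists q : rat, x ord0 i - e < ratr q < x ord0 i.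
    have lt1 : x ord0 i - e < x ord0 i by rewrite ltrBlDr ltrDl.
    by have [q] := rat_in_itvoo lt1; rewrite in_itv/=; exists q.
  have ex2 i : exists q : rat, x ord0 i < ratr q < x ord0 i + e.
    have lt1 : x ord0 i < x ord0 i + e by rewrite ltrDl.
    by have [q] := rat_in_itvoo lt1; rewrite in_itv/=; exists q.
  have [f Hf] := choice ex1; have [g Hg] := choice ex2.
  exists (\row_i f i, \row_i g i) => //; rewrite /F asboolT /=.
    by move=> i; rewrite !mxE; have /andP[_ ->] := Hf i; have /andP[-> _] := Hg i.
  move=> y Hy; apply: He; split=> // i j; rewrite ord1.
  have := Hy j; rewrite !mxE; have := Hf j; have := Hg j.
  move=> /andP[A B] /andP[C D] /andP[E1 E2].
  by rewrite /ball /= ltr_norml; apply/andP; split; lra.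
apply: (@countable_bigcupT_measurable _ BT); first exact: countableP.
move=> q; rewrite /F; case: asboolP => _; last exact: measurable0.
by apply: sub_sigma_algebra; exists (map_mx ratr q.1, map_mx ratr q.2).
Qed.

End Bumps.

(** * Martingale constraints beyond test maps *)

Lemma cvg_cst_eq {R : realType} (u : nat -> R) (l c : R) :
  u @ \oo --> l -> (forall n, u n = c) -> l = c.
Proof.
move=> ul uc; apply: (cvg_unique (@Rhausdorff R) ul).
by rewrite (_ : u = cst c); [exact: cvg_cst | exact/funext].
Qed.

Import HBSimple HBNNSimple.

Section Martingale.
Context {R : realType} {d : nat} {disp : measure_display} {T : measurableType disp}.
Variables (P : probability T R) (X : T -> Rd R d) (D : T -> R).
Hypothesis mX : measurable_fun setT X.
Hypothesis ID : intg P D.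
Hypothesis HD : forall n (a b : 'rV[R]_d), \int[P]_t (D t * box_bump n a b (X t)) = 0.

Let mD := intg_measurable ID.
Let IaD : intg P (fun t => `|D t|).
Proof. exact: integrable_norm. Qed.

Let intg_indic (A : set (Rd R d)) : measurable A -> intg P (fun t => D t * \1_A (X t)).
Proof.
move=> mA; apply: (intg_le _ _ IaD) => [|t].
  apply: measurable_funM => //; apply: measurableT_comp mX.
  exact: measurable_indic.
rewrite normrM indicE; case: (_ \in _); rewrite ?normr1 ?mulr1//.
by rewrite normr0 mulr0.
Qed.

Let box0 (a b : 'rV[R]_d) : \int[P]_t (D t * \1_(box a b) (X t)) = 0.
Proof.
have mb n : measurable_fun setT (fun t => D t * box_bump n a b (X t)).
  apply: measurable_funM => //; apply: measurableT_comp mX.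
  by apply: continuous_measurable_Rd; exact: (Ck_box_bump 0 n a b).
have C : \int[P]_t (D t * box_bump n a b (X t)) @[n --> \oo] -->
    \int[P]_t (D t * \1_(box a b) (X t)).
  apply: (@Rint_dominated _ _ _ P (fun n t => D t * box_bump n a b (X t)) _ (fun t => `|D t|)) => //.
  - apply: intg_measurable; apply: intg_indic.
    by apply: sub_sigma_algebra; exact: open_box.
  - by move=> t; apply: cvgM; [exact: cvg_cst | exact: box_bump_cvg].
  - move=> n t; rewrite normrM; have /andP[b0 b1] := box_bump_itv n a b (X t).
    by rewrite (ger0_norm b0) ler_piMr.
exact: (cvg_cst_eq C).
Qed.

(** Since [D] changes sign, this is a Dynkin argument rather than uniqueness of measures: boxes are
    stable under intersection, and monotone unions pass by dominated convergence with bound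
    [|D|]. *)
Let borel0 (A : set (Rd R d)) : measurable A -> \int[P]_t (D t * \1_A (X t)) = 0.
Proof.
pose H := [set A : set (Rd R d) | measurable A /\ \int[P]_t (D t * \1_A (X t)) = 0].
suff : @measurable _ (Rd R d) `<=` H by move=> /[apply] -[].
have cvgH (F : nat -> set (Rd R d)) : nondecreasing_seq F -> (forall n, H (F n)) ->
    H (\bigcup_n F n).
  move=> ndF HF; have mF : measurable (\bigcup_n F n).
    by apply: bigcupT_measurable => n; case: (HF n).
  split => //.
  have C : \int[P]_t (D t * \1_(F n) (X t)) @[n --> \oo] -->
      \int[P]_t (D t * \1_(\bigcup_n F n) (X t)).
    apply: (@Rint_dominated _ _ _ P (fun n t => D t * \1_(F n) (X t)) _ (fun t => `|D t|)) => //.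
    - by move=> n; apply: intg_measurable; apply: intg_indic; case: (HF n).
    - by apply: intg_measurable; exact: intg_indic.
    - move=> t; apply: cvgM; first exact: cvg_cst.
      case: (pselect ((\bigcup_n F n) (X t))) => [[n _ Fn]|nF].
        apply: cvg_near_cst; exists n => // m /= nm.
        have Fm : F m (X t) by move/subsetPset : (ndF _ _ nm); exact.
        by rewrite !indicE !mem_set//; exists m.
      apply: cvg_near_cst; apply: nearW => n.
      by rewrite !indicE !memNset// => Fn; apply: nF; exists n.
    - move=> n t; rewrite normrM indicE; case: (_ \in _); rewrite ?normr1 ?mulr1//.
      by rewrite normr0 mulr0.
  by apply: (cvg_cst_eq C) => n; case: (HF n).
rewrite Rd_measurable_box; apply: lambda_system_subset => //; last first.
- by move=> _ [[a b] _ <-]; split; [apply: sub_sigma_algebra; exact: open_box | exact: box0].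
- split => //.
  (* The vanishing of the integral of [D] itself is not assumed; the whole space is reached as an
     increasing union of cubes. *)
  + rewrite (_ : setT = \bigcup_n box (const_mx (- n%:R)) (const_mx n%:R)).
      apply: cvgH => [m n mn|n]; last first.
        by split; [apply: sub_sigma_algebra; exact: open_box | exact: box0].
      apply/subsetPset => x Hx i; have := Hx i; rewrite !mxE => /andP[ ? ?].
      have mn' : (m%:R <= n%:R :> R) by rewrite ler_nat.
      by apply/andP; split; lra.
    apply/seteqP; split=> // x _; exists (Num.truncn `|x|).+1 => // i.
    rewrite !mxE -ltr_norml; apply: le_lt_trans (coord_norm_le x i) _.
    exact: truncnS_gt.
  + move=> B C CB [mB B0] [mC C0]; split; first exact: measurableD.
    have -> : \int[P]_t (D t * \1_(B `\` C) (X t)) =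
        \int[P]_t (D t * \1_B (X t) - D t * \1_C (X t)).
      apply: eq_Rintegral => t _; rewrite -mulrBr; congr (_ * _).
      rewrite !indicE; case: (pselect (C (X t))) => Ct.
        by rewrite memNset ?mem_set ?subrr//; [exact: CB | case].
      rewrite (memNset Ct) subr0; case: (pselect (B (X t))) => Bt.
        by rewrite !mem_set.
      by rewrite !memNset// => -[].
    by rewrite RintB ?B0 ?C0 ?subrr//; exact: intg_indic.
- exact: box_setI.
Qed.

Let nonneg0 (G : Rd R d -> R) : measurable_fun setT G -> (forall x, 0 <= G x) ->
  intg P (fun t => D t * G (X t)) -> \int[P]_t (D t * G (X t)) = 0.
Proof.
move=> mG G0 IG.
have meG : measurable_fun setT (EFin \o G) by exact/measurable_EFinP.
pose g := nnsfun_approx measurableT meG.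
have gG (x : Rd R d) : (fun n => g n x) @ \oo --> G x.
  have := @cvg_nnsfun_approx _ _ _ _ measurableT _ meG (fun x _ => G0 x) x I.
  exact: fine_cvg.
have ndg (x : Rd R d) : nondecreasing_seq (fun n => g n x).
  by move=> m n mn; have /lefP := nd_nnsfun_approx measurableT meG mn.
have gle n (x : Rd R d) : g n x <= G x.
  have := nondecreasing_cvgn_le (ndg x) (cvgP _ (gG x)) n.
  by rewrite (cvg_lim (@Rhausdorff R) (gG x)).
have Ig n : intg P (fun t => D t * g n (X t)).
  apply: (intg_le _ _ (integrable_norm IG)) => [|t].
    by apply: measurable_funM => //; exact: measurableT_comp.
  rewrite /= !normrM ler_wpM2l// !ger0_norm//.
have C : \int[P]_t (D t * g n (X t)) @[n --> \oo] --> \int[P]_t (D t * G (X t)).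
  apply: (@Rint_dominated _ _ _ P (fun n t => D t * g n (X t)) _ (fun t => `|D t * G (X t)|)) => //.
  - by move=> n; exact: intg_measurable (Ig n).
  - exact: intg_measurable IG.
  - by move=> t; apply: cvgM; [exact: cvg_cst | exact: gG].
  - exact: integrable_norm IG.
  - by move=> n t; rewrite !normrM ler_wpM2l// !ger0_norm.
apply: (cvg_cst_eq C) => n.
have mgi y : measurable (g n @^-1` [set y]) by exact: measurable_funPTI.
transitivity (\int[P]_t (\sum_(y <- finmap.enum_fset (fset_set (range (g n))))
    (y * (D t * \1_(g n @^-1` [set y]) (X t))))).
  apply: eq_Rintegral => t _; rewrite (fimfunE (g n)) fsbig_finite//= mulr_sumr.
  by apply: eq_bigr => i _; rewrite mulrCA.
rewrite Rint_sum => [|i]; last by apply: intgZ; exact: intg_indic.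
by rewrite big1// => i _; rewrite RintZ ?borel0 ?mulr0//; exact: intg_indic.
Qed.

(** The hypothesis on bumps says that the conditional expectation of [D] given [X] is zero. The
    extension to unbounded [G] is what allows coordinates of [grad u]. *)
Lemma martingale_integral0 (G : Rd R d -> R) : measurable_fun setT G ->
  intg P (fun t => D t * G (X t)) -> \int[P]_t (D t * G (X t)) = 0.
Proof.
move=> mG IG.
have mp : measurable_fun setT (fun x => Num.max (G x) 0) by apply: measurable_maxr.
have mn : measurable_fun setT (fun x => Num.max (- G x) 0).
  by apply: measurable_maxr => //; exact: measurableT_comp.
have Ip : intg P (fun t => D t * Num.max (G (X t)) 0).
  apply: (intg_le _ _ (integrable_norm IG)) => [|t].
    by apply: measurable_funM => //; exact: (measurableT_comp mp mX).
  rewrite /= !normrM ler_wpM2l//; case: (leP (G (X t)) 0) => h; first by rewrite normr0.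
  by [].
have In : intg P (fun t => D t * Num.max (- G (X t)) 0).
  apply: (intg_le _ _ (integrable_norm IG)) => [|t].
    by apply: measurable_funM => //; exact: (measurableT_comp mn mX).
  rewrite /= !normrM ler_wpM2l//; case: (leP (- G (X t)) 0) => h; first by rewrite normr0.
  by rewrite normrN.
transitivity (\int[P]_t (D t * Num.max (G (X t)) 0 - D t * Num.max (- G (X t)) 0)).
  apply: eq_Rintegral => t _; rewrite -mulrBr; congr (_ * _).
  by case: (leP (G (X t)) 0) => h; case: (leP (- G (X t)) 0) => h'; lra.
rewrite RintB// (nonneg0 mp) ?(nonneg0 mn) ?subrr// => x; rewrite le_max lexx orbT//.
Qed.

End Martingale.

(** * Weak duality *)

Section Marginals.
Context d1 d2 (T : measurableType d1) (S : measurableType d2) (R : realType).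
Variables (P : probability T R) (Q : probability S R) (X : T -> S).
Hypothesis mX : measurable_fun setT X.
Hypothesis law : forall A, measurable A -> P (X @^-1` A) = Q A.

Lemma intg_marginal (f : S -> R) : intg Q f -> intg P (fun t => f (X t)).
Proof.
move=> If; have mf := intg_measurable If.
apply/integrableP; split.
  by apply/measurable_EFinP; exact: measurableT_comp.
have /integrableP[_] := If; apply: le_lt_trans.
have := @ge0_integral_pushforward _ _ T S R X mX P setT (fun s => `|(f s)%:E|%E) measurableT.
rewrite preimage_setT => <- //; last first.
  by apply: measurableT_comp => //; exact/measurable_EFinP.
rewrite (@eq_measure_integral _ S R setT Q)// => A mA _; exact: law.
Qed.

Lemma Rint_marginal (f : S -> R) : intg Q f -> \int[P]_t f (X t) = \int[Q]_s f s.
Proof.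
move=> If; have mf := intg_measurable If; rewrite /Rintegral; congr fine.
have IfX := intg_marginal If.
have := @integral_pushforward _ _ T S R X mX P setT (EFin \o f).
rewrite preimage_setT => <- //; last by exact/measurable_EFinP.
apply: eq_measure_integral => A mA _; exact: law.
Qed.

End Marginals.

Section WeakDuality.
Context {R : realType} {d : nat}.

Lemma measurable_px : measurable_fun setT (fun p : T3 R d => p.1.1).
Proof. exact: (measurableT_comp measurable_fst measurable_fst). Qed.

Lemma measurable_py : measurable_fun setT (fun p : T3 R d => p.1.2).
Proof. exact: (measurableT_comp measurable_snd measurable_fst). Qed.

Lemma measurable_pz : measurable_fun setT (fun p : T3 R d => p.2).
Proof. exact: measurable_snd. Qed.

Lemma continuous_measurable_px (f : 'rV[R]_d -> R) : continuous f ->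
  measurable_fun setT (fun p : T3 R d => f (px p)).
Proof.
by move=> cf; exact: (measurableT_comp (continuous_measurable_Rd cf) measurable_px).
Qed.

Lemma continuous_measurable_py (f : 'rV[R]_d -> R) : continuous f ->
  measurable_fun setT (fun p : T3 R d => f (py p)).
Proof.
by move=> cf; exact: (measurableT_comp (continuous_measurable_Rd cf) measurable_py).
Qed.

Lemma continuous_measurable_pz (f : 'rV[R]_d -> R) : continuous f ->
  measurable_fun setT (fun p : T3 R d => f (pz p)).
Proof.
by move=> cf; exact: (measurableT_comp (continuous_measurable_Rd cf) measurable_pz).
Qed.

(** The reference function for quadratic growth; the summand 1 lets it dominate constants as
    well. *)
Definition weight (p : T3 R d) : R :=
  1 + (dotv (px p) (px p) + dotv (py p) (py p) + dotv (pz p) (pz p)).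

Lemma weight_ge1 p : 1 <= weight p.
Proof. by rewrite /weight lerDl !addr_ge0// dotv_ge0. Qed.

Lemma measurable_dotv (F G : T3 R d -> 'rV[R]_d) :
  (forall i, measurable_fun setT (fun p => F p ord0 i)) ->
  (forall i, measurable_fun setT (fun p => G p ord0 i)) ->
  measurable_fun setT (fun p => dotv (F p) (G p)).
Proof.
move=> mF mG; rewrite /dotv; apply: measurable_sum => i.
exact: measurable_funM.
Qed.

Lemma measurable_zx i : measurable_fun setT (fun p : T3 R d => (pz p - px p) ord0 i).
Proof.
rewrite (_ : (fun p => _) = (fun p : T3 R d => pz p ord0 i - px p ord0 i)).
  apply: measurable_funB.
  - by apply: (continuous_measurable_pz (f := fun x => x ord0 i)); exact: coord_continuous.
  - by apply: (continuous_measurable_px (f := fun x => x ord0 i)); exact: coord_continuous.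
by apply/funext => p; rewrite !mxE.
Qed.

Lemma measurable_zy i : measurable_fun setT (fun p : T3 R d => (pz p - py p) ord0 i).
Proof.
rewrite (_ : (fun p => _) = (fun p : T3 R d => pz p ord0 i - py p ord0 i)).
  apply: measurable_funB.
  - by apply: (continuous_measurable_pz (f := fun x => x ord0 i)); exact: coord_continuous.
  - by apply: (continuous_measurable_py (f := fun x => x ord0 i)); exact: coord_continuous.
by apply/funext => p; rewrite !mxE.
Qed.

Lemma costE (x y z : 'rV[R]_d) :
  cost x y z = 2^-1 * (dotv (z - x) (z - x) + dotv (z - y) (z - y)).
Proof. by rewrite /cost !enorm_sq. Qed.

Lemma measurable_cost : measurable_fun setT (fun p : T3 R d => cost (px p) (py p) (pz p)).
Proof.
rewrite (_ : (fun p => _) = (fun p : T3 R d => 2^-1 *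
  (dotv (pz p - px p) (pz p - px p) + dotv (pz p - py p) (pz p - py p)))).
  apply: measurable_funM => //; apply: measurable_funD.
  - apply: measurable_dotv; exact: measurable_zx.
  - apply: measurable_dotv; exact: measurable_zy.
by apply/funext => p; rewrite costE.
Qed.

Lemma cost_ge0 (x y z : 'rV[R]_d) : 0 <= cost x y z.
Proof. by rewrite costE mulr_ge0 ?invr_ge0// addr_ge0// dotv_ge0. Qed.

Lemma cost_le_weight (p : T3 R d) : cost (px p) (py p) (pz p) <= 2 * weight p.
Proof.
rewrite costE /weight; have := dotvBB_le (pz p) (px p); have := dotvBB_le (pz p) (py p).
have := dotv_ge0 (px p); have := dotv_ge0 (py p); have := dotv_ge0 (pz p); lra.
Qed.

Lemma coord_abs_le (x : 'rV[R]_d) i : `|x ord0 i| <= 1 + dotv x x.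
Proof.
have := coord_sq_le x i; move: (x ord0 i) => c H.
have := sqr_ge0 (c - 1); have := sqr_ge0 (c + 1).
rewrite sqrrD sqrrB !expr1n !mulr1 => H1 H2; have := sqr_ge0 c => H3.
by rewrite ler_norml; apply/andP; split; lra.
Qed.

Lemma near_dotv (x : 'rV[R]_d) (e : R) : 0 < e ->
  \forall x' \near x, dotv (x - x') (x - x') <= e.
Proof.
move=> e0; have cc : {for x, continuous (fun x' : 'rV[R]_d => dotv (x - x') (x - x'))}.
  apply: (@continuous_comp _ _ _ (fun x' : 'rV[R]_d => x - x') (fun v => dotv v v)).
    by apply: continuousB; [exact: cst_continuous | exact: cvg_id].
  exact: dotv_sq_continuous.
by have := cvgr_le _ cc; rewrite subrr dotv0l; apply.
Qed.

Local Opaque grad.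

Lemma C11_grad_continuous (u : 'rV[R]_d -> R) i : C11_lip1 u ->
  continuous (fun x : 'rV[R]_d => grad u x ord0 i).
Proof.
move=> cu x; have FF := nbhs_filter (x : 'rV[R]_d); apply/cvgrPdist_le => e e0.
have N := near_dotv (x : 'rV[R]_d) (exprn_gt0 2 e0).
apply: filterS N => x' Hx'.
have := quad_jet_lip (C11_quad_jet cu) x x' => /le_trans /(_ Hx') H.
move: (grad u x) (grad u x') H => a b H.
have := le_trans (coord_sq_le (a - b) i) H; rewrite 2!mxE.
by move=> /ler_wsqrtr; rewrite !sqrtr_sqr (gtr0_norm e0).
Qed.

Lemma C11_grad_le (u : 'rV[R]_d -> R) : C11_lip1 u -> forall x,
  dotv (grad u x) (grad u x) <= 2 * dotv (grad u 0) (grad u 0) + 2 * dotv x x.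
Proof.
move=> cu x; have := quad_jet_lip (C11_quad_jet cu) x 0; rewrite subr0.
move: (grad u x) (grad u 0) => a b H.
by have := dotvDD_le (a - b) b; rewrite subrK; lra.
Qed.

Definition jet_gap (u : 'rV[R]_d -> R) (p : T3 R d) : R :=
  (u (py p) + dotv (grad u (py p)) (pz p - py p)) -
  (u (px p) + dotv (grad u (px p)) (pz p - px p)).

(** Both jets are compared with the same value [u z]; the two errors are the two halves of the
    cost. *)
Lemma jet_gap_le_cost (u : 'rV[R]_d -> R) : C11_lip1 u ->
  forall p, jet_gap u p <= cost (px p) (py p) (pz p).
Proof.
have aux (a b c e f s t : R) : - (2^-1 * s) <= c - b - e -> c - a - f <= 2^-1 * t ->
  b + e - (a + f) <= 2^-1 * (t + s) by lra.
move=> cu p; rewrite costE /jet_gap; have Q := C11_quad_jet cu.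
move: (px p) (py p) (pz p) => x y z.
have := Q x z; have := Q y z; rewrite !ler_norml => /andP[A _] /andP[_ D].
exact: aux A D.
Qed.

Variables mu nu : probability (Rd R d) R.
Hypothesis (mu2 : finite_second_moment mu) (nu2 : finite_second_moment nu).
Variable pi : probability (T3 R d) R.
Hypothesis Spi : Sigma mu nu pi.

Lemma intg_weight : intg pi weight.
Proof.
apply: intgD; first exact: intg_cst.
have [H _] := Spi; move: H; rewrite /finite_second_moment3 /intg.
by congr (pi.-integrable _ _); apply/funext => p /=; rewrite !enorm_sq.
Qed.

Lemma intg_weight_le (f : T3 R d -> R) C : measurable_fun setT f ->
  (forall p, `|f p| <= C * weight p) -> intg pi f.
Proof. by move=> mf fC; apply: (intg_le mf fC); apply: intgZ; exact: intg_weight. Qed.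

Lemma intg_cost : intg pi (fun p => cost (px p) (py p) (pz p)).
Proof.
apply: (@intg_weight_le _ 2); first exact: measurable_cost.
by move=> p; rewrite ger0_norm ?cost_ge0// cost_le_weight.
Qed.

Lemma Jobj_cost : Jobj pi = (\int[pi]_p cost (px p) (py p) (pz p))%:E.
Proof. by rewrite /Jobj EFin_Rintegral//; exact: intg_cost. Qed.

Lemma zx_le p i : `|(pz p - px p) ord0 i| <= 2 * weight p.
Proof.
apply: le_trans (coord_abs_le _ i) _; rewrite /weight.
have := dotvBB_le (pz p) (px p); have := dotv_ge0 (py p); lra.
Qed.

Lemma zy_le p i : `|(pz p - py p) ord0 i| <= 2 * weight p.
Proof.
apply: le_trans (coord_abs_le _ i) _; rewrite /weight.
have := dotvBB_le (pz p) (py p); have := dotv_ge0 (px p); lra.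
Qed.

Lemma coord_mul_le (v w : 'rV[R]_d) i : `|v ord0 i * w ord0 i| <= dotv v v + dotv w w.
Proof.
have := coord_sq_le v i; have := coord_sq_le w i.
move: (v ord0 i) (w ord0 i) => a b Ha Hb.
have := sqr_ge0 (a - b); have := sqr_ge0 (a + b); have := sqr_ge0 a; have := sqr_ge0 b.
rewrite sqrrD sqrrB !mulr2n => *.
by rewrite ler_norml; apply/andP; split; lra.
Qed.

Let grad_mul_bound (g g0 q z x W : R) : g <= 2 * g0 + 2 * x -> q <= 2 * z + 2 * x ->
  0 <= g0 -> 0 <= z -> z + x + 1 <= W -> 1 <= W -> q + g <= (2 * g0 + 4) * W.
Proof. by move=> A B g00 z0 C D; have := ler_wpM2l g00 D; rewrite mulrDl; lra. Qed.

(** Coordinate by coordinate: [(z - x)_i] is tested against bumps times the i-th unit vector, and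
    the linear growth of [grad u] makes the product integrable. *)
Lemma grad_x_integral0 (u : 'rV[R]_d -> R) : C11_lip1 u ->
  intg pi (fun p => dotv (grad u (px p)) (pz p - px p)) /\
  \int[pi]_p dotv (grad u (px p)) (pz p - px p) = 0.
Proof.
move=> cu.
have Ii i : intg pi (fun p => (pz p - px p) ord0 i * grad u (px p) ord0 i).
  apply: (@intg_weight_le _ (2 * dotv (grad u 0) (grad u 0) + 4)).
    apply: measurable_funM; first exact: measurable_zx.
    by apply: (continuous_measurable_px (f := fun x => grad u x ord0 i)); exact: C11_grad_continuous.
  move=> p; apply: le_trans (coord_mul_le _ _ i) _.
  apply: grad_mul_bound (C11_grad_le cu _) (dotvBB_le _ _) _ _ _ (weight_ge1 p);
    rewrite /weight ?dotv_ge0//.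
  have := dotv_ge0 (px p); have := dotv_ge0 (py p); have := dotv_ge0 (pz p); lra.
have Zi i : \int[pi]_p ((pz p - px p) ord0 i * grad u (px p) ord0 i) = 0.
  apply: (@martingale_integral0 R d _ _ pi (fun p => p.1.1)
    (fun p => (pz p - px p) ord0 i) _ _ _ (fun x => grad u x ord0 i)) => //.
  - exact: measurable_px.
  - by apply: (@intg_weight_le _ 2); [exact: measurable_zx | move=> p; exact: zx_le].
  - move=> n a b; have [_ [_ [_ H]]] := Spi.
    have [+ _] := H _ _ (test_map_box_bump n a b (delta_mx ord0 i)) (test_map_box_bump n a b (delta_mx ord0 i)).
    rewrite /Rintegral => E; rewrite -[RHS]/(fine 0%E) -E; congr fine; apply: eq_integral => p _.
    by rewrite dotvZr dotv_delta mulrC.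
  - by apply: continuous_measurable_Rd; exact: C11_grad_continuous.
have E p : dotv (grad u (px p)) (pz p - px p) =
    \sum_(i < d) ((pz p - px p) ord0 i * grad u (px p) ord0 i).
  by apply: eq_bigr => i _; rewrite mulrC.
split; first by rewrite /intg; under [X in EFin \o X]eq_fun do rewrite E; exact: intg_sum.
under eq_Rintegral do rewrite E.
by rewrite Rint_sum// big1.
Qed.

Lemma grad_y_integral0 (u : 'rV[R]_d -> R) : C11_lip1 u ->
  intg pi (fun p => dotv (grad u (py p)) (pz p - py p)) /\
  \int[pi]_p dotv (grad u (py p)) (pz p - py p) = 0.
Proof.
move=> cu.
have Ii i : intg pi (fun p => (pz p - py p) ord0 i * grad u (py p) ord0 i).
  apply: (@intg_weight_le _ (2 * dotv (grad u 0) (grad u 0) + 4)).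
    apply: measurable_funM; first exact: measurable_zy.
    by apply: (continuous_measurable_py (f := fun x => grad u x ord0 i)); exact: C11_grad_continuous.
  move=> p; apply: le_trans (coord_mul_le _ _ i) _.
  apply: grad_mul_bound (C11_grad_le cu _) (dotvBB_le _ _) _ _ _ (weight_ge1 p);
    rewrite /weight ?dotv_ge0//.
  have := dotv_ge0 (px p); have := dotv_ge0 (py p); have := dotv_ge0 (pz p); lra.
have Zi i : \int[pi]_p ((pz p - py p) ord0 i * grad u (py p) ord0 i) = 0.
  apply: (@martingale_integral0 R d _ _ pi (fun p => p.1.2)
    (fun p => (pz p - py p) ord0 i) _ _ _ (fun x => grad u x ord0 i)) => //.
  - exact: measurable_py.
  - by apply: (@intg_weight_le _ 2); [exact: measurable_zy | move=> p; exact: zy_le].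
  - move=> n a b; have [_ [_ [_ H]]] := Spi.
    have [_ +] := H _ _ (test_map_box_bump n a b (delta_mx ord0 i)) (test_map_box_bump n a b (delta_mx ord0 i)).
    rewrite /Rintegral => E; rewrite -[RHS]/(fine 0%E) -E; congr fine; apply: eq_integral => p _.
    by rewrite dotvZr dotv_delta mulrC.
  - by apply: continuous_measurable_Rd; exact: C11_grad_continuous.
have E p : dotv (grad u (py p)) (pz p - py p) =
    \sum_(i < d) ((pz p - py p) ord0 i * grad u (py p) ord0 i).
  by apply: eq_bigr => i _; rewrite mulrC.
split; first by rewrite /intg; under [X in EFin \o X]eq_fun do rewrite E; exact: intg_sum.
under eq_Rintegral do rewrite E.
by rewrite Rint_sum// big1.
Qed.

Lemma jet_gap_integral (u : 'rV[R]_d -> R) : C11_lip1 u ->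
  intg pi (jet_gap u) /\ \int[pi]_p jet_gap u p = gap mu nu u.
Proof.
move=> cu; have [Ix Zx] := grad_x_integral0 cu; have [Iy Zy] := grad_y_integral0 cu.
have [_ [lx [ly _]]] := Spi.
have Iu := intg_C11 mu2 cu; have Iv := intg_C11 nu2 cu.
have Ux := intg_marginal measurable_px lx Iu; have Uy := intg_marginal measurable_py ly Iv.
have Ex := Rint_marginal measurable_px lx Iu; have Ey := Rint_marginal measurable_py ly Iv.
have I1 := intgD Uy Iy; have I2 := intgD Ux Ix.
split; first exact: intgB.
by rewrite RintB// !RintD// Zx Zy Ex Ey !addr0.
Qed.

Lemma weak_duality (u : 'rV[R]_d -> R) : C11_lip1 u ->
  gap mu nu u <= \int[pi]_p cost (px p) (py p) (pz p).
Proof.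
move=> cu; have [Ig <-] := jet_gap_integral cu.
by apply: Rint_le => //; [exact: intg_cost | exact: jet_gap_le_cost].
Qed.

Lemma duality_equality (u : 'rV[R]_d -> R) : C11_lip1 u ->
  gap mu nu u = \int[pi]_p cost (px p) (py p) (pz p) <->
  {ae pi, forall p : T3 R d, jet_gap u p = cost (px p) (py p) (pz p)}.
Proof.
move=> cu; have [Ig E] := jet_gap_integral cu; have Ic := intg_cost.
pose h p := cost (px p) (py p) (pz p) - jet_gap u p.
have Ih : intg pi h by exact: intgB.
have h0 p : 0 <= h p by rewrite subr_ge0; exact: jet_gap_le_cost.
have Eh : \int[pi]_p h p = \int[pi]_p cost (px p) (py p) (pz p) - gap mu nu u.
  by rewrite RintB// E.
have Z : (\int[pi]_p `|(h p)%:E| = (\int[pi]_p h p)%:E)%E.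
  rewrite -EFin_Rintegral//; apply: eq_integral => p _; rewrite gee0_abs// lee_fin.
  exact: h0.
have := ae_eq_integral_abs pi measurableT (measurable_int _ Ih); rewrite /= Z Eh => -[H1 H2].
split=> [eq|ae].
- have := H1; rewrite eq subrr => /(_ erefl); apply: filterS => p /(_ I) /= [].
  by rewrite /h => /eqP; rewrite subr_eq0 => /eqP.
- have ae' : ae_eq pi setT (EFin \o h) (cst 0%E).
    by apply: filterS ae => p /= Ep _; rewrite /h Ep subrr.
  by have /(congr1 fine)/= /eqP := H2 ae'; rewrite subr_eq0 => /eqP.
Qed.

End WeakDuality.

(** * Hahn-Banach *)

Section HahnBanach.
Context {R : realType} {V : lmodType R}.
Variable E : set V.
Hypotheses (E0 : E 0) (ED : forall f g, E f -> E g -> E (f + g))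
  (EZ : forall (a : R) f, E f -> E (a *: f)).
Implicit Types (f g : V) (q : V -> R).

Definition sublinear_on q := [/\ q 0 = 0,
  (forall t f, 0 < t -> E f -> q (t *: f) <= t * q f) &
  (forall f g, E f -> E g -> q (f + g) <= q f + q g)].

Let EN f : E f -> E (- f).
Proof. by move=> Ef; rewrite -scaleN1r; exact: EZ. Qed.

Let sublinear_opp q f : sublinear_on q -> E f -> - q (- f) <= q f.
Proof.
by move=> [q0 _ qD] Ef; have := qD _ _ Ef (EN Ef); rewrite subrr q0; lra.
Qed.

Variable p : V -> R.
Hypothesis sp : sublinear_on p.

(** The value 0 off [E] makes a minorant determined by its restriction to [E], so that comparing
    minorants on all of [V] amounts to comparing them on [E]. *)
Let minorant q := [/\ sublinear_on q, forall f, E f -> q f <= p f &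
  forall f, ~ E f -> q f = 0].

(* The infimum of a chain of sublinear minorants of p is sublinear: it is bounded
   below by - p (- f). *)
Let minorant_chain (A : set (V -> R)) : A !=set0 -> A `<=` minorant ->
  (forall q r, A q -> A r -> (forall f, q f <= r f) \/ (forall f, r f <= q f)) ->
  exists2 q, minorant q & forall r, A r -> forall f, q f <= r f.
Proof.
move=> [q1 Aq1] Am tot.
pose S f := [set q f | q in A].
have S0 f : S f !=set0 by exists (q1 f), q1.
have lbS f : E f -> lbound (S f) (- p (- f)).
  move=> Ef _ [q Aq <-]; have [sq qp _] := Am _ Aq.
  apply: le_trans (sublinear_opp sq Ef); rewrite lerN2; apply: qp; exact: EN.
have infS f r : E f -> A r -> inf (S f) <= r f.
  move=> Ef Ar; apply: ge_inf; last by exists r.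
  by exists (- p (- f)); exact: lbS.
pose q f := if `[< E f >] then inf (S f) else 0.
have qE f : E f -> q f = inf (S f) by move=> Ef; rewrite /q asboolT.
have qN f : ~ E f -> q f = 0 by move=> Ef; rewrite /q asboolF.
exists q; last first.
  move=> r Ar f; case: (pselect (E f)) => Ef; first by rewrite qE//; exact: infS.
  by rewrite qN//; have [_ _ ->] := Am _ Ar.
split=> //; last by move=> f Ef; rewrite qE// (le_trans (infS _ _ Ef Aq1))//; have [_ + _] := Am _ Aq1; apply.
split.
- rewrite qE//; apply/eqP; rewrite eq_le; apply/andP; split.
    by apply: le_trans (infS _ _ E0 Aq1) _; have [[-> _ _] _ _] := Am _ Aq1.
  by apply: lb_le_inf => // _ [r Ar <-]; have [[-> _ _] _ _] := Am _ Ar.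
- move=> t f t0 Ef; rewrite !qE//; last exact: EZ.
  rewrite mulrC -ler_pdivrMr//; apply: lb_le_inf => // _ [r Ar <-].
  rewrite ler_pdivrMr// mulrC; apply: le_trans (infS _ _ (EZ t Ef) Ar) _.
  by have [[_ rZ _] _ _] := Am _ Ar; exact: rZ.
- move=> f g Ef Eg; rewrite !qE//; last exact: ED.
  rewrite -lerBlDr; apply: lb_le_inf => // _ [r Ar <-]; rewrite lerBlDr -lerBlDl.
  apply: lb_le_inf => // _ [s As <-]; rewrite lerBlDl.
  have Efg := ED Ef Eg.
  (* Subadditivity of an infimum would need one functional for both summands; in a chain the smaller
     of [r] and [s] serves. *)
  have [rs|sr] := tot _ _ Ar As.
  + apply: le_trans (infS _ _ Efg Ar) _; have [[_ _ rD] _ _] := Am _ Ar.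
    by apply: le_trans (rD _ _ Ef Eg) _; rewrite lerD2l.
  + apply: le_trans (infS _ _ Efg As) _; have [[_ _ sD] _ _] := Am _ As.
    by apply: le_trans (sD _ _ Ef Eg) _; rewrite lerD2r.
Qed.

(* Koenig: if q is a minimal sublinear functional, it coincides with
   f |-> inf_(t >= 0) (q (f + t g) - t q g), hence q (f + g) >= q f + q g. *)
Let minimal_additive q : minorant q ->
  (forall r, minorant r -> (forall f, r f <= q f) -> r = q) ->
  forall f g, E f -> E g -> q (f + g) = q f + q g.
Proof.
move=> mq qmin f g Ef Eg; have [sq qp qN] := mq; have [q0 qZ qD] := sq.
pose S h := [set q (h + t *: g) - t * q g | t in [set t : R | 0 <= t]].
have S0 h : S h !=set0.
  by exists (q (h + 0 *: g) - 0 * q g); exists 0 => //=.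
have lbS h : E h -> lbound (S h) (- q (- h)).
  move=> Eh _ [t /= t0 <-].
  have tg : q (t *: g) <= t * q g.
    move: t0; rewrite le_eqVlt => /predU1P[<-|t0]; first by rewrite scale0r mul0r q0.
    exact: qZ.
  have := sublinear_opp sq (EZ (- t) Eg).
  have EE : E (h + t *: g) by apply: ED => //; exact: EZ.
  have := qD _ _ EE (EN Eh); rewrite addrAC subrr add0r => H1.
  case: (ltgtP t 0) t0 => // [t0|->] _; last first.
    rewrite scale0r addr0 mul0r subr0 => _; exact: sublinear_opp.
  have := qZ t^-1 (t *: g); rewrite invr_gt0 => /(_ t0 (EZ t Eg)).
  rewrite scalerA mulVf ?gt_eqF// scale1r mulrC ler_pdivlMr// mulrC => H2 _; lra.
have infS h t : E h -> 0 <= t -> inf (S h) <= q (h + t *: g) - t * q g.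
  move=> Eh t0; apply: ge_inf; last by exists t.
  by exists (- q (- h)); exact: lbS.
pose r h := if `[< E h >] then inf (S h) else 0.
have rE h : E h -> r h = inf (S h) by move=> Eh; rewrite /r asboolT.
have rN h : ~ E h -> r h = 0 by move=> Eh; rewrite /r asboolF.
have rq h : r h <= q h.
  case: (pselect (E h)) => Eh; last by rewrite rN// qN.
  by rewrite rE//; have := infS h 0 Eh (lexx _); rewrite scale0r addr0 mul0r subr0.
have mr : minorant r.
  split=> //; last by move=> h Eh; exact: le_trans (rq h) (qp _ Eh).
  split.
  - apply/eqP; rewrite eq_le -{1}q0 rq /= rE//; apply: lb_le_inf => // _ [t /= t0 <-].
    rewrite add0r subr_ge0; move: t0; rewrite le_eqVlt => /predU1P[<-|t0].
      by rewrite scale0r mul0r q0.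
    have := qZ t^-1 (t *: g); rewrite invr_gt0 => /(_ t0 (EZ t Eg)).
    by rewrite scalerA mulVf ?gt_eqF// scale1r mulrC ler_pdivlMr// mulrC.
  - move=> s h s0 Eh; rewrite !rE//; last exact: EZ.
    rewrite mulrC -ler_pdivrMr//; apply: lb_le_inf => // _ [t /= t0 <-].
    rewrite ler_pdivrMr//; have st : 0 <= s * t by rewrite mulr_ge0// ltW.
    apply: le_trans (infS _ _ (EZ s Eh) st) _.
    rewrite -scalerA -scalerDr mulrBl [t * q g * s]mulrC mulrA lerB// mulrC.
    by apply: qZ => //; apply: ED => //; exact: EZ.
  - move=> h k Eh Ek; rewrite !rE//; last exact: ED.
    rewrite -lerBlDr; apply: lb_le_inf => // _ [t /= t0 <-]; rewrite lerBlDr -lerBlDl.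
    apply: lb_le_inf => // _ [t' /= t0' <-]; rewrite lerBlDl.
    apply: le_trans (infS _ _ (ED Eh Ek) (addr_ge0 t0 t0')) _.
    have := qD _ _ (ED Eh (EZ t Eg)) (ED Ek (EZ t' Eg)).
    by rewrite addrACA -scalerDl mulrDl; lra.
(* Minimality forces [r = q], and the member [t = 1] of [S f] then gives superadditivity. *)
have rqE := qmin _ mr rq.
apply/eqP; rewrite eq_le qD//=.
have := infS f 1 Ef ler01; rewrite -rE// rqE scale1r mul1r; lra.
Qed.

Theorem hahn_banach : exists L : V -> R,
  [/\ forall f g, E f -> E g -> L (f + g) = L f + L g,
      forall (a : R) f, E f -> L (a *: f) = a * L f &
      forall f, E f -> L f <= p f].
Proof.
pose T := {q : V -> R | minorant q}.
pose le (s t : T) := `[< forall f, sval t f <= sval s f >].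
pose p0 f := if `[< E f >] then p f else 0.
have mp0 : minorant p0.
  have [p00 pZ pD] := sp.
  have pE f : E f -> p0 f = p f by move=> Ef; rewrite /p0 asboolT.
  split=> [|f Ef|f Ef]; last by rewrite /p0 asboolF.
  - split; first by rewrite pE.
    + by move=> t f t0 Ef; rewrite !pE; [exact: pZ | | exact: EZ].
    + by move=> f g Ef Eg; rewrite !pE//; [exact: pD | exact: ED].
  - by rewrite pE.
have [||||[q mq] qmax] := @Zorn T le.
- by move=> t; apply/asboolP.
- by move=> r s t /asboolP rs /asboolP st; apply/asboolP => f; exact: le_trans (st f) (rs f).
- move=> [s ms] [t mt] /asboolP /= st /asboolP /= ts; apply: eq_exist; apply/funext => f.
  by apply/eqP; rewrite eq_le st ts.
- move=> A tot; case: (pselect (A !=set0)) => [[s0 As0]|nA]; last first.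
    by exists (exist _ p0 mp0) => s As; exfalso; apply: nA; exists s.
  pose B := [set sval s | s in A].
  have B0 : B !=set0 by exists (sval s0), s0.
  have Bm : B `<=` minorant by move=> _ [[s ms] As <-].
  have Bt q r : B q -> B r -> (forall f, q f <= r f) \/ (forall f, r f <= q f).
    move=> [s As <-] [t At <-].
    by case: (tot _ _ As At) => /asboolP; [right|left].
  have [q mq Hq] := minorant_chain B0 Bm Bt.
  by exists (exist _ q mq) => s As; apply/asboolP => f; apply: Hq; exists s.
- have add := @minimal_additive q mq _.
  have {}add : forall f g, E f -> E g -> q (f + g) = q f + q g.
    apply: add => r mr rq; have := qmax (exist _ r mr); rewrite /le /=.
    by move=> /(_ (asboolT rq)) /(congr1 sval).
  have [[q0 qZ qD] qp _] := mq.
  have qN f : E f -> q (- f) = - q f.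
    by move=> Ef; have := add _ _ Ef (EN Ef); rewrite subrr q0; lra.
  have qZ' (t : R) f : 0 < t -> E f -> q (t *: f) = t * q f.
    move=> t0 Ef; apply/eqP; rewrite eq_le qZ//=.
    have := qZ _ _ t0 (EN Ef); rewrite scalerN !qN//; last exact: EZ.
    by rewrite mulrN lerN2.
  exists q; split => // a f Ef.
  have [a0|a0|->] := ltgtP a 0; first last.
  - by rewrite scale0r mul0r.
  - exact: qZ'.
  - by rewrite -[a]opprK scaleNr qN ?qZ' ?oppr_gt0 ?mulNr//; exact: EZ.
Qed.

End HahnBanach.

(** * Daniell-Riesz representation *)

Definition clamp {R : realType} (t : R) : R := Num.min (Num.max t 0) 1.

Lemma clamp_itv {R : realType} (t : R) : 0 <= clamp t <= 1.
Proof. by rewrite /clamp ge_min lexx orbT le_min ler01 le_max lexx orbT. Qed.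

Lemma clamp0 {R : realType} (t : R) : t <= 0 -> clamp t = 0.
Proof. by move=> t0; rewrite /clamp max_r// min_l. Qed.

Lemma clamp1 {R : realType} (t : R) : 1 <= t -> clamp t = 1.
Proof. by move=> t1; rewrite /clamp max_l ?(le_trans _ t1)// min_r. Qed.

Lemma clamp_mono {R : realType} (s t : R) : s <= t -> clamp s <= clamp t.
Proof. by move=> st; rewrite /clamp le_min2// ge_max !le_max st lexx orbT. Qed.

(** Layer decomposition: the summand of index [j] is the part of [t] between [j] and [j + 1]. *)
Lemma sum_clamp {R : realType} (t : R) n : 0 <= t -> t <= n%:R ->
  \sum_(j < n) clamp (t - j%:R) = t.
Proof.
move=> t0; elim: n => [|n IH] tn; first by rewrite big_ord0; apply/eqP; rewrite eq_le t0.
rewrite big_ord_recr /=; have [tn'|nt] := leP t n%:R.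
  by rewrite IH// clamp0 ?subr_le0// addr0.
rewrite (_ : \sum_(j < n) _ = n%:R); last first.
  rewrite -[RHS]mulr1 -[in RHS](card_ord n) mulr_natl -sumr_const; apply: eq_bigr => j _.
  rewrite clamp1// lerBrDr; apply: le_trans (ltW nt).
  by rewrite -[1]/(1%:R) -natrD ler_nat add1n.
rewrite /clamp max_l ?subr_ge0 ?(ltW nt)// min_l; first by rewrite addrC subrK.
by rewrite lerBlDr -[1 in leRHS]/(1%:R) -natrD add1n.
Qed.

Lemma sum_level {R : realType} (t : R) n :
  Num.min t n.+1%:R <= 1 + \sum_(j < n) (if j.+1%:R <= t then 1 else 0).
Proof.
elim: n => [|n IH]; first by rewrite big_ord0 addr0 ge_min lexx orbT.
rewrite big_ord_recr /= addrA; case: ifPn => h.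
  apply: le_trans (lerD IH (lexx 1)).
  rewrite addr_minl le_min !ge_min lerDl ler01 /=.
  by rewrite [X in _ || (_ <= X)](_ : _ = n.+2%:R) ?lexx ?orbT// -[RHS]natr1.
rewrite addr0; apply: le_trans IH; rewrite -ltNge in h.
by rewrite le_min !ge_min lexx /= (ltW h).
Qed.

(* Daniell-Riesz: a normalised positive functional L on a class C of bounded
   functions is integration against a probability measure as soon as the increasing
   nonnegative sequences of C that exceed 1 everywhere satisfy sup L >= 1. *)
Section Representation.
Context {R : realType} {disp : measure_display} {T : measurableType disp}.
Variables (C : set (T -> R)) (L : (T -> R) -> R).
Hypotheses (Ccst : forall c, C (fun=> c))
  (CD : forall f g, C f -> C g -> C (fun x => f x + g x))
  (CM : forall f g, C f -> C g -> C (fun x => f x * g x))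
  (Cclamp : forall f, C f -> C (fun x => clamp (f x)))
  (Cmeas : forall f, C f -> measurable_fun setT f)
  (Cbnd : forall f, C f -> exists M, forall x, `|f x| <= M).
Hypothesis Cgen : @measurable _ T `<=`
  <<s [set A | exists f a, C f /\ A = [set x | a < f x]] >>.
Hypotheses (LD : forall f g, C f -> C g -> L (fun x => f x + g x) = L f + L g)
  (LZ : forall a f, C f -> L (fun x => a * f x) = a * L f)
  (Lmono : forall f g, C f -> C g -> (forall x, f x <= g x) -> L f <= L g)
  (L1 : L (fun=> 1) = 1).

(** An increasing majorant of the indicator of [S]. The value 1 has to be reached at a finite index,
    so that multiplying by another such sequence keeps the property. *)
Definition unit_cover (S : set T) (g : nat -> T -> R) :=
  [/\ forall n, C (g n), forall n x, 0 <= g n x,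
      forall x m n, (m <= n)%N -> g m x <= g n x &
      forall x, S x -> exists n, 1 <= g n x].

Hypothesis dini : forall g, unit_cover setT g -> forall e, 0 < e -> exists n, 1 - e <= L (g n).

Let CZ a f : C f -> C (fun x => a * f x).
Proof. by move=> Cf; apply: CM. Qed.

Let CB f g : C f -> C g -> C (fun x => f x - g x).
Proof.
move=> Cf Cg; have := CD Cf (CZ (-1) Cg).
by congr C; apply/funext => x; rewrite mulN1r.
Qed.

Let LB f g : C f -> C g -> L (fun x => f x - g x) = L f - L g.
Proof.
move=> Cf Cg; have := LD Cf (CZ (-1) Cg); rewrite LZ// mulN1r => <-.
by congr L; apply/funext => x; rewrite mulN1r.
Qed.

Let Lcst c : L (fun=> c) = c.
Proof.
have := LZ c (Ccst 1); rewrite L1 mulr1 => {2}<-.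
by congr L; apply/funext => x; rewrite mulr1.
Qed.

Let Lge0 f : C f -> (forall x, 0 <= f x) -> 0 <= L f.
Proof. by move=> Cf f0; rewrite -(Lcst 0); apply: Lmono. Qed.

Let Csum n (F : nat -> T -> R) : (forall i, C (F i)) -> C (fun x => \sum_(i < n) F i x).
Proof.
move=> CF; elim: n => [|n IH].
  rewrite (_ : (fun x => _) = fun=> 0)//; apply/funext => x; by rewrite big_ord0.
rewrite (_ : (fun x => _) = fun x => \sum_(i < n) F i x + F n x); first exact: CD.
by apply/funext => x; rewrite big_ord_recr.
Qed.

Let Lsum n (F : nat -> T -> R) : (forall i, C (F i)) ->
  L (fun x => \sum_(i < n) F i x) = \sum_(i < n) L (F i).
Proof.
move=> CF; elim: n => [|n IH].
  rewrite big_ord0 -[RHS](Lcst 0); congr L; apply/funext => x; by rewrite big_ord0.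
rewrite [RHS]big_ord_recr /= -IH -LD//; last exact: Csum.
by congr L; apply/funext => x; rewrite big_ord_recr.
Qed.

(** Upper integral of the indicator of [S]: the infimum over covers of [sup_n L (g n)], with [r] any
    bound for that supremum. *)
Definition rep (S : set T) : \bar R :=
  ereal_inf [set r%:E | r in [set r | exists g, unit_cover S g /\ forall n, L (g n) <= r]].

Let rep_le S g r : unit_cover S g -> (forall n, L (g n) <= r) -> (rep S <= r%:E)%E.
Proof. by move=> cg Lr; apply: ereal_inf_lbound; exists r => //; exists g. Qed.

Let rep_ge0 S : (0 <= rep S)%E.
Proof.
apply: le_ereal_inf_tmp => _ [r [g [[Cg g0 _ _] Lr]] <-]; rewrite lee_fin.
by apply: le_trans (Lr 0%N); apply: Lge0.
Qed.

Let cover_cst f S : C f -> (forall x, 0 <= f x) -> (forall x, S x -> 1 <= f x) ->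
  unit_cover S (fun=> f).
Proof. by move=> Cf f0 f1; split => // x Sx; exists 0%N; exact: f1. Qed.

Let rep_le1 S : (rep S <= 1%:E)%E.
Proof.
apply: (@rep_le _ (fun=> fun=> 1)); last by rewrite L1.
by apply: cover_cst.
Qed.

Let rep_fin S : rep S \is a fin_num.
Proof. by rewrite ge0_fin_numE// (le_lt_trans (rep_le1 S))// ltey. Qed.

Let rep_adherent S (e : R) : 0 < e ->
  exists g r, [/\ unit_cover S g, forall n, L (g n) <= r & (r%:E < rep S + e%:E)%E].
Proof.
move=> e0; have [_ [r [g [cg Lr]] <-] lt] := lb_ereal_inf_adherent e0 (rep_fin S).
by exists g, r.
Qed.

Let rep0 : rep set0 = 0%E.
Proof.
apply/eqP; rewrite eq_le rep_ge0 andbT.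
by apply: (@rep_le _ (fun=> fun=> 0)); [exact: cover_cst | rewrite Lcst].
Qed.

Let rep_mono : {homo rep : A B / A `<=` B >-> (A <= B)%E}.
Proof.
move=> A B AB; apply: ereal_inf_le_tmp => _ [r [g [[Cg g0 gm g1] Lr]] <-].
by exists r => //; exists g; split => //; split => // x /AB; exact: g1.
Qed.

(** Covers within [e / 2^(m+1)] of optimal are summed diagonally: [G n] adds the n-th terms of the
    first [n + 1] covers, so it remains a finite sum and is increasing. *)
Let rep_subadd (F : nat -> set T) : (rep (\bigcup_n F n) <= \sum_(i <oo) rep (F i))%E.
Proof.
apply/lee_addgt0Pr => e e0.
have ex m : exists gr : (nat -> T -> R) * R, [/\ unit_cover (F m) gr.1,
    forall n, L (gr.1 n) <= gr.2 & (gr.2%:E < rep (F m) + (e / (2 ^ m.+1)%:R)%:E)%E].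
  have em : 0 < e / (2 ^ m.+1)%:R by rewrite divr_gt0// ltr0n expn_gt0.
  by have [g [r H]] := rep_adherent (F m) em; exists (g, r).
have [gr H] := choice ex.
pose G n x := \sum_(m < n.+1) (gr m).1 n x.
have cG : unit_cover (\bigcup_n F n) G.
  split.
  - by move=> n; apply: (Csum _ (F := fun m => (gr m).1 n)) => m; case: (H m) => -[].
  - by move=> n x; apply: sumr_ge0 => m _; case: (H m) => -[].
  - move=> x m n mn; rewrite /G.
    apply: (@le_trans _ _ (\sum_(k < m.+1) (gr k).1 n x)).
      by apply: ler_sum => k _; case: (H k) => -[_ _ + _] _ _; apply.
    rewrite -!(big_mkord xpredT (fun k => (gr k).1 n x)).
    rewrite [leRHS](@big_cat_nat _ _ _ m.+1)//= lerDl sumr_ge0// => k _.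
    by case: (H k) => -[].
  - move=> x [m _ Fx]; have [[_ g0 gm g1] _ _] := H m; have [k gk] := g1 _ Fx.
    exists (maxn m k); apply: (le_trans (le_trans gk (gm x _ _ (leq_maxr m k)))).
    have mlt : (m < (maxn m k).+1)%N by rewrite ltnS leq_maxl.
    rewrite /G (bigD1 (Ordinal mlt))//= lerDl sumr_ge0// => i _.
    by case: (H i) => -[].
have [Soo|Sfin] := eqVneq (\sum_(i <oo) rep (F i))%E +oo%E.
  by rewrite Soo addye// leey.
have S0 : (0 <= \sum_(i <oo) rep (F i))%E by apply: nneseries_ge0.
have Sf : (\sum_(i <oo) rep (F i))%E \is a fin_num.
  by rewrite ge0_fin_numE// lt_neqAle Sfin leey.
rewrite -(fineK Sf) -EFinD; apply: (rep_le cG) => n.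
rewrite (Lsum _ (F := fun m => (gr m).1 n)); last by move=> m; case: (H m) => -[].
rewrite -lee_fin EFinD fineK//.
apply: le_trans (epsilon_trick xpredT (fun m => rep_ge0 (F m)) (ltW e0)).
rewrite -sumEFin.
apply: (@le_trans _ _ (\sum_(0 <= i < n.+1) ((gr i).2)%:E)%E).
  rewrite -(big_mkord xpredT (fun k => (L ((gr k).1 n))%:E)).
  by apply: lee_sum => i _; rewrite lee_fin; case: (H i).
apply: (@le_trans _ _ (\sum_(0 <= i < n.+1) (rep (F i) + (e / (2 ^ i.+1)%:R)%:E))%E).
  by apply: lee_sum => i _; case: (H i) => _ _ /ltW.
apply: nneseries_lim_ge => k _ _; apply: adde_ge0 => //.
by rewrite lee_fin divr_ge0// ltW.
Qed.

Let mixin := isOuterMeasure.Build R T rep rep0 rep_ge0 rep_mono rep_subadd.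
Let repO : {outer_measure set T -> \bar R} := HB.pack rep mixin.

(** A nearly optimal cover [g] of [X] is split by [h n], which increases to the indicator of the
    level set: [g n h n] covers the part inside, and [g n (1 - h N)] the part outside for a fixed
    large [N]. *)
Let level_caratheodory f a : C f -> caratheodory_measurable repO [set x | a < f x].
Proof.
move=> Cf; apply: le_caratheodory_measurable => X.
rewrite /repO /=.
apply/lee_addgt0Pr => e e0; have e20 : 0 < e / 2 by exact: divr_gt0.
have [g [r [[Cg g0 gm g1] Lr re]]] := rep_adherent X e20.
pose h n x := clamp (n%:R * (f x - a)).
have Ch n : C (h n) by apply: Cclamp; apply: CZ; apply: CB.
have h0 n x : 0 <= h n x by case/andP: (clamp_itv (n%:R * (f x - a))).
have h1 n x : h n x <= 1 by case/andP: (clamp_itv (n%:R * (f x - a))).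
have hm x m n : (m <= n)%N -> h m x <= h n x.
  move=> mn; rewrite /h; have [fa|/ltW fa] := leP (f x - a) 0.
    by rewrite !clamp0// mulr_ge0_le0.
  by apply: clamp_mono; rewrite ler_wpM2r// ler_nat.
have Cgh n m : C (fun x => g n x * h m x) by exact: CM.
have ghm x m n m' n' : (m <= n)%N -> (m' <= n')%N -> g m x * h m' x <= g n x * h n' x.
  by move=> mn mn'; apply: ler_pM => //; [exact: gm | exact: hm].
pose S := [set L (fun x => g n x * h n x) | n in [set: nat]].
have ghr n : L (fun x => g n x * h n x) <= r.
  by apply: le_trans (Lr n); apply: Lmono => // x; rewrite ler_piMr.
have hS : has_sup S.
  by split; [exists (L (fun x => g 0%N x * h 0%N x)), 0%N | exists r => _ [n _ <-]].
have B1 : (rep (X `&` [set x | (a < f x)%R]) <= (sup S)%:E)%E.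
  apply: (@rep_le _ (fun n x => g n x * h n x)).
  - split => //; [by move=> n x; rewrite mulr_ge0 | by move=> x m n mn; exact: ghm |].
    move=> x [Xx /= ax]; have [n gn] := g1 _ Xx.
    have ax0 : 0 < f x - a by rewrite subr_gt0.
    pose k := (Num.truncn (f x - a)^-1).+1; exists (maxn n k).
    rewrite -[1](mulr1 1); apply: ler_pM => //.
      by apply: le_trans gn _; apply: gm; exact: leq_maxl.
    apply: le_trans (hm x k _ (leq_maxr _ _)); rewrite /h clamp1//.
    by rewrite -ler_pdivrMr// div1r ltW// truncnS_gt.
  - by move=> n; apply: ub_le_sup; [exact: hS.2 | exists n].
have [_ [N _ <-] HN] := sup_adherent e20 hS.
have B2 : (rep (X `&` ~` [set x | (a < f x)%R]) <= (r - L (fun x => (g N x * h N x)))%:E)%E.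
  apply: (@rep_le _ (fun n x => g n x * (1 - h N x))).
  - split.
    + by move=> n; apply: CM => //; apply: CB.
    + by move=> n x; rewrite mulr_ge0// subr_ge0.
    + by move=> x m n mn; rewrite ler_wpM2r ?subr_ge0//; exact: gm.
    + move=> x [Xx /= nax]; have [n gn] := g1 _ Xx; exists n.
      rewrite /h clamp0 ?subr0 ?mulr1// mulr_ge0_le0// subr_le0 leNgt; exact/negP.
  (* Monotonicity gives [g n (1 - h N) <= g k - g N h N], and [L (g k) <= r]. *)
  - move=> n; pose k := maxn n N.
    apply: (@le_trans _ _ (L (g k) - L (fun x => g N x * h N x))); last by rewrite lerB.
    rewrite -LB//; apply: Lmono => [||x].
    + by apply: CM => //; apply: CB.
    + exact: CB.
    + apply: (@le_trans _ _ (g k x * (1 - h N x))).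
        by rewrite ler_wpM2r ?subr_ge0//; apply: gm; exact: leq_maxl.
      by rewrite mulrBr mulr1 lerB//; apply: ghm => //; exact: leq_maxr.
apply: le_trans (leeD B1 B2) _; rewrite -EFinD.
have : (r%:E <= rep X + (e / 2)%:E)%E by exact: ltW.
rewrite -(fineK (rep_fin X)) -!EFinD !lee_fin; lra.
Qed.

Let measurable_caratheodory (A : set T) : measurable A -> caratheodory_measurable repO A.
Proof.
suff : @measurable _ T `<=` caratheodory_measurable repO by apply.
clear A.
apply: subset_trans Cgen _; apply: smallest_sub.
  split; first exact: caratheodory_measurable_set0.
  - by move=> A mA; rewrite setTD; exact: caratheodory_measurable_setC.
  - by move=> F mF; exact: caratheodory_measurable_bigcup.
by move=> _ [f [a [Cf ->]]]; exact: level_caratheodory.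
Qed.

Let rep_sigma_additive : semi_sigma_additive (rep : set T -> \bar R).
Proof.
move=> F mF tF mUF.
have := @caratheodory_measure_sigma_additive R T repO F.
apply => //; last exact: measurable_caratheodory.
by move=> n; exact: measurable_caratheodory.
Qed.

(** The lower bound is where [dini] is used: it excludes a loss of mass. *)
Let rep1 : rep setT = 1%E.
Proof.
apply/eqP; rewrite eq_le rep_le1 /=; apply: le_ereal_inf_tmp => _ [r [g [cg Lr]] <-].
rewrite lee_fin; apply/ler_addgt0Pr => e e0.
have [n Hn] := dini cg e0; have := Lr n; lra.
Qed.

Let repM := isMeasure.Build disp T R rep rep0 rep_ge0 rep_sigma_additive.
Let repmeas : {measure set T -> \bar R} := HB.pack rep repM.
Let repP := Measure_isProbability.Build disp T R repmeas rep1.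
Let P : probability T R := HB.pack rep repM repP.

Let intgC f : C f -> intg P f.
Proof.
move=> Cf; have [M HM] := Cbnd Cf.
by apply: (intg_le (Cmeas Cf) HM); exact: intg_cst.
Qed.

(** [N f] is the sum of its layers [th j], each a one-function cover of the level set [A j], so
    [P (A j) <= L (th j)]. Since [N f] exceeds the sum of the indicators of [A j] by at most 1, the
    error after division is [1/N]. *)
Let Rint_le_L f : C f -> (forall x, 0 <= f x <= 1) -> \int[P]_x f x <= L f.
Proof.
move=> Cf f01; apply/ler_addgt0Pr => e e0.
pose N := (Num.truncn e^-1).+1.
have N0 : 0 < N%:R :> R by rewrite ltr0n.
have Ne : N%:R^-1 <= e by rewrite -[e]invrK lef_pV2 ?posrE ?invr_gt0// ltW// truncnS_gt.
pose th j x := clamp (N%:R * f x - j%:R).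
have Cth j : C (th j) by apply: Cclamp; apply: CB => //; exact: CZ.
pose A j := [set x | j.+1%:R <= N%:R * f x].
have mA j : measurable (A j).
  have := measurable_funM (measurable_cst (N%:R : R)) (Cmeas Cf) measurableT (measurable_itv `[j.+1%:R, +oo[).
  by rewrite setTI; congr measurable; apply/seteqP; split=> x /=; rewrite in_itv/= andbT.
have IA j : intg P (\1_(A j)) by exact: integrable_indic.
have PA j : \int[P]_x \1_(A j) x <= L (th j).
  rewrite /Rintegral integral_indic// setIT -lee_fin fineK; last exact: rep_fin.
  apply: (@rep_le _ (fun=> th j)) => //; apply: cover_cst => //.
  - by move=> x; case/andP: (clamp_itv (N%:R * f x - j%:R)).
  - by move=> x /= Ax; rewrite /th clamp1// lerBrDr nat1r.
have E1 : \int[P]_x (N%:R * f x) <= 1 + \sum_(j < N) L (th j).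
  apply: (@le_trans _ _ (\int[P]_x (1 + \sum_(j < N) \1_(A j) x))).
    apply: Rint_le.
    - by apply: intgZ; exact: intgC.
    - by apply: intgD; [exact: intg_cst | exact: (intg_sum _ (fun j : 'I_N => IA j))].
    - move=> x; have := sum_level (N%:R * f x) N.
      rewrite min_l => [H|]; last first.
        have /andP[_ f1] := f01 x; apply: (@le_trans _ _ N%:R); last by rewrite ler_nat.
        by rewrite ler_piMr// ltW.
      apply: le_trans H _; rewrite lerD2l; apply: ler_sum => j _.
      by rewrite indicE; case: ifPn => h; [rewrite mem_set | exact: ler0n].
  rewrite RintD; [|exact: intg_cst|exact: (intg_sum _ (fun j : 'I_N => IA j))].
  rewrite Rint_cst lerD2l (Rint_sum _ (fun j : 'I_N => IA j)).
  by apply: ler_sum => j _; exact: PA.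
have E2 : \sum_(j < N) L (th j) = N%:R * L f.
  rewrite -Lsum// -LZ//; congr L; apply/funext => x; rewrite /th sum_clamp//.
    by have /andP[f0 _] := f01 x; rewrite mulr_ge0.
  by have /andP[_ f1] := f01 x; rewrite ler_piMr// ltW.
move: E1; rewrite E2 RintZ; last exact: intgC.
move=> E1; rewrite -(ler_pM2l N0); apply: le_trans E1 _.
rewrite mulrDr addrC lerD2l; apply: (@le_trans _ _ (N%:R * N%:R^-1)).
  by rewrite mulfV// lt0r_neq0.
by rewrite ler_wpM2l// ltW.
Qed.

Lemma representation : exists P : probability T R,
  forall f, C f -> intg P f /\ \int[P]_x f x = L f.
Proof.
exists P => f Cf; split; first exact: intgC.
have [M HM] := Cbnd Cf.
have M0 : 0 < `|M| + 1 by rewrite ltr_wpDl.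
(* After rescaling [f] into [0, 1], the one-sided bound for both [u] and [1 - u] gives equality. *)
pose K := 2 * (`|M| + 1); have K0 : 0 < K by rewrite mulr_gt0.
pose u x := K^-1 * (f x + (`|M| + 1)).
have Cu : C u by apply: CZ; apply: CD.
have u01 x : 0 <= u x <= 1.
  have := HM x; have := ler_norm M; rewrite ler_norml => m1 /andP[A B].
  rewrite /u mulrC divr_ge0 ?(ltW K0)//=; last by lra.
  by rewrite ler_pdivrMr// mul1r /K; lra.
have u01' x : 0 <= 1 - u x <= 1 by have := u01 x => /andP[A B]; apply/andP; split; lra.
have C1u : C (fun x => 1 - u x) by apply: CB.
have A1 := Rint_le_L Cu u01; have A2 := Rint_le_L C1u u01'.
have Iu := intgC Cu; have If := intgC Cf.
rewrite RintB ?Rint_cst in A2; [|exact: intg_cst|exact: Iu].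
rewrite LB ?L1 in A2; [|exact: Ccst|exact: Cu].
have E : \int[P]_x u x = L u by apply/eqP; rewrite eq_le A1 /=; lra.
move: E; rewrite /u RintZ; last by apply: intgD; [exact: If | exact: intg_cst].
rewrite RintD ?Rint_cst; [|exact: If|exact: intg_cst].
rewrite LZ; last exact: CD.
rewrite LD// Lcst => /(mulfI (lt0r_neq0 _)).
by rewrite invr_gt0 => /(_ K0) /addIr.
Qed.

End Representation.

(** * The dual functional *)

Section DualFunctional.
Context {R : realType} {d : nat}.
Variables (mu nu : probability (Rd R d) R) (I : R).
Hypotheses (mu2 : finite_second_moment mu) (nu2 : finite_second_moment nu).
Hypothesis gapI : forall u, C11_lip1 u -> gap mu nu u <= I.
Implicit Types (f g : T3 R d -> R) (phi psi : 'rV[R]_d -> R) (Phi Psi : 'rV[R]_d -> 'rV[R]_d).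

Definition quad_growth f := exists K, forall p, `|f p| <= K * weight p.

Definition dual_bound phi psi Phi Psi t (p : T3 R d) :=
  phi (px p) + psi (py p) + dotv (Phi (px p)) (pz p - px p)
  + dotv (Psi (py p)) (pz p - py p) + t * cost (px p) (py p) (pz p).

(** The functional p of the overview, named [q] below, is the infimum of these [s]. [Phi] and [Psi]
    may be arbitrary maps: they enter the pointwise bound but no integral. *)
Definition dominated f s := exists phi psi Phi Psi t, [/\ 0 <= t, intg mu phi, intg nu psi,
  forall p, f p <= dual_bound phi psi Phi Psi t p &
  s = \int[mu]_x phi x + \int[nu]_y psi y + t * I].

Let I0 : 0 <= I.
Proof.
have C0 : C11_lip1 (fun _ : 'rV[R]_d => 0 : R).
  apply: (@quad_jet_C11 _ _ _ (fun=> 0)) => x y /=; rewrite !dotv0l ?subr0 ?addr0 ?subrr ?normr0.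
  by rewrite mulr_ge0 ?invr_ge0 ?dotv_ge0.
by apply: le_trans (gapI C0); rewrite /gap !Rint_cst subrr.
Qed.

Lemma dominatedD f g s s' : dominated f s -> dominated g s' ->
  dominated (fun p => f p + g p) (s + s').
Proof.
move=> [a [b [A [B [t [t0 Ia Ib H ->]]]]]] [a' [b' [A' [B' [t' [t0' Ia' Ib' H' ->]]]]]].
exists (fun x => a x + a' x), (fun x => b x + b' x), (fun x => A x + A' x),
  (fun x => B x + B' x), (t + t'); split.
- exact: addr_ge0.
- exact: (intgD Ia Ia').
- exact: (intgD Ib Ib').
- move=> p; have := H p; have := H' p; rewrite /dual_bound !dotvDl.
  move: (f p) (g p) (dotv _ _) (dotv _ _) (dotv _ _) (dotv _ _) (cost _ _ _) => *; lra.
- by rewrite (RintD Ia Ia') (RintD Ib Ib'); ring.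
Qed.

Lemma dominatedZ f s k : 0 < k -> dominated f s -> dominated (fun p => k * f p) (k * s).
Proof.
move=> k0 [a [b [A [B [t [t0 Ia Ib H ->]]]]]].
exists (fun x => k * a x), (fun x => k * b x), (fun x => k *: A x),
  (fun x => k *: B x), (k * t); split.
- by rewrite mulr_ge0// ltW.
- exact: (intgZ k Ia).
- exact: (intgZ k Ib).
- move=> p; rewrite /dual_bound !dotvZl -mulrA -!mulrDr ler_wpM2l ?(ltW k0)//; exact: H.
- by rewrite (RintZ k Ia) (RintZ k Ib); ring.
Qed.

(** Adding [e] times the nonnegative cost keeps the bound and makes the curvature [t + e] positive;
    division by it gives paraboloids of unit curvature. *)
Let dual_bound_ge0 a b A B t e : 0 <= t -> 0 < e ->
  (forall p, 0 <= dual_bound a b A B t p) ->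
  exists u, [/\ C11_lip1 u, forall y, - ((t + e)^-1 * b y) <= u y &
    forall x, u x <= (t + e)^-1 * a x].
Proof.
move=> t0 e0 H; have te : 0 < t + e by rewrite ltr_wpDl.
have ite : 0 < (t + e)^-1 by rewrite invr_gt0.
apply: (@insertion _ _ _ _ (fun y => - (t + e)^-1 *: B y) (fun x => (t + e)^-1 *: A x)) => x y z.
have := H ((x, y), z); rewrite /dual_bound /px /py /pz /= costE !dotvZl.
have := dotv_ge0 (z - x); have := dotv_ge0 (z - y).
move: (dotv _ _) (dotv (B y) _) (dotv (z - x) _) (dotv (A x) _) => Y Bz X Az Y0 X0 G.
rewrite -(ler_pM2l te).
have E k : (t + e) * ((t + e)^-1 * k) = k by rewrite mulVKf// gt_eqF.
rewrite !mulrDr !mulrN !mulNr !mulrN !E.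
have := mulr_ge0 (ltW e0) Y0; have := mulr_ge0 (ltW e0) X0; move: G; lra.
Qed.

Lemma dominated_ge0 f s : (forall p, 0 <= f p) -> dominated f s -> 0 <= s.
Proof.
move=> f0 [a [b [A [B [t [t0 Ia Ib H ->]]]]]].
suff Hs e : 0 < e -> 0 <= \int[mu]_x a x + \int[nu]_y b y + t * I + e * I.
  rewrite leNgt; apply/negP; set S := (X in X < 0) => S0.
  have I1 : 0 < I + 1 by rewrite ltr_wpDl.
  (* With this [e], [S + e I = S / (I + 1)] is still negative, a contradiction. *)
  have e0 : 0 < - S / (I + 1) by rewrite divr_gt0// oppr_gt0.
  have := Hs _ e0; rewrite -/S.
  have -> : S + - S / (I + 1) * I = S / (I + 1) by field; rewrite gt_eqF.
  by rewrite leNgt pmulr_llt0 ?invr_gt0// S0.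
move=> e0; have te : 0 < t + e by rewrite ltr_wpDl.
have Hd p : 0 <= dual_bound a b A B t p by exact: le_trans (f0 p) (H p).
have [u [Cu bu ua]] := dual_bound_ge0 t0 e0 Hd.
have := gapI Cu; rewrite /gap.
have Iu := intg_C11 mu2 Cu; have Iv := intg_C11 nu2 Cu.
have := Rint_le Iu (intgZ (t + e)^-1 Ia) ua.
have bu' y : -1 * ((t + e)^-1 * b y) <= u y by rewrite mulN1r.
have := Rint_le (intgZ (-1) (intgZ (t + e)^-1 Ib)) Iv bu'.
rewrite (RintZ _ Ia) (RintZ (-1) (intgZ (t + e)^-1 Ib)) (RintZ _ Ib) => H1 H2 H3.
have : -1 * ((t + e)^-1 * \int[nu]_x b x) - (t + e)^-1 * \int[mu]_x a x <= I by lra.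
rewrite -(ler_pM2l te) mulrBr mulN1r mulrN !mulVKf ?gt_eqF//; lra.
Qed.

(** From [|z|^2 <= 2 |x|^2 + 2 |z - x|^2] and [2 |z - x|^2 <= 4 c] one gets
    [weight <= 1 + 3 |x|^2 + |y|^2 + 4 c]. *)
Lemma weight_dominated f K : (forall p, f p <= K * weight p) -> exists s, dominated f s.
Proof.
move=> H; exists (\int[mu]_x (`|K| * (1 + 3 * dotv x x)) + \int[nu]_y (`|K| * dotv y y) + 4 * `|K| * I).
have sq m : finite_second_moment m -> intg m (fun x => dotv x x) := @intg_sq R d m.
exists (fun x => `|K| * (1 + 3 * dotv x x)), (fun y => `|K| * dotv y y), (fun=> 0), (fun=> 0), (4 * `|K|).
split=> //.
- by apply: intgZ; apply: intgD; [exact: intg_cst | apply: intgZ; exact: sq].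
- by apply: intgZ; exact: sq.
- move=> p; apply: le_trans (H p) _.
  apply: (@le_trans _ _ (`|K| * weight p)).
    by rewrite ler_wpM2r ?ler_norm// (le_trans ler01 (weight_ge1 p)).
  rewrite /dual_bound !dotv0l !addr0 (mulrC 4) -mulrA -!mulrDr ler_wpM2l//.
  have := dotvDD_le (px p) (pz p - px p); rewrite subrKC costE /weight.
  have := dotv_ge0 (pz p - py p).
  move: (dotv _ _) (dotv (pz p) _) (dotv (px p) _) (dotv (pz p - _) _) (dotv _ _) => *; lra.
Qed.

Lemma quad_growthD f g : quad_growth f -> quad_growth g -> quad_growth (fun p => f p + g p).
Proof.
move=> [K HK] [K' HK']; exists (K + K') => p; rewrite mulrDl.
by apply: le_trans (ler_normD _ _) _; exact: lerD.
Qed.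

Lemma quad_growthZ k f : quad_growth f -> quad_growth (fun p => k * f p).
Proof.
by move=> [K HK]; exists (`|k| * K) => p; rewrite normrM -mulrA ler_wpM2l.
Qed.

Let q f := inf [set s | dominated f s].

(** Bounded below: values for [f] and for [- f] add up to a value for 0, which is nonnegative. *)
Let has_inf_q f : quad_growth f -> has_inf [set s | dominated f s].
Proof.
move=> [K HK]; split.
  by apply: (@weight_dominated f K) => p; apply: le_trans (HK p); exact: ler_norm.
have [s' Hs'] : exists s, dominated (fun p => - f p) s.
  by apply: (@weight_dominated _ K) => p; apply: le_trans (HK p); rewrite -normrN ler_norm.
exists (- s') => s /= Hs; rewrite -subr_ge0 opprK.
by apply: (dominated_ge0 _ (dominatedD Hs Hs')) => p; rewrite subrr.
Qed.

Let q_le f s : quad_growth f -> dominated f s -> q f <= s.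
Proof. by move=> /has_inf_q[_ lb] Hs; exact: ge_inf. Qed.

Let dominated0 : dominated (fun=> 0) 0.
Proof.
exists (fun=> 0), (fun=> 0), (fun=> 0), (fun=> 0), 0; split=> //; try exact: intg_cst.
  by move=> p; rewrite /dual_bound !dotv0l !addr0 mul0r.
by rewrite !Rint_cst mul0r !addr0.
Qed.

Lemma quad_growth0 : quad_growth (fun=> 0).
Proof. by exists 0 => p; rewrite normr0 mul0r. Qed.

Let sublinear_q : sublinear_on (quad_growth : set (T3 R d -> R)) q.
Proof.
split.
- apply/eqP; rewrite eq_le (q_le quad_growth0 dominated0) /=.
  apply: lb_le_inf; first by exists 0; exact: dominated0.
  by move=> s /= Hs; apply: dominated_ge0 Hs => p.
- move=> t f t0 Ef; rewrite -ler_pdivrMl//; apply: lb_le_inf; first by have [] := has_inf_q Ef.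
  move=> s /= Hs; rewrite ler_pdivrMl//; apply: q_le; first exact: quad_growthZ.
  exact: dominatedZ.
- move=> f g Ef Eg; rewrite -lerBlDr; apply: lb_le_inf; first by have [] := has_inf_q Ef.
  move=> s /= Hs; rewrite lerBlDr -lerBlDl; apply: lb_le_inf; first by have [] := has_inf_q Eg.
  move=> s' /= Hs'; rewrite lerBlDl; apply: q_le; first exact: quad_growthD.
  exact: dominatedD.
Qed.

Lemma dual_functional : exists L : (T3 R d -> R) -> R,
  [/\ forall f g, quad_growth f -> quad_growth g -> L (fun p => f p + g p) = L f + L g,
      forall k f, quad_growth f -> L (fun p => k * f p) = k * L f &
      forall f s, quad_growth f -> dominated f s -> L f <= s].
Proof.
have [L [LD LZ Lq]] := @hahn_banach R (T3 R d -> R) quad_growth quad_growth0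
  quad_growthD quad_growthZ q sublinear_q.
exists L; split=> // f s Ef Hs; exact: le_trans (Lq _ Ef) (q_le Ef Hs).
Qed.

End DualFunctional.

(** * From functionals to couplings *)

Lemma clampE {R : realType} (m t : R) : 0 < m -> 0 <= t -> m * clamp (m^-1 * t) = Num.min t m.
Proof.
move=> m0 t0; rewrite /clamp max_l; last by rewrite mulr_ge0// invr_ge0 ltW.
by rewrite minr_pMr ?(ltW m0)// mulr1 mulVKf// gt_eqF.
Qed.

(** The subtracted term is [t] truncated to [-1, 1], built from [clamp]. *)
Lemma clamp_symmetric {R : realType} (t : R) : `|t - (2 * clamp (2^-1 * (t + 1)) - 1)| <= t ^+ 2.
Proof.
have [t1|t1] := leP 1 t.
  rewrite clamp1; last by lra.
  by rewrite ger0_norm; [nra | lra].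
have [t2|t2] := leP t (-1).
  rewrite clamp0; last by lra.
  by rewrite ler0_norm; [nra | lra].
rewrite /clamp max_l ?min_l; [|lra|lra].
rewrite (_ : t - _ = 0); last by field.
by rewrite normr0 sqr_ge0.
Qed.

Lemma box_bump_gt0 {R : realType} {d : nat} n (a b x : 'rV[R]_d) :
  box a b x -> 0 < box_bump n a b x.
Proof.
move=> H; apply: prodr_gt0 => i _; have /andP[A B] := H i.
by apply: mulr_gt0; rewrite flat1E pmulr_rgt0// subr_gt0 ?A ?B expR_gt0.
Qed.

(** * A law on R^d is determined by its integrals of box bumps *)

Section LawByBumps.
Context {R : realType} {d : nat} {disp : measure_display} {T : measurableType disp}.
Variables (P : probability T R) (X : T -> Rd R d) (m : probability (Rd R d) R).
Hypothesis mX : measurable_fun setT X.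
Hypothesis bumps : forall n (a b : 'rV[R]_d),
  \int[P]_t box_bump n a b (X t) = \int[m]_x box_bump n a b x.

Let bump_limit {disp' : measure_display} {S : measurableType disp'} (Q : probability S R)
    (Y : S -> Rd R d) (a b : 'rV[R]_d) : measurable_fun setT Y ->
  \int[Q]_t box_bump n a b (Y t) @[n --> \oo] --> fine (Q (Y @^-1` box a b)).
Proof.
move=> mY; have mb : @measurable _ (Rd R d) (box a b).
  by apply: sub_sigma_algebra; exact: open_box.
have mYb : measurable (Y @^-1` box a b) by rewrite -[_ @^-1` _]setTI; exact: mY.
rewrite (_ : fine _ = \int[Q]_t \1_(box a b) (Y t)); last first.
  by rewrite -(setIT (_ @^-1` _)) -integral_indic.
apply: (@Rint_dominated _ _ _ Q (fun n t => box_bump n a b (Y t)) _ (fun=> 1)).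
- move=> n; apply: measurableT_comp mY.
  by apply: continuous_measurable_Rd; exact: (Ck_box_bump 0 n a b).
- by apply: measurableT_comp mY; exact: measurable_indic.
- by move=> t; exact: box_bump_cvg.
- exact: intg_cst.
- by move=> n t; have /andP[b0 b1] := box_bump_itv n a b (Y t); rewrite ger0_norm.
Qed.

Lemma law_box_bump (A : set (Rd R d)) : measurable A -> P (X @^-1` A) = m A.
Proof.
pose PX : {measure set (Rd R d) -> \bar R} := [the measure _ _ of pushforward P X].
move=> mA; rewrite -[LHS]/(PX mX A).
pose c (k : nat) : 'rV[R]_d := const_mx k%:R.
apply: (@measure_unique _ R (Rd R d) _ (fun k => box (- c k) (c k)) Rd_measurable_box box_setI) => //.
- by move=> k; exists (- c k, c k).
- apply/seteqP; split=> // x _; exists (Num.truncn `|x : 'rV[R]_d|).+1 => //= i.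
  have := coord_norm_le (x : 'rV[R]_d) i; rewrite !mxE -ltr_norml => H.
  by apply: le_lt_trans H _; exact: truncnS_gt.
- move=> _ [[a b] _ <-] /=.
  have mb : @measurable _ (Rd R d) (box a b).
    by apply: sub_sigma_algebra; exact: open_box.
  have mXb : measurable (X @^-1` box a b) by rewrite -[_ @^-1` _]setTI; exact: mX.
  have C1 := @bump_limit _ _ P X a b mX.
  have C2 := @bump_limit _ _ m id a b (@measurable_id _ _ setT).
  have E : fine (P (X @^-1` box a b)) = fine (m (box a b)).
    apply: (cvg_unique (@Rhausdorff R) C1); rewrite (_ : (fun n => _) = (fun n => \int[m]_t box_bump n a b t))//.
    by apply/funext => n; exact: bumps.
  rewrite -[PX mX _]/(P (X @^-1` box a b)) -(fineK (fin_num_measure P _ mXb)) E fineK//.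
  exact: fin_num_measure.
- move=> k; rewrite -[PX mX _]/(P (X @^-1` box (- c k) (c k))).
  have mXb : measurable (X @^-1` box (- c k) (c k)).
    by rewrite -[_ @^-1` _]setTI; apply: mX => //; apply: sub_sigma_algebra; exact: open_box.
  by apply: le_lt_trans (probability_le1 P mXb) _; exact: ltey.
Qed.

End LawByBumps.

(** * Bounded continuous functions of three variables and a weighted Dini theorem *)

Section ContinuousFunctions.
Context {R : realType} {d : nat}.
Implicit Types f g : T3 R d -> R.

Definition cont3 f := continuous (f : 'rV[R]_d * 'rV[R]_d * 'rV[R]_d -> R).

Lemma cont3_cst (c : R) : cont3 (fun=> c).
Proof. by move=> p; exact: cvg_cst. Qed.

Lemma cont3D f g : cont3 f -> cont3 g -> cont3 (fun p => f p + g p).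
Proof. by move=> cf cg p; apply: cvgD; [exact: cf | exact: cg]. Qed.

Lemma cont3M f g : cont3 f -> cont3 g -> cont3 (fun p => f p * g p).
Proof. by move=> cf cg p; apply: cvgM; [exact: cf | exact: cg]. Qed.

Lemma cont3_clamp f : cont3 f -> cont3 (fun p => clamp (f p)).
Proof.
move=> cf p; apply: (@continuous_min R _ (fun p => Num.max (f p) 0) (fun=> 1)).
  by apply: (@continuous_max R _ f (fun=> 0)); [exact: cf | exact: cvg_cst].
exact: cvg_cst.
Qed.

Lemma cont3_px (f : 'rV[R]_d -> R) : continuous f -> cont3 (fun p => f (px p)).
Proof.
move=> cf p; apply: (@continuous_comp _ _ _ (fun p : 'rV[R]_d * 'rV[R]_d * 'rV[R]_d => p.1.1) f); last exact: cf.
by apply: (@continuous_comp _ _ _ fst fst); exact: cvg_fst.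
Qed.

Lemma cont3_py (f : 'rV[R]_d -> R) : continuous f -> cont3 (fun p => f (py p)).
Proof.
move=> cf p; apply: (@continuous_comp _ _ _ (fun p : 'rV[R]_d * 'rV[R]_d * 'rV[R]_d => p.1.2) f); last exact: cf.
by apply: (@continuous_comp _ _ _ fst snd); [exact: cvg_fst|exact: cvg_snd].
Qed.

Lemma cont3_pz (f : 'rV[R]_d -> R) : continuous f -> cont3 (fun p => f (pz p)).
Proof.
move=> cf p; apply: (@continuous_comp _ _ _ (fun p : 'rV[R]_d * 'rV[R]_d * 'rV[R]_d => p.2) f); last exact: cf.
exact: cvg_snd.
Qed.

Lemma cont3_dotv (F G : T3 R d -> 'rV[R]_d) :
  (forall i, cont3 (fun p => F p ord0 i)) -> (forall i, cont3 (fun p => G p ord0 i)) ->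
  cont3 (fun p => dotv (F p) (G p)).
Proof.
move=> cF cG; rewrite /dotv /cont3; apply: continuous_big => [|i _ y].
  exact: add_continuous.
by apply: continuousM; [exact: cF | exact: cG].
Qed.

Lemma cont3_zx i : cont3 (fun p => (pz p - px p) ord0 i).
Proof.
rewrite (_ : (fun p => _) = (fun p : T3 R d => pz p ord0 i + -1 * px p ord0 i)).
  apply: cont3D; first by apply: (cont3_pz (f := fun x => x ord0 i)); exact: coord_continuous.
  apply: cont3M; first exact: cont3_cst.
  by apply: (cont3_px (f := fun x => x ord0 i)); exact: coord_continuous.
by apply/funext => p; rewrite !mxE mulN1r.
Qed.

Lemma cont3_zy i : cont3 (fun p => (pz p - py p) ord0 i).
Proof.
rewrite (_ : (fun p => _) = (fun p : T3 R d => pz p ord0 i + -1 * py p ord0 i)).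
  apply: cont3D; first by apply: (cont3_pz (f := fun x => x ord0 i)); exact: coord_continuous.
  apply: cont3M; first exact: cont3_cst.
  by apply: (cont3_py (f := fun x => x ord0 i)); exact: coord_continuous.
by apply/funext => p; rewrite !mxE mulN1r.
Qed.

Lemma cont3_cost : cont3 (fun p => cost (px p) (py p) (pz p)).
Proof.
rewrite (_ : (fun p => _) = (fun p : T3 R d => 2^-1 *
  (dotv (pz p - px p) (pz p - px p) + dotv (pz p - py p) (pz p - py p)))).
  apply: cont3M; first exact: cont3_cst.
  apply: cont3D; apply: cont3_dotv; by [exact: cont3_zx | exact: cont3_zy].
by apply/funext => p; rewrite costE.
Qed.

Lemma cont3_weight : cont3 weight.
Proof.
apply: cont3D; first exact: cont3_cst.
apply: cont3D; first apply: cont3D.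
- exact: (cont3_px (@dotv_sq_continuous R d)).
- exact: (cont3_py (@dotv_sq_continuous R d)).
- exact: (cont3_pz (@dotv_sq_continuous R d)).
Qed.

Lemma measurable_weight : measurable_fun setT (@weight R d).
Proof.
apply: measurable_funD => //; apply: measurable_funD; first apply: measurable_funD.
- exact: (continuous_measurable_px (@dotv_sq_continuous R d)).
- exact: (continuous_measurable_py (@dotv_sq_continuous R d)).
- exact: (continuous_measurable_pz (@dotv_sq_continuous R d)).
Qed.

(** Measurability for the product sigma-algebra is carried along as a separate condition, not
    derived from continuity. *)
Definition bounded_cont f := [/\ cont3 f, measurable_fun setT f & exists M, forall p, `|f p| <= M].

Lemma bounded_cont_clamp f : cont3 f -> measurable_fun setT f ->
  bounded_cont (fun p => clamp (f p)).
Proof.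
move=> cf mf; split; first exact: cont3_clamp.
  by apply: measurable_minr => //; exact: measurable_maxr.
by exists 1 => p; have /andP[c0 c1] := clamp_itv (f p); rewrite ger0_norm.
Qed.

Lemma bounded_cont_cst c : bounded_cont (fun=> c).
Proof. by split; [exact: cont3_cst | exact: measurable_cst | exists `|c|]. Qed.

Lemma bounded_contD f g : bounded_cont f -> bounded_cont g -> bounded_cont (fun p => f p + g p).
Proof.
move=> [cf mf [M HM]] [cg mg [N HN]]; split; [exact: cont3D | exact: measurable_funD |].
by exists (M + N) => p; apply: le_trans (ler_normD _ _) _; exact: lerD.
Qed.

Lemma bounded_contM f g : bounded_cont f -> bounded_cont g -> bounded_cont (fun p => f p * g p).
Proof.
move=> [cf mf [M HM]] [cg mg [N HN]]; split; [exact: cont3M | exact: measurable_funM |].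
by exists (M * N) => p; rewrite normrM; exact: ler_pM.
Qed.

Lemma bounded_cont_quad_growth f : bounded_cont f -> quad_growth f.
Proof.
move=> [_ _ [M HM]]; exists M => p; apply: le_trans (HM p) _.
by rewrite ler_peMr ?weight_ge1// (le_trans _ (HM p)).
Qed.

Lemma quad_growth_sq f K : (forall p, f p ^+ 2 <= K * weight p) -> quad_growth f.
Proof.
move=> HK; exists (K + 1) => p; have := HK p; have := weight_ge1 p.
have := sqr_ge0 (`|f p| - 1); have := sqr_ge0 (f p).
rewrite -(real_normK (num_real (f p))); move: `|f p| (weight p) => a w *; lra.
Qed.

(** A box is the set where a bump is positive, so cylinders over boxes are level sets, and the
    identity out of the generated sigma-algebra [T'] is measurable. *)
Lemma T3_measurable_level : @measurable _ (T3 R d) `<=`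
  <<s [set A | exists f a, bounded_cont f /\ A = [set x | a < f x]] >>.
Proof.
set G := (X in <<s X >>); pose T' := g_sigma_algebraType G.
have proj (pr : T3 R d -> Rd R d) : (forall n a b, bounded_cont (fun p => box_bump n a b (pr p))) ->
    measurable_fun setT (pr : T' -> Rd R d).
  move=> Hpr; apply: (measurability _ Rd_measurable_box) => _ [_ [[a b] _ <-] <-] /=.
  apply: sub_sigma_algebra; exists (fun p => box_bump 0 a b (pr p)), 0; split=> //.
  rewrite setTI; apply/seteqP; split=> p /=; first exact: box_bump_gt0.
  by move=> H; apply: (@box_bump_neq0 _ _ 0); rewrite gt_eqF.
have bc_box n a b : [/\ continuous (box_bump n a b : 'rV[R]_d -> R),
    measurable_fun setT (box_bump n a b : Rd R d -> R) &
    forall x, `|box_bump n a b x| <= 1].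
  have cb := @Ck_box_bump R d 0 n a b; split=> //; first exact: continuous_measurable_Rd.
  by move=> x; have /andP[b0 b1] := box_bump_itv n a b x; rewrite ger0_norm.
have mid : measurable_fun setT (id : T' -> T3 R d).
  apply/measurable_fun_pairP; split; first apply/measurable_fun_pairP; first split.
  - apply: (proj (fun p => p.1.1)) => n a b; have [cb mb b1] := bc_box n a b; split.
    + exact: (cont3_px cb).
    + exact: (continuous_measurable_px cb).
    + by exists 1 => p; exact: b1.
  - apply: (proj (fun p => p.1.2)) => n a b; have [cb mb b1] := bc_box n a b; split.
    + exact: (cont3_py cb).
    + exact: (continuous_measurable_py cb).
    + by exists 1 => p; exact: b1.
  - apply: (proj (fun p => p.2)) => n a b; have [cb mb b1] := bc_box n a b; split.
    + exact: (cont3_pz cb).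
    + exact: (continuous_measurable_pz cb).
    + by exists 1 => p; exact: b1.
by move=> A mA; have := mid measurableT _ mA; rewrite setTI.
Qed.

(** On the product of balls of radius [k], compactness gives one index [n]. Elsewhere some squared
    norm is at least [k^2 >= k], so [weight p / k >= 1] and the left side is negative. *)
Lemma dini_weight (g : nat -> T3 R d -> R) (e k : R) : unit_cover bounded_cont setT g ->
  0 < e -> 1 <= k -> exists n, forall p, 1 - e - k^-1 * weight p <= g n p.
Proof.
move=> [bg g0 gm g1] e0 k1; have k0 : 0 < k by exact: lt_le_trans k1.
pose K := ([set x : 'rV[R]_d | `|x| <= k] `*` [set x : 'rV[R]_d | `|x| <= k])
  `*` [set x : 'rV[R]_d | `|x| <= k].
have cK : compact K by apply: compact_setX; [apply: compact_setX|]; exact: compact_norm_ball.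
have : \forall n \near \oo, K `<=` (fun p => 1 - e < g n p).
  apply: (compact_near_coveringP _).1 cK _ _ _ _ _ => p _.
  have [n gn] := g1 p I; have [cg _ _] := bg n.
  have : \forall q \near (p : 'rV[R]_d * 'rV[R]_d * 'rV[R]_d), 1 - e < g n q.
    have lt1 : 1 - e < g n p by apply: lt_le_trans gn; rewrite ltrBlDr ltrDl.
    exact: (@cvgr_gt R _ _ (nbhs_filter (p : 'rV[R]_d * 'rV[R]_d * 'rV[R]_d)) (g n) (g n p) (cg p) _ lt1).
  move=> near_p; exists ([set q : 'rV[R]_d * 'rV[R]_d * 'rV[R]_d | 1 - e < g n q], [set m | (n <= m)%N]) => /=.
    by split=> //; exists n.
  by move=> [q m] /= [H nm]; apply: lt_le_trans H _; exact: gm.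
move=> [n _ Hn]; exists n => p; have [Kp|nKp] := pselect (K p).
  apply: le_trans (ltW (Hn n (leqnn n) p Kp)); rewrite gerBl.
  by rewrite mulr_ge0 ?invr_ge0 ?(ltW k0)// (le_trans ler01 (weight_ge1 p)).
apply: le_trans (g0 n p); rewrite subr_le0; apply: (@le_trans _ _ 1); first by rewrite lerBlDr lerDl ltW.
rewrite ler_pdivlMl// mulr1; have kk x : ~ (`|x : 'rV[R]_d| <= k) -> k <= dotv x x.
  move=> /negP; rewrite -ltNge => kx; apply: le_trans (norm_sq_le_dotv x).
  by rewrite expr2; apply: le_trans (ltW kx) _; rewrite ler_peMr// (le_trans k1)// ltW.
have := dotv_ge0 (px p); have := dotv_ge0 (py p); have := dotv_ge0 (pz p).
rewrite /weight; have [xk|/kk] := pselect (`|px p : 'rV[R]_d| <= k); last by move: (dotv _ _) (dotv _ _) (dotv _ _) => *; lra.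
have [yk|/kk] := pselect (`|py p : 'rV[R]_d| <= k); last by move: (dotv _ _) (dotv _ _) (dotv _ _) => *; lra.
have [zk|/kk] := pselect (`|pz p : 'rV[R]_d| <= k); last by move: (dotv _ _) (dotv _ _) (dotv _ _) => *; lra.
by case: nKp.
Qed.

End ContinuousFunctions.

(** * Comparing the functional with the measure that represents it *)

Section FunctionalMeasure.
Context {R : realType} {d : nat}.
Variable L : (T3 R d -> R) -> R.
Implicit Types f g : T3 R d -> R.
Hypotheses
  (LD : forall f g, quad_growth f -> quad_growth g -> L (fun p => f p + g p) = L f + L g)
  (LZ : forall k f, quad_growth f -> L (fun p => k * f p) = k * L f)
  (Lmono : forall f g, quad_growth f -> quad_growth g -> (forall p, f p <= g p) -> L f <= L g)
  (L1 : L (fun=> 1) = 1).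

Let bq f : bounded_cont f -> quad_growth f := @bounded_cont_quad_growth R d f.

Lemma quad_growth_weight k : quad_growth (fun p : T3 R d => k * weight p).
Proof.
by exists `|k| => p; rewrite normrM (ger0_norm (le_trans ler01 (weight_ge1 p))).
Qed.

Let qw : quad_growth (@weight R d).
Proof.
by have := quad_growth_weight 1; congr quad_growth; apply/funext => p; rewrite mul1r.
Qed.

(** This is tightness: [k] is taken large enough that [L weight / k <= e / 2]. *)
Let dini (g : nat -> T3 R d -> R) : unit_cover bounded_cont setT g -> forall e, 0 < e -> exists n, 1 - e <= L (g n).
Proof.
move=> cg e e0; have [bg _ _ _] := cg; have e20 : 0 < e / 2 by rewrite divr_gt0.
pose k := Num.max 1 (L weight / (e / 2)).
have k1 : 1 <= k by rewrite le_max lexx.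
have k0 : 0 < k by exact: lt_le_trans k1.
have [n Hn] := dini_weight cg e20 k1; exists n.
have qc c : quad_growth (fun _ : T3 R d => c) := bq (bounded_cont_cst c).
have qs : quad_growth (fun p : T3 R d => (1 - e / 2) * 1 + (- k^-1) * weight p).
  exact: quad_growthD (qc _) (quad_growth_weight _).
have Hn' p : (1 - e / 2) * 1 + (- k^-1) * weight p <= g n p.
  by apply: le_trans (Hn p); rewrite mulr1 mulNr.
have := Lmono qs (bq (bg n)) Hn'; rewrite LD//; last exact: quad_growth_weight.
rewrite (LZ (- k^-1))// (LZ (1 - e / 2))// L1 mulr1 mulNr.
suff : k^-1 * L weight <= e / 2 by lra.
rewrite ler_pdivrMl// mulrC -ler_pdivrMl// mulrC; by rewrite le_max lexx orbT.
Qed.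

Lemma functional_measure : exists P : probability (T3 R d) R,
  forall f, bounded_cont f -> intg P f /\ \int[P]_p f p = L f.
Proof.
apply: (@representation R _ (T3 R d) bounded_cont L) => //.
- exact: bounded_cont_cst.
- exact: bounded_contD.
- exact: bounded_contM.
- by move=> f [cf mf _]; exact: bounded_cont_clamp.
- by move=> f [].
- by move=> f [].
- exact: T3_measurable_level.
- by move=> f g bf bg; apply: LD; exact: bq.
- by move=> a f bf; apply: LZ; exact: bq.
- by move=> f g bf bg; apply: Lmono; exact: bq.
Qed.

Variable P : probability (T3 R d) R.
Hypothesis PL : forall f, bounded_cont f -> intg P f /\ \int[P]_p f p = L f.

(** Monotone convergence holds for [P] but not for [L] along the truncations [min f (n+1)], hence
    only an inequality. *)
Lemma nonneg_integral_le f : cont3 f -> measurable_fun setT f -> quad_growth f ->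
  (forall p, 0 <= f p) -> (\int[P]_p (f p)%:E <= (L f)%:E)%E.
Proof.
move=> cf mf qf f0; pose g n p := n.+1%:R * clamp (n.+1%:R^-1 * f p).
have gE n p : g n p = Num.min (f p) n.+1%:R by rewrite /g clampE.
have bg n : bounded_cont (g n).
  apply: bounded_contM; first exact: bounded_cont_cst.
  apply: bounded_cont_clamp; first by apply: cont3M => //; exact: cont3_cst.
  exact: measurable_funM.
have mg n : measurable_fun setT (EFin \o g n) by apply/measurable_EFinP; case: (bg n).
have Ig n : (\int[P]_p (g n p)%:E <= (L f)%:E)%E.
  have [In LE] := PL (bg n); rewrite (EFin_Rintegral In) LE lee_fin.
  by apply: Lmono => [||p]; [exact: bq | exact: qf | rewrite gE ge_min lexx].
have g0 n p : 0 <= g n p by rewrite gE le_min f0 ler0n.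
have gnd p : {homo (fun n => (g n p)%:E) : m n / (m <= n)%N >-> (m <= n)%E}.
  by move=> m n mn; rewrite lee_fin !gE le_min2// ler_nat.
have glim p : limn (fun n => (g n p)%:E) = (f p)%:E.
  apply: cvg_lim => //; apply: cvg_near_cst; exists (Num.truncn (f p)) => // n /= H.
  rewrite gE min_l//; apply/ltW; apply: lt_le_trans (truncnS_gt _) _.
  by rewrite ler_nat ltnS.
have := @monotone_convergence _ _ _ P setT measurableT (fun n => EFin \o g n) mg
  (fun n p _ => g0 n p) (fun p _ => gnd p).
under eq_integral do rewrite /= glim.
move=> ->; apply: lime_le; last by apply: nearW => n; exact: Ig.
apply: ereal_nondecreasing_is_cvgn => m n mn; apply: ge0_le_integral => //.
- by move=> p _; rewrite lee_fin.
- by move=> p _; exact: gnd.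
Qed.

Lemma intg_functional_weight : intg P weight.
Proof.
have mw := @measurable_weight R d; have := nonneg_integral_le (@cont3_weight R d) mw qw.
move=> /(_ (fun p => le_trans ler01 (weight_ge1 p))) H.
apply/integrableP; split; first exact/measurable_EFinP.
apply: le_lt_trans (ltry (L weight)); apply: le_trans H.
by apply: ge0_le_integral => //= [||p _]; [exact/measurable_EFinP/measurableT_comp|
  exact/measurable_EFinP|rewrite lee_fin ger0_norm// (le_trans ler01 (weight_ge1 p))].
Qed.

Lemma functional_integral f K : cont3 f -> measurable_fun setT f ->
  (forall p, f p ^+ 2 <= K * weight p) -> intg P f /\ \int[P]_p f p = L f.
Proof.
move=> cf mf HK; have Iw := intg_functional_weight.
have [M fle] := quad_growth_sq HK; have qf : quad_growth f by exists M.
have If : intg P f by exact: (intg_le mf fle (intgZ _ Iw)).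
split=> //; apply/eqP; rewrite -subr_eq0; apply/eqP.
apply: (@le_small_eq0 _ _ (K * (\int[P]_p weight p + L weight))) => t t0.
(* [f] truncated at height [1/t]. The error is at most [t f^2 <= t K weight], which both [L] and [P]
   send to 0 with [t]. *)
pose g p := t^-1 * (2 * clamp (2^-1 * (t * f p + 1)) + -1).
have bg : bounded_cont g.
  apply: bounded_contM; first exact: bounded_cont_cst.
  apply: bounded_contD; last exact: bounded_cont_cst.
  apply: bounded_contM; first exact: bounded_cont_cst.
  apply: bounded_cont_clamp.
    apply: cont3M; first exact: cont3_cst.
    by apply: cont3D; [apply: cont3M => //|]; exact: cont3_cst.
  by apply: measurable_funM => //; apply: measurable_funD => //; exact: measurable_funM.
have fg p : `|f p - g p| <= t * K * weight p.
  have := clamp_symmetric (t * f p); rewrite -(ler_pM2l t0) => H.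
  have E : f p - g p = t^-1 * (t * f p - (2 * clamp (2^-1 * (t * f p + 1)) - 1)).
    by rewrite mulrBr mulKf// gt_eqF.
  rewrite E normrM gtr0_norm ?invr_gt0// ler_pdivrMl//.
  apply: le_trans (clamp_symmetric _) _; rewrite exprMn expr2 -!mulrA.
  by rewrite !ler_wpM2l// ltW.
have [Ig LE] := PL bg.
have qg := bq bg.
have qd : quad_growth (fun p => f p + -1 * g p).
  exists (t * K) => p; rewrite mulN1r; exact: fg.
have LB : L (fun p => f p + -1 * g p) = L f - L g.
  by rewrite (LD qf (quad_growthZ (-1) qg)) (LZ (-1) qg) mulN1r.
have U : L f - L g <= t * K * L weight.
  rewrite -LB -LZ//; apply: Lmono => // [|p]; first exact: quad_growth_weight.
  by rewrite mulN1r; apply: le_trans (fg p); exact: ler_norm.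
have V : - (t * K * L weight) <= L f - L g.
  rewrite -LB -mulNr -LZ//; apply: Lmono => // [|p]; first exact: quad_growth_weight.
  by rewrite mulN1r mulNr; have := fg p; rewrite ler_norml => /andP[].
have U' : \int[P]_p f p - \int[P]_p g p <= t * K * \int[P]_p weight p.
  rewrite -(RintB If Ig) -(RintZ _ Iw); apply: Rint_le; [exact: intgB|exact: intgZ|].
  by move=> p; apply: le_trans (fg p); exact: ler_norm.
have V' : - (t * K * \int[P]_p weight p) <= \int[P]_p f p - \int[P]_p g p.
  rewrite -(RintB If Ig) -mulNr -(RintZ _ Iw); apply: Rint_le; [exact: intgZ|exact: intgB|].
  by move=> p; rewrite mulNr; have := fg p; rewrite ler_norml => /andP[].
rewrite ler_norml; move: U V U' V' LE.
move: (L f) (L g) (L weight) (Rintegral _ _ f) (Rintegral _ _ g) (Rintegral _ _ weight).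
move=> Lf Lg Lw If' Ig' Iw' U V U' V' LE; apply/andP; split; nra.
Qed.

End FunctionalMeasure.

(** * Strong duality *)

(** Young's inequality with weight [<x, y> / (|x|^2 + 1)]; the summand 1 avoids dividing by zero. *)
Lemma dotv_sq_le {R : realType} d (x y : 'rV[R]_d) :
  dotv x y ^+ 2 <= (dotv x x + 1) * dotv y y.
Proof.
have pos (w : 'rV[R]_d) : 0 < dotv x w -> dotv x w ^+ 2 <= (dotv x x + 1) * dotv w w.
  move=> D0; have X0 := dotv_ge0 x; have X1 : 0 < dotv x x + 1 by rewrite ltr_wpDl.
  have := dotv_young x w (divr_gt0 D0 X1); move: (dotv x w) (dotv x x) (dotv w w) D0 X0 X1.
  move=> D X Y D0 X0 X1; rewrite -(ler_pM2l (mulr_gt0 D0 X1)).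
  rewrite (_ : _ * (2^-1 * _) = 2^-1 * (D ^+ 2 * X + (X + 1) ^+ 2 * Y)); last first.
    by field; rewrite !gt_eqF.
  move=> H; rewrite -(ler_pM2l X1).
  have : 0 <= D ^+ 2 by exact: sqr_ge0.
  move: H; nra.
have [D0|D0|D0] := ltgtP (dotv x y) 0.
- by have := pos (- y); rewrite !dotvE sqrrN opprK; apply; rewrite oppr_gt0.
- exact: pos.
- by rewrite D0 expr0n mulr_ge0 ?addr_ge0 ?dotv_ge0.
Qed.

Lemma test_map_bounded {R : realType} d (Phi : 'rV[R]_d -> 'rV[R]_d) : test_map Phi ->
  exists B, forall x, dotv (Phi x) (Phi x) <= B.
Proof.
move=> [sPhi cK]; have cPhi : continuous Phi := sPhi 0%N.
have ch : continuous (fun x => dotv (Phi x) (Phi x)).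
  move=> x; apply: (@continuous_comp _ _ _ Phi (fun y => dotv y y)); first exact: cPhi.
  exact: dotv_sq_continuous.
have [M [_ HM]] := compact_bounded (continuous_compact (continuous_subspaceT ch) cK).
exists (`|M| + 1) => x; have [->|Phix] := eqVneq (Phi x) 0.
  by rewrite dotv0l addr_ge0.
apply: le_trans (ler_norm _) _; apply: (HM (`|M| + 1)).
  by rewrite ltr_pwDr// ler_norm.
by exists x => //; exact: subset_closure.
Qed.

Lemma drift_bound {R : realType} d (X : T3 R d -> 'rV[R]_d) (Phi : 'rV[R]_d -> 'rV[R]_d) :
  (forall f : 'rV[R]_d -> R, continuous f -> cont3 (fun p => f (X p))) ->
  (forall f : 'rV[R]_d -> R, continuous f -> measurable_fun setT (fun p => f (X p))) ->
  (forall i, cont3 (fun p => (pz p - X p) ord0 i)) ->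
  (forall i, measurable_fun setT (fun p => (pz p - X p) ord0 i)) ->
  test_map Phi -> (forall p, dotv (X p) (X p) + dotv (pz p) (pz p) + 1 <= weight p) ->
  exists K, [/\ cont3 (fun p => dotv (Phi (X p)) (pz p - X p)),
    measurable_fun setT (fun p => dotv (Phi (X p)) (pz p - X p)) &
    forall p, dotv (Phi (X p)) (pz p - X p) ^+ 2 <= K * weight p].
Proof.
move=> cX mX cD mD tPhi XW.
have [B HB] := test_map_bounded tPhi; have cPhi : continuous Phi := tPhi.1 0%N.
have cc i : continuous (fun x => Phi x ord0 i).
  move=> x; apply: (@continuous_comp _ _ _ Phi (fun y => y ord0 i)); first exact: cPhi.
  exact: coord_continuous.
(* [|Phi|^2 <= B], and [|z - X|^2 <= 2 (|z|^2 + |X|^2)] is at most [2 weight]. *)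
exists (2 * (B + 1)); split.
- by apply: cont3_dotv => i; [exact: (cX _ (cc i))|exact: cD].
- by apply: measurable_dotv => i; [exact: (mX _ (cc i))|exact: mD].
- move=> p; apply: le_trans (dotv_sq_le _ _) _.
  have := HB (X p); have := dotvBB_le (pz p) (X p); have := dotv_ge0 (pz p - X p).
  have := XW p; have := dotv_ge0 (Phi (X p)).
  move: (weight p) (dotv (Phi _) _) (dotv (pz p - X p) _) (dotv (pz p) _) (dotv (X p) _).
  move=> w F Z z x F0 W0 Z0 Zzx FB.
  have B0 : 0 <= B + 1 by lra.
  apply: (@le_trans _ _ ((B + 1) * Z)); first by rewrite ler_wpM2r// lerD2r.
  by rewrite (mulrC 2) -mulrA ler_wpM2l//; lra.
Qed.

Lemma weight_px {R : realType} d (p : T3 R d) :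
  dotv (px p) (px p) + dotv (pz p) (pz p) + 1 <= weight p.
Proof.
have := dotv_ge0 (py p); rewrite /weight.
by move: (dotv _ _) (dotv (pz p) _) (dotv _ _) => *; lra.
Qed.

Lemma weight_py {R : realType} d (p : T3 R d) :
  dotv (py p) (py p) + dotv (pz p) (pz p) + 1 <= weight p.
Proof.
have := dotv_ge0 (px p); rewrite /weight.
by move: (dotv _ _) (dotv (pz p) _) (dotv _ _) => *; lra.
Qed.

Section StrongDuality.
Context {R : realType} {d : nat}.
Variables (mu nu : probability (Rd R d) R) (I : R).
Hypotheses (mu2 : finite_second_moment mu) (nu2 : finite_second_moment nu).
Hypothesis gapI : forall u, C11_lip1 u -> gap mu nu u <= I.
Let dom := dominated mu nu I.

Let z1 : 'rV[R]_d -> R := fun=> 0.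
Let z2 : 'rV[R]_d -> 'rV[R]_d := fun=> 0.

Let dominated_npos f : (forall p, f p <= 0) -> dom f 0.
Proof.
move=> f0; exists z1, z1, z2, z2, 0; split; [by []|exact: intg_cst|exact: intg_cst| |].
  by move=> p; rewrite /dual_bound /z1 /z2 !dotv0l mul0r !addr0.
by rewrite !Rint_cst mul0r !addr0.
Qed.

Let dominated_px (phi : 'rV[R]_d -> R) : intg mu phi ->
  dom (fun p => phi (px p)) (\int[mu]_x phi x).
Proof.
move=> Iphi; exists phi, z1, z2, z2, 0; split; [by []|exact: Iphi|exact: intg_cst| |].
  by move=> p; rewrite /dual_bound /z1 /z2 !dotv0l mul0r !addr0.
by rewrite Rint_cst mul0r !addr0.
Qed.

Let dominated_py (psi : 'rV[R]_d -> R) : intg nu psi ->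
  dom (fun p => psi (py p)) (\int[nu]_x psi x).
Proof.
move=> Ipsi; exists z1, psi, z2, z2, 0; split; [by []|exact: intg_cst|exact: Ipsi| |].
  by move=> p; rewrite /dual_bound /z1 /z2 !dotv0l mul0r !addr0 add0r.
by rewrite Rint_cst mul0r addr0 add0r.
Qed.

Let dominated_zx (Phi : 'rV[R]_d -> 'rV[R]_d) :
  dom (fun p => dotv (Phi (px p)) (pz p - px p)) 0.
Proof.
exists z1, z1, Phi, z2, 0; split; [by []|exact: intg_cst|exact: intg_cst| |].
  by move=> p; rewrite /dual_bound /z1 /z2 !dotv0l mul0r !addr0 !add0r.
by rewrite !Rint_cst mul0r !addr0.
Qed.

Let dominated_zy (Psi : 'rV[R]_d -> 'rV[R]_d) :
  dom (fun p => dotv (Psi (py p)) (pz p - py p)) 0.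
Proof.
exists z1, z1, z2, Psi, 0; split; [by []|exact: intg_cst|exact: intg_cst| |].
  by move=> p; rewrite /dual_bound /z1 /z2 !dotv0l mul0r !addr0 !add0r.
by rewrite !Rint_cst mul0r !addr0.
Qed.

Let dominated_cost : dom (fun p => cost (px p) (py p) (pz p)) I.
Proof.
exists z1, z1, z2, z2, 1; split; [by []|exact: intg_cst|exact: intg_cst| |].
  by move=> p; rewrite /dual_bound /z1 /z2 !dotv0l mul1r !add0r.
by rewrite !Rint_cst mul1r !add0r.
Qed.

Let quad_growth_cost : quad_growth (fun p : T3 R d => cost (px p) (py p) (pz p)).
Proof. by exists 2 => p; rewrite ger0_norm ?cost_ge0//; exact: cost_le_weight. Qed.

Lemma optimal_coupling : exists pi, Sigma mu nu pi /\ (Jobj pi <= I%:E)%E.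
Proof.
have [L [LD LZ Ldom]] := dual_functional mu2 nu2 gapI.
have Lmono f g : quad_growth f -> quad_growth g -> (forall p, f p <= g p) -> L f <= L g.
  move=> qf qg fg; have qg' := quad_growthZ (-1) qg.
  have := Ldom _ 0 (quad_growthD qf qg') (dominated_npos _).
  rewrite LD// LZ// mulN1r subr_le0; apply => p.
  by rewrite mulN1r subr_le0.
(* Marginals and drifts may be subtracted as well as added in a dual bound, so they yield equalities
   for [L]; the cost has a nonnegative coefficient and yields only [L c <= I]. *)
have Leq f s : quad_growth f -> dom f s -> dom (fun p => -1 * f p) (- s) -> L f = s.
  move=> qf ds dNs; apply/eqP; rewrite eq_le Ldom//=.
  by have := Ldom _ _ (quad_growthZ (-1) qf) dNs; rewrite LZ// mulN1r lerN2.
have Lpx (phi : 'rV[R]_d -> R) : quad_growth (fun p => phi (px p)) -> intg mu phi ->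
    L (fun p => phi (px p)) = \int[mu]_x phi x.
  move=> qf Iphi; apply: Leq qf (dominated_px Iphi) _.
  by have := dominated_px (intgZ (-1) Iphi); rewrite (RintZ (-1) Iphi) mulN1r.
have Lpy (psi : 'rV[R]_d -> R) : quad_growth (fun p => psi (py p)) -> intg nu psi ->
    L (fun p => psi (py p)) = \int[nu]_x psi x.
  move=> qf Ipsi; apply: Leq qf (dominated_py Ipsi) _.
  by have := dominated_py (intgZ (-1) Ipsi); rewrite (RintZ (-1) Ipsi) mulN1r.
have Lzx (Phi : 'rV[R]_d -> 'rV[R]_d) : quad_growth (fun p => dotv (Phi (px p)) (pz p - px p)) ->
    L (fun p => dotv (Phi (px p)) (pz p - px p)) = 0.
  move=> qf; apply: Leq qf (dominated_zx Phi) _; rewrite oppr0.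
  have := dominated_zx (fun x => -1 *: Phi x); congr dom; apply/funext => p.
  by rewrite dotvZl.
have Lzy (Psi : 'rV[R]_d -> 'rV[R]_d) : quad_growth (fun p => dotv (Psi (py p)) (pz p - py p)) ->
    L (fun p => dotv (Psi (py p)) (pz p - py p)) = 0.
  move=> qf; apply: Leq qf (dominated_zy Psi) _; rewrite oppr0.
  have := dominated_zy (fun x => -1 *: Psi x); congr dom; apply/funext => p.
  by rewrite dotvZl.
have L1 : L (fun=> 1) = 1.
  have q1 := bounded_cont_quad_growth (@bounded_cont_cst R d 1).
  by rewrite (Lpx (fun=> 1) q1 (intg_cst _ _)) Rint_cst.
have [pi PL] := functional_measure LD LZ Lmono L1.
have Iw := intg_functional_weight Lmono PL.
have FI := functional_integral LD LZ Lmono PL.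
exists pi; split; last first.
  apply: le_trans (nonneg_integral_le Lmono PL (@cont3_cost R d) (@measurable_cost R d) quad_growth_cost _) _.
    by move=> p; exact: cost_ge0.
  by rewrite lee_fin; exact: Ldom.
have bb n (a b : 'rV[R]_d) : [/\ continuous (box_bump n a b),
    forall x, `|box_bump n a b x| <= 1 & forall m : probability (Rd R d) R, intg m (box_bump n a b)].
  have cb := @Ck_box_bump R d 0 n a b.
  have b1 x : `|box_bump n a b x| <= 1.
    by have /andP[b0 b1] := box_bump_itv n a b x; rewrite ger0_norm.
  split=> // m; apply: (intg_le (continuous_measurable_Rd cb) b1); exact: intg_cst.
have drift0 (X : T3 R d -> 'rV[R]_d) (Phi : 'rV[R]_d -> 'rV[R]_d) :
    forall K, let f p := dotv (Phi (X p)) (pz p - X p) in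
    cont3 f -> measurable_fun setT f -> (forall p, f p ^+ 2 <= K * weight p) ->
    (quad_growth f -> L f = 0) -> (\int[pi]_p (dotv (pz p - X p) (Phi (X p)))%:E = 0)%E.
  move=> K f cf mf fK Lf; have [If fL] := FI f _ cf mf fK.
  rewrite (_ : (fun p => _) = EFin \o f); last by apply/funext => p; rewrite dotvC.
  by rewrite (EFin_Rintegral If) fL Lf//; exact: quad_growth_sq fK.
split; [|split; [|split]].
- rewrite /finite_second_moment3; apply: (@intg_le _ _ _ pi (fun p : T3 R d =>
    enorm (px p) ^+ 2 + enorm (py p) ^+ 2 + enorm (pz p) ^+ 2) weight _ _ Iw).
    rewrite (_ : (fun p => _) = (fun p : T3 R d => weight p + -1)).
      by apply: measurable_funD => //; exact: measurable_weight.
    by apply/funext => p; rewrite !enorm_sq /weight [RHS]addrC addKr.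
  move=> p; rewrite !enorm_sq ger0_norm; last by rewrite !addr_ge0 ?dotv_ge0.
  by rewrite /weight lerDr.
- apply: law_box_bump; first exact: measurable_px.
  move=> n a b; have [cb b1 Ib] := bb n a b.
  have bc : bounded_cont (fun p : T3 R d => box_bump n a b (px p)).
    by split; [exact: cont3_px|exact: continuous_measurable_px|exists 1 => p; exact: b1].
  have [_ ->] := PL _ bc; apply: Lpx; [exact: bounded_cont_quad_growth|exact: Ib].
- apply: law_box_bump; first exact: measurable_py.
  move=> n a b; have [cb b1 Ib] := bb n a b.
  have bc : bounded_cont (fun p : T3 R d => box_bump n a b (py p)).
    by split; [exact: cont3_py|exact: continuous_measurable_py|exists 1 => p; exact: b1].
  have [_ ->] := PL _ bc; apply: Lpy; [exact: bounded_cont_quad_growth|exact: Ib].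
- move=> Phi Psi tPhi tPsi; split.
  + have [K [cf mf fK]] := @drift_bound R d (@px R d) Phi (@cont3_px R d) (@continuous_measurable_px R d)
      (@cont3_zx R d) (@measurable_zx R d) tPhi (@weight_px R d).
    exact: (drift0 _ _ _ cf mf fK (Lzx Phi)).
  + have [K [cf mf fK]] := @drift_bound R d (@py R d) Psi (@cont3_py R d) (@continuous_measurable_py R d)
      (@cont3_zy R d) (@measurable_zy R d) tPsi (@weight_py R d).
    exact: (drift0 _ _ _ cf mf fK (Lzy Psi)).
Qed.

End StrongDuality.

Theorem theorem1p1 (R : realType) (d : nat)
  (mu nu : probability (Rd R d) R) :
  finite_second_moment mu -> finite_second_moment nu ->
  same_barycentre mu nu ->
  (* (i) *)
  (Ival mu nu = Jval mu nu /\
   (exists u, C11_lip1 u /\ Iobj mu nu u = Ival mu nu) /\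
   (exists pi, Sigma mu nu pi /\ Jobj pi = Jval mu nu)) /\
  (* (ii) *)
  (forall (u : 'rV[R]_d -> R) (pi : probability (T3 R d) R),
     C11_lip1 u -> Sigma mu nu pi ->
     ((Iobj mu nu u = Ival mu nu /\ Jobj pi = Jval mu nu) <->
      {ae pi, forall p : T3 R d,
         (u (py p) + dotv (grad u (py p)) (pz p - py p))
         - (u (px p) + dotv (grad u (px p)) (pz p - px p))
         = cost (px p) (py p) (pz p)})).
Proof.
move=> mu2 nu2 bary.
have [u0 C0 max0] := gap_maximiser mu2 nu2 bary.
have [pi0 [S0 J0]] := optimal_coupling mu2 nu2 max0.
have IE : Ival mu nu = (gap mu nu u0)%:E.
  apply/eqP; rewrite eq_le; apply/andP; split.
    apply: ge_ereal_sup => _ [u Cu <-].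
    by rewrite (Iobj_gap mu2 nu2 Cu) lee_fin; exact: max0.
  by apply: ereal_sup_ubound; exists u0 => //; exact: Iobj_gap.
have JE : Jval mu nu = (gap mu nu u0)%:E.
  apply/eqP; rewrite eq_le; apply/andP; split.
    by apply: le_trans J0; apply: ereal_inf_lbound; exists pi0.
  apply: le_ereal_inf_tmp => _ [pi Spi <-].
  by rewrite (Jobj_cost Spi) lee_fin; exact: weak_duality.
split; first split; first by rewrite IE JE.
  split; first by exists u0; split=> //; rewrite IE; exact: Iobj_gap.
  exists pi0; split=> //; apply/eqP; rewrite eq_le JE J0 -JE.
  by apply: ereal_inf_lbound; exists pi0.
move=> u pi Cu Spi; rewrite IE JE (Iobj_gap mu2 nu2 Cu) (Jobj_cost Spi).
rewrite -[X in _ <-> X]/({ae pi, forall p, jet_gap u p = cost (px p) (py p) (pz p)}).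
split=> [[[Eu] [Ep]]|].
  by apply/(duality_equality mu2 nu2 Spi Cu); rewrite Eu Ep.
move=> /(duality_equality mu2 nu2 Spi Cu) E.
(* The common value is squeezed: the gap of [u] is at most that of [u0], which is at most the cost
   of [pi], and [E] identifies the two ends. *)
have A := max0 _ Cu; have B := weak_duality mu2 nu2 Spi C0.
by split; congr EFin; apply/eqP; rewrite eq_le; apply/andP; split=> //; rewrite ?E// -E.
Qed.
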